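(* Let $\alpha,\beta,\gamma$ be real parameters and let $M>0$. For $u\in\mathrm H^1(\mathbb R^2)$ let $$\mathcal E[u]:=\int_{\mathbb R^2}|\nabla u|^2\,dx+\alpha\int_{\mathbb R^2}V\,|u|^2\,dx+2\,\pi\,\beta\int_{\mathbb R^2}W\,|u|^2\,dx+\gamma\int_{\mathbb R^2}|u|^2\,\log|u|^2\,dx\,,$$ where $$V(x)=2\,\log\left(1+|x|^2\right),\qquad W(x)=-\frac1{2\,\pi}\int_{\mathbb R^2}|u(y)|^2\,\log|x-y|\,dy\,,$$ and let $\mathcal H_M:=\{u\in\mathrm H^1(\mathbb R^2):\|u\|_{\mathrm L^2(\mathbb R^2)}^2=M\}$. Then: (i) $\mathcal E$ is not bounded from below on $\mathcal H_M$ if one of the following conditions is satisfied: (a) $\alpha<0$, (b) $\alpha\ge0$ and $M\,\beta>\min\{2\,\alpha-\gamma,\,4\,\alpha-2\,\gamma\}$. (ii) $\mathcal E$ is bounded from below on $\mathcal H_M$ if either $\alpha=0$, $\beta\le0$ and $M\,\beta+2\,\gamma\le0$, or $\alpha>0$ and one of the following conditions is satisfied: (a) $\gamma\le0$ and $M\,\beta\le2\,\alpha$, (b) $\gamma>0$, $M\,\beta\le4\,\alpha-2\,\gamma$ and $M\,\beta<2\,\alpha-\gamma$.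
   Context: $\mathrm H^1(\mathbb R^2)$ is the usual Sobolev space, $\log$ is the natural logarithm and $0\log0=0$. The function $W=(-\Delta)^{-1}|u|^2$ is the solution of $-\Delta W=|u|^2$ given by the Green kernel $-\frac1{2\pi}\log|x-y|$, so that $2\pi\int_{\mathbb R^2}W|u|^2\,dx=-\iint_{\mathbb R^2\times\mathbb R^2}|u(x)|^2\log|x-y|\,|u(y)|^2\,dx\,dy$. The functional $\mathcal E$ is evaluated on those $u$ for which all the integrals appearing are absolutely convergent. *)

(* Defs.v *)
From HB Require Import structures.
From mathcomp Require Import all_boot all_order all_algebra.
From mathcomp Require Import complex.
From mathcomp Require Import all_classical all_reals all_analysis.
Import Order.TTheory GRing.Theory Num.Theory.
Import numFieldNormedType.Exports.

Set Implicit Arguments.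
Unset Strict Implicit.
Unset Printing Implicit Defensive.

Local Open Scope classical_set_scope.
Local Open Scope ring_scope.

(* H^1 may be taken over the reals or over the complex numbers.  Functions are
   always R[i]-valued; [real_valued] restricts to those with zero imaginary
   part. *)
Variant scalars := real_valued | complex_valued.

Section Defs.
Context {R : realType}.

Local Notation R2 := (R * R)%type.

(* Lebesgue measure on the plane.  The sigma-finite instance is restated because
   canonical structure inference does not find the library's one for [\x]; it is
   what makes [leb2 \x leb2] a measure. *)
Definition leb2 : set (measurableTypeR R * measurableTypeR R)%type -> \bar R :=
  ((@lebesgue_measure R) \x (@lebesgue_measure R))%E.

HB.instance Definition _ := Measure.on leb2.

Let leb2_sigma_finite : sigma_finite setT leb2.
Proof.
have /sigma_finiteP[F [TF ndF Foo]] := sigma_finiteT (@lebesgue_measure R).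
exists (fun n => F n `*` F n).
  rewrite -setXTT TF predeqE => -[x y]; split.
    move=> [/= [n _ Fnx] [k _ Fky]]; exists (maxn n k) => //; split.
    - by move: x Fnx; exact/subsetPset/ndF/leq_maxl.
    - by move: y Fky; exact/subsetPset/ndF/leq_maxr.
  by move=> [n _ []/= ? ?]; split; exists n.
move=> k; have [? ?] := Foo k; split; first exact: measurableX.
by rewrite /leb2 product_measure1E// lte_mul_pinfty// ge0_fin_numE.
Qed.

HB.instance Definition _ :=
  Measure_isSigmaFinite.Build _ _ _ leb2 leb2_sigma_finite.

(* The canonical norm of R * R is the max norm, not this one. *)
Definition enorm (x : R2) : R := Num.sqrt (x.1 ^+ 2 + x.2 ^+ 2).

Definition basis2 (i : 'I_2) : R2 := if i == ord0 then (1, 0) else (0, 1).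

Fixpoint Ck (k : nat) (phi : R2 -> R) : Prop :=
  continuous phi /\
  match k with
  | 0 => True
  | k'.+1 => forall i, (forall x, derivable phi x (basis2 i)) /\
                       Ck k' ('D_(basis2 i) phi)
  end.

Definition test_function (phi : R2 -> R) : Prop :=
  (forall k, Ck k phi) /\ compact (closure [set x | phi x != 0]).

Definition weak_partial (i : 'I_2) (f g : R2 -> R) : Prop :=
  forall phi, test_function phi ->
    (\int[leb2]_x (f x * 'D_(basis2 i) phi x) =
     - \int[leb2]_x (g x * phi x))%R.

Definition H1_real (f : R2 -> R) : Prop :=
  f \in Lfun leb2 2%:E /\
  forall i, exists2 g, g \in Lfun leb2 2%:E & weak_partial i f g.

(* Well defined only up to almost everywhere equality, which is all that the
   integral of |grad u|^2 sees. *)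
Definition wpartial (i : 'I_2) (f : R2 -> R) : R2 -> R :=
  xget (cst 0) [set g | g \in Lfun leb2 2%:E /\ weak_partial i f g].

Definition re (u : R2 -> R[i]) : R2 -> R := fun x => complex.Re (u x).
Definition im (u : R2 -> R[i]) : R2 -> R := fun x => complex.Im (u x).

Definition H1 (K : scalars) : set (R2 -> R[i]) :=
  [set u | [/\ H1_real (re u), H1_real (im u) &
               if K is real_valued then forall x, im u x = 0 else True]].

Definition sqmod (u : R2 -> R[i]) (x : R2) : R := ComplexField.Normc.normc (u x) ^+ 2.

Definition sqgrad (u : R2 -> R[i]) (x : R2) : R :=
  \sum_(i < 2) (wpartial i (re u) x ^+ 2 + wpartial i (im u) x ^+ 2).

Definition V (x : R2) : R := 2 * ln (1 + enorm x ^+ 2).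

(* [ln 0 = 0] in the library: this affects only the null set x = y here, and
   gives 0 log 0 = 0 in the entropy term of [energy]. *)
Definition W (u : R2 -> R[i]) (x : R2) : R :=
  - (2 * pi)^-1 * (\int[leb2]_y (sqmod u y * ln (enorm (x - y))))%R.

Definition energy (alpha beta gamma : R) (u : R2 -> R[i]) : R :=
  (\int[leb2]_x sqgrad u x)%R
  + alpha * (\int[leb2]_x (V x * sqmod u x))%R
  + 2 * pi * beta * (\int[leb2]_x (W u x * sqmod u x))%R
  + gamma * (\int[leb2]_x (sqmod u x * ln (sqmod u x)))%R.

(* Absolute convergence of the integrals in [energy] other than that of
   |grad u|^2, finite for u in H^1.  The integral of W |u|^2 is controlled, via
   Fubini, by the third condition. *)
Definition energy_dom : set (R2 -> R[i]) :=
  [set u | [/\ leb2.-integrable setT (fun x => (V x * sqmod u x)%:E),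
     {ae leb2, forall x,
        leb2.-integrable setT (fun y => (sqmod u y * ln (enorm (x - y)))%:E)},
     (leb2 \x leb2)%E.-integrable setT
        (fun z => (sqmod u z.1 * ln (enorm (z.1 - z.2)) * sqmod u z.2)%:E) &
     leb2.-integrable setT (fun x => (sqmod u x * ln (sqmod u x))%:E)]].

Definition sphere (K : scalars) (M : R) : set (R2 -> R[i]) :=
  [set u | H1 K u /\ (\int[leb2]_x sqmod u x)%R = M].

Definition energy_bounded_below (K : scalars) (alpha beta gamma M : R) : Prop :=
  has_lbound (energy alpha beta gamma @` (sphere K M `&` energy_dom)).

End Defs.

(* Main.v *)
(* Write rho = |u|^2 and let K, P, I, S be the integrals of |grad u|^2, of V rho,
   of rho(x) log|x - y| rho(y) and of rho log rho.  By Fubini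
   E = K + alpha P - beta I + gamma S.

   Lower bounds.  Comparing u with its translates by vectors of size h bounds the
   mass of rho above the level 2 M / h^2 by C h^2 K; summing over dyadic levels
   gives S <= eps K + C.  With w = - log rho and w0 its mean, an elementary
   pointwise inequality bounds rho (w / 2 - (eps / 2) |w - w0| - log|z|) by a
   kernel of z alone, integrable uniformly in w0.  Applied to rho at z = x - y and
   at z = x it gives
     I >= - (M / 2) S + (1/4 - eps) D - C   and   P >= - 2 S - 2 eps D / M - C,
   where D is the integral of rho(x) rho(y) |w(x) - w(y)|.  If beta < 0, this
   yields E >= K - kappa S - C with kappa = 2 alpha - beta M / 2 - gamma >= 0, and
   the bound on S concludes.  If beta >= 0, then
   |x - y|^2 <= (1 + |x|^2) (1 + |y|^2) gives I <= (M / 2) P; the bound on S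
   concludes if gamma <= 0, and S + tau P >= - C for tau > 1/2 (the same kernel
   with w0 = 0) if gamma > 0.

   Unboundedness.  Take for u a fixed bump of mass m1 at the origin plus a bump of
   width s and mass m2 centred at distance x0 >= 4 s.  Up to a bounded error,
     E = 4 alpha m2 log x0 - beta (2 m1 m2 log x0 + m2^2 log s) - 2 gamma m2 log s.
   For alpha < 0 let x0 go to infinity with s = 1 and m2 = M.  For x0 = 4 s the
   coefficient of log s is m2 (4 alpha - 2 gamma - beta (2 M - m2)), which is
   negative either for m2 = M or for small m2.  The weak derivatives of u are
   identified with the classical ones by testing against products a(x1) b(x2). *)

Require Import Defs.
From HB Require Import structures.
From mathcomp Require Import all_boot all_order all_algebra.
From mathcomp Require Import complex.
From mathcomp Require Import all_classical all_reals all_analysis.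
From mathcomp Require Import measurable_realfun ring lra.
Import Order.TTheory GRing.Theory Num.Theory.
Import numFieldNormedType.Exports.

Set Implicit Arguments.
Unset Strict Implicit.
Unset Printing Implicit Defensive.

Local Open Scope classical_set_scope.
Local Open Scope ring_scope.

(** * Lebesgue measure on the plane: translations and uniqueness *)

(** The equality case kappa = 0 is allowed when beta < 0, and S tends to minus infinity for
    spread-out densities, so the coefficients M/2 and 2 of S in the lower bounds on I and P have to
    be exact: no small multiple of |S| can be given away. Without the term in eps the pointwise
    bound fails to be integrable: the supremum over r > 0 of r (- (1/2) log r - log|z|)_+ is a
    multiple of |z|^-2, which diverges logarithmically both at 0 and at infinity. The penalty eps |w
    - w0| improves the majorant to |z|^-2 times the smaller of the powers eps and - eps of |z| /
    exp(w0 / 2), whose integral does not depend on w0 by scaling. The price is a multiple of eps D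
    and not of S. It is paid for by applying the bound at that one of x, y where w is larger: half
    the larger value is (w(x) + w(y) + |w(x) - w(y)|) / 4, which puts D / 4 on the good side. The
    potential has no such gain; its loss is balanced against the gain in - beta I, and this balance
    fixes eps. *)

Section translation.
Context {R : realType}.
Local Notation mu := (@lebesgue_measure R).
Local Notation P2 := (measurableTypeR R * measurableTypeR R)%type.
Local Open Scope ereal_scope.

Definition translate (s : R) (x : measurableTypeR R) : measurableTypeR R := (x + s)%R.

Lemma measurable_translate (s : R) : measurable_fun setT (translate s).
Proof. exact: measurable_funD. Qed.

HB.instance Definition _ (s : R) :=
  isMeasurableFun.Build _ _ _ _ (translate s) (measurable_translate s).

Lemma lebesgue_measure_translate (s : R) (A : set R) : measurable A ->
  pushforward mu (translate s) A = mu A.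
Proof.
move=> mA; apply/esym/lebesgue_measure_unique => //= _ [[a b]] _ <-.
rewrite /pushforward.
have -> : translate s @^-1` `]a, b]%classic = `](a - s)%R, (b - s)%R]%classic.
  by apply/seteqP; split => x /=; rewrite /translate !in_itv/= ltrBlDr lerBrDr.
by rewrite !lebesgue_measure_itv/= !lte_fin ltrD2r -!EFinD; congr (if _ then _%:E else _); lra.
Qed.

Lemma ge0_integral_translate (s : R) (f : R -> \bar R) :
  measurable_fun setT f -> (forall x, 0 <= f x) ->
  \int[mu]_x f (x + s)%R = \int[mu]_x f x.
Proof.
move=> mf f0.
transitivity (\int[pushforward mu (translate s)]_x f x).
  by rewrite (ge0_integral_pushforward (measurable_translate s)).
by apply: eq_measure_integral => A mA _; exact: lebesgue_measure_translate.
Qed.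

Lemma measurable_fun_pairD (s : R * R) :
  measurable_fun setT (fun z : measurableTypeR R * measurableTypeR R =>
    (z + s)%R : measurableTypeR R * measurableTypeR R).
Proof.
by apply/measurable_fun_pairP; split; apply: measurable_funD => //=.
Qed.

Lemma ge0_integral_leb2 (f : P2 -> \bar R) :
  measurable_fun setT f -> (forall x, 0 <= f x) ->
  \int[leb2]_z f z = \int[mu]_x \int[mu]_y f (x, y).
Proof. by move=> mf f0; exact: (fubini_tonelli1 f). Qed.

Lemma ge0_integral_leb2' (f : P2 -> \bar R) :
  measurable_fun setT f -> (forall x, 0 <= f x) ->
  \int[leb2]_z f z = \int[mu]_y \int[mu]_x f (x, y).
Proof. by move=> mf f0; exact: (fubini_tonelli2 f). Qed.

Lemma ge0_integral_leb2_translate (s : P2) (f : P2 -> \bar R) :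
  measurable_fun setT f -> (forall x, 0 <= f x) ->
  \int[leb2]_z f (z + s)%R = \int[leb2]_z f z.
Proof.
move=> mf f0.
rewrite (ge0_integral_leb2 (measurableT_comp mf (measurable_fun_pairD s))); last first.
  by move=> x; exact: f0.
rewrite (ge0_integral_leb2 mf f0).
pose F (x : measurableTypeR R) := \int[mu]_y f (x, y).
have mF : measurable_fun setT F by exact: (measurable_fun_fubini_tonelli_F f).
have F0 x : 0 <= F x by apply: integral_ge0 => y _; exact: f0.
rewrite -[RHS](ge0_integral_translate s.1 mF F0).
apply: eq_integral => x _; rewrite /F.
exact: (@ge0_integral_translate s.2 (fun y => f ((x + s.1)%R, y))
  (measurableT_comp mf (measurable_pair1 _)) (fun y => f0 _)).
Qed.
End translation.

Section vanishing.
Local Open Scope ereal_scope.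

(** The integrals of the positive and of the negative part of [f] are finite measures that agree on
    [G]. By uniqueness on a generating pi-system they agree on all measurable sets, so [f] has zero
    integral over each of them. *)
Lemma integral_pi_system_eq0 d (T : measurableType d) (R : realType)
    (mu : {measure set T -> \bar R}) (G : set (set T)) (g : (set T)^nat)
    (f : T -> R) :
  measurable = <<s G >> -> setI_closed G -> (forall i, G (g i)) ->
  \bigcup_k g k = setT -> mu.-integrable setT (EFin \o f) ->
  (forall A, G A -> \int[mu]_(x in A) (f x)%:E = 0) ->
  {ae mu, forall x, f x = 0%R}.
Proof.
move=> mG GI Gg gT intf fG0.
have mf := measurable_int _ intf.
pose F := EFin \o f.
have mFp : measurable_fun setT F^\+ by exact: measurable_funepos.
have mFn : measurable_fun setT F^\- by exact: measurable_funeneg.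
pose m1 A := \int[mu]_(x in A) F^\+ x.
pose m2 A := \int[mu]_(x in A) F^\- x.
have m1_0 : m1 set0 = 0 by rewrite /m1 integral_set0.
have m2_0 : m2 set0 = 0 by rewrite /m2 integral_set0.
have m1_ge0 A : 0 <= m1 A by exact: integral_ge0.
have m2_ge0 A : 0 <= m2 A by exact: integral_ge0.
have m1s : semi_sigma_additive m1 by exact: semi_sigma_additive_nng_induced.
have m2s : semi_sigma_additive m2 by exact: semi_sigma_additive_nng_induced.
pose M1 : {measure set T -> \bar R} :=
  HB.pack m1 (isMeasure.Build _ _ _ m1 m1_0 m1_ge0 m1s).
pose M2 : {measure set T -> \bar R} :=
  HB.pack m2 (isMeasure.Build _ _ _ m2 m2_0 m2_ge0 m2s).
have mGA A : G A -> measurable A by rewrite mG => ?; exact: sub_sigma_algebra.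
have intFA A : measurable A -> mu.-integrable A F.
  by move=> mA; exact: integrableS intf.
have fin1 A : measurable A -> m1 A \is a fin_num.
  move=> mA; apply: integrable_fin_num => //.
  by apply: integrable_funepos => //; exact: intFA.
have fin2 A : measurable A -> m2 A \is a fin_num.
  move=> mA; apply: integrable_fin_num => //.
  by apply: integrable_funeneg => //; exact: intFA.
have M12 A : measurable A -> m1 A = m2 A.
  move=> mA; apply: (measure_unique G g mG GI Gg gT M1 M2) => //.
    move=> B GB; have := fG0 _ GB; rewrite integralE -/(m1 B) -/(m2 B).
    move=> /eqP; rewrite sube_eq; first by rewrite add0e => /eqP.
      by rewrite fin1//; exact: mGA.
    by rewrite fin_num_adde_defl// fin2//; exact: mGA.
  by move=> k; rewrite ltey_eq fin1//; exact: mGA.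
have /(_ _ _)[] := @integral_ae_eq _ T R mu setT measurableT (cst 0) F intf.
- exact: measurable_cst.
- move=> E _ mE; rewrite integral0 integralE -/(m1 E) -/(m2 E) M12//.
  by rewrite subee// fin2.
move=> N [mN N0 sub]; exists N; split => //.
by move=> x /= fx; apply: sub => /= /(_ I) [].
Qed.

End vanishing.

Section rectangles.
Context {R : realType}.
Local Notation P2 := (measurableTypeR R * measurableTypeR R)%type.

Definition orect (a b c d : R) : set P2 := `]a, b[%classic `*` `]c, d[%classic.

Definition orects : set (set P2) :=
  [set A | exists a b c d, A = orect a b c d].

Lemma orectI (a b c d a' b' c' d' : R) :
  orect a b c d `&` orect a' b' c' d' =
  orect (Num.max a a') (Num.min b b') (Num.max c c') (Num.min d d').
Proof.
apply/seteqP; split => -[x y]; rewrite /orect /= !in_itv/= !gt_max !lt_min.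
  by move=> [[/andP[-> ->] /andP[-> ->]] [/andP[-> ->] /andP[-> ->]]].
by move=> [/andP[/andP[-> ->] /andP[-> ->]] /andP[/andP[-> ->] /andP[-> ->]]].
Qed.

Lemma orects_setI_closed : setI_closed orects.
Proof.
move=> _ _ [a [b [c [d ->]]]] [a' [b' [c' [d' ->]]]]; rewrite orectI.
by do 4 eexists.
Qed.

Lemma measurable_orect (a b c d : R) : measurable (orect a b c d).
Proof. by apply: measurableX; exact: measurable_itv. Qed.

Lemma bigcup_orect :
  \bigcup_n orect (- n%:R) n%:R (- n%:R) n%:R = setT.
Proof.
rewrite -subTset => -[x y] _.
exists (Num.truncn (Num.max `|x| `|y|)).+1 => //.
have := truncnS_gt (Num.max `|x| `|y|); rewrite gt_max !ltr_norml /orect /= !in_itv/=.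
by move=> /andP[].
Qed.

Lemma bigcup_itvoo_sym : \bigcup_n `](- n%:R : R), n%:R[%classic = setT.
Proof.
rewrite -subTset => x _; exists (Num.truncn `|x|).+1 => //.
by have := truncnS_gt `|x|; rewrite ltr_norml /= in_itv.
Qed.

(** Both projections are measurable for the sigma-algebra generated by the rectangles, because an
    open strip is a countable union of rectangles. *)
Lemma measurable_orects : @measurable _ P2 = <<s orects >>.
Proof.
rewrite eqEsubset; split; last first.
  apply: smallest_sub; first exact: sigma_algebra_measurable.
  by move=> _ [a [b [c [d ->]]]]; exact: measurable_orect.
pose Q := g_sigma_algebraType orects.
have mopen : @measurable _ (measurableTypeR R) = <<s @RGenOpens.G R >>.
  exact: RGenOpens.measurableE.
pose f1 : Q -> measurableTypeR R := fun z => (z : P2).1.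
pose f2 : Q -> measurableTypeR R := fun z => (z : P2).2.
have m1 : measurable_fun setT f1.
  apply: (@measurability _ _ Q (measurableTypeR R) setT f1 _ mopen) => _ [_ [a [b ->]] <-].
  rewrite setTI; have -> : f1 @^-1` `]a, b[%classic =
      \bigcup_n orect a b (- n%:R) n%:R :> set Q.
    rewrite /orect -setX_bigcupr bigcup_itvoo_sym.
    by apply/seteqP; split => -[x y] /=; [split|case].
  apply: bigcupT_measurable => n; apply: sub_sigma_algebra.
  by do 4 eexists.
have m2 : measurable_fun setT f2.
  apply: (@measurability _ _ Q (measurableTypeR R) setT f2 _ mopen) => _ [_ [a [b ->]] <-].
  rewrite setTI; have -> : f2 @^-1` `]a, b[%classic =
      \bigcup_n orect (- n%:R) n%:R a b :> set Q.
    rewrite /orect -setX_bigcupl bigcup_itvoo_sym.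
    by apply/seteqP; split => -[x y] /=; [split|case].
  apply: bigcupT_measurable => n; apply: sub_sigma_algebra.
  by do 4 eexists.
apply: smallest_sub; first exact: smallest_sigma_algebra.
rewrite subUset; split => _ [A mA <-].
  exact: m1.
exact: m2.
Qed.

(** Cutting [k] off by a square restores integrability, and the integral of the cut-off over a
    rectangle is an integral of [k] over a smaller rectangle. *)
Lemma rect_integral_eq0 (k : P2 -> R) :
  (forall n, leb2.-integrable (orect (- n%:R) n%:R (- n%:R) n%:R) (EFin \o k)) ->
  (forall a b c d, (\int[leb2]_(z in orect a b c d) (k z)%:E = 0)%E) ->
  {ae leb2, forall x, k x = 0%R}.
Proof.
move=> ik k0; pose B n := orect (- n%:R) n%:R (- n%:R) n%:R.
have mB n : measurable (B n) by exact: measurable_orect.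
have H n : {ae leb2, forall x, (k \_ (B n)) x = 0}.
  apply: (@integral_pi_system_eq0 _ _ _ _ orects B) => //.
  - exact: measurable_orects.
  - exact: orects_setI_closed.
  - by move=> i; do 4 eexists.
  - exact: bigcup_orect.
  - by rewrite -restrict_EFin; apply/(integrable_mkcond _ (mB n)); exact: ik.
  - move=> _ [a [b [c [d ->]]]].
    have -> : (fun x => ((k \_ (B n)) x)%:E) = (EFin \o k) \_ (B n).
      by rewrite restrict_EFin.
    by rewrite -integral_mkcondr /B orectI k0.
have := ae_foralln H; apply: filterS => x Hx.
have [n _ Bx] : (\bigcup_n B n) x by rewrite bigcup_orect.
by rewrite -(Hx n) patchE mem_set.
Qed.

End rectangles.

(** * Smooth test functions *)

Section smooth.
Context {R : realType}.
Implicit Types f g : R -> R.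

(** Each derivative is exhibited as a witness rather than computed, so that stability under sums,
    products and affine substitutions is a plain induction on [k]. *)
Fixpoint smooth_n (k : nat) f : Prop :=
  if k is k'.+1 then
    exists2 g : R -> R, (forall x : R, is_derive (x : R) (1 : R) f (g x)) & smooth_n k' g
  else True.

Definition smooth f := forall k, smooth_n k f.

Lemma smooth_nW k f : smooth_n k.+1 f -> smooth_n k f.
Proof.
elim: k f => [//|k IH] f [g fg sg]; exists g => //; exact: IH.
Qed.

Lemma smooth_nD k f g : smooth_n k f -> smooth_n k g ->
  smooth_n k (fun x => f x + g x).
Proof.
elim: k f g => [//|k IH] f g [f' df sf] [g' dg sg].
exists (fun x => f' x + g' x); last exact: IH.
by move=> x; exact: is_deriveD.
Qed.

Lemma smooth_nM k f g : smooth_n k f -> smooth_n k g ->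
  smooth_n k (fun x => f x * g x).
Proof.
elim: k f g => [//|k IH] f g sf sg.
have sfW := smooth_nW sf; have sgW := smooth_nW sg.
move: sf sg => [f' df sf] [g' dg sg].
exists (fun x => f x * g' x + g x * f' x).
  by move=> x; exact: is_deriveM.
by apply: smooth_nD; apply: IH.
Qed.

Lemma smooth_n_cst k (c : R) : smooth_n k (fun=> c).
Proof.
elim: k c => [//|k IH] c; exists (fun=> 0) => // x.
exact: is_derive_cst.
Qed.

Lemma smooth_n_affine k f (a b : R) : smooth_n k f ->
  smooth_n k (fun x => f (a * x + b)).
Proof.
elim: k f => [//|k IH] f [g fg sg].
exists (fun x => g (a * x + b) * a).
  move=> x.
  have ->: (fun x => f (a * x + b)) = f \o (fun x => a * x + b) by [].
  apply: is_derive1_comp; rewrite -[X in is_derive _ _ _ X]addr0.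
  apply: is_deriveD; rewrite -[X in is_derive _ _ _ X]mulr1.
  exact: (is_deriveZ a (is_derive_id x 1)).
by apply: smooth_nM; [exact: IH|exact: smooth_n_cst].
Qed.

Lemma smoothD f g : smooth f -> smooth g -> smooth (fun x => f x + g x).
Proof. by move=> sf sg k; exact: smooth_nD. Qed.

Lemma smoothM f g : smooth f -> smooth g -> smooth (fun x => f x * g x).
Proof. by move=> sf sg k; exact: smooth_nM. Qed.

Lemma smooth_cst (c : R) : smooth (fun=> c).
Proof. by move=> k; exact: smooth_n_cst. Qed.

Lemma smooth_affine f (a b : R) : smooth f -> smooth (fun x => f (a * x + b)).
Proof. by move=> sf k; exact: smooth_n_affine. Qed.

Lemma smooth_is_derive f x : smooth f -> is_derive (x : R) (1 : R) f (f^`()%classic x).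
Proof.
move=> /(_ 1%N)[g fg _]; have := fg x => fgx.
by rewrite derive1E derive_val.
Qed.

Lemma smooth_derive1 f : smooth f -> smooth f^`()%classic.
Proof.
move=> sf k; have [g fg sg] := sf k.+1.
by rewrite (_ : f^`()%classic = g)//; apply/funext => x; rewrite derive1E derive_val.
Qed.

Lemma smooth_primitive f g : (forall x, is_derive (x : R) (1 : R) f (g x)) -> smooth g ->
  smooth f.
Proof. by move=> fg sg [//|k]; exists g. Qed.

Lemma smooth_continuous f : smooth f -> continuous f.
Proof.
move=> sf x; apply: differentiable_continuous; apply/derivable1_diffP.
by have [] := smooth_is_derive x sf.
Qed.

(** The factor t^(-n) is there because the derivatives of exp(-1/t) leave that function alone but
    are linear combinations of members of this family; smoothness of all members is proved
    simultaneously. *)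
Definition flat (n : nat) (t : R) : R :=
  if 0 < t then t^-1 ^+ n * expR (- t^-1) else 0.

(** One term of the exponential series, exp(x) >= x^(n+2) / (n+2)! at x = 1/t. The square on the
    right is what makes the derivative at 0 vanish. *)
Lemma flat_le (n : nat) (t : R) : `|flat n t| <= (n.+2)`!%:R * t ^+ 2.
Proof.
rewrite /flat; case: ifPn => [t0|_]; last first.
  by rewrite normr0 mulr_ge0 ?sqr_ge0.
have ti0 : 0 <= t^-1 by rewrite invr_ge0 ltW.
rewrite ger0_norm ?mulr_ge0 ?exprn_ge0 ?expR_ge0//.
have : t^-1 ^+ n.+2 / (n.+2)`!%:R <= expR t^-1.
  by rewrite (le_trans _ (expR_ge1Dxn n.+1 ti0))// lerDr.
rewrite ler_pdivrMr ?ltr0n ?fact_gt0// => h.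
rewrite expRN ler_pdivrMr ?expR_gt0// mulrAC [leRHS]mulrC.
rewrite -ler_pdivrMl ?exprn_gt0// mulrC [leRHS]mulrC -exprVn -exprD addn2.
by [].
Qed.

Lemma is_derive_flat n (t : R) :
  is_derive t (1 : R) (flat n) (flat n.+2 t - n%:R * flat n.+1 t).
Proof.
have [t0|t0|->] := ltgtP t 0.
- have -> : flat n.+2 t - n%:R * flat n.+1 t = 0.
    by rewrite /flat ltNge (ltW t0)/= mulr0 subr0.
  apply: (@near_eq_is_derive _ _ _ (cst 0)).
  + near=> x; rewrite /flat ltNge ltW//.
    near: x; exact: lt_nbhsl.
- have tn0 : t != 0 by rewrite gt_eqF.
  apply: (@near_eq_is_derive _ _ _ (fun x : R => x^-1 ^+ n * expR (- x^-1))).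
    near=> x; rewrite /flat ifT//.
    near: x; exact: lt_nbhsr.
  have dV : is_derive t (1 : R) (fun x : R => x^-1) (- t ^- 2).
    have := is_deriveV (v := 1) tn0 (is_derive_id t 1).
    by rewrite /GRing.scale /= mulr1.
  have dX : is_derive t (1 : R) (fun x : R => x^-1 ^+ n) (n%:R * t^-1 ^+ n.-1 * - t ^- 2).
    have := is_deriveX n dV.
    by rewrite (_ : (fun x : R => x^-1) ^+ n = (fun x : R => x^-1 ^+ n))// exprfctE.
  have dE : is_derive t (1 : R) (fun x : R => expR (- x^-1)) (expR (- t^-1) * t ^- 2).
    apply: is_derive1_comp; rewrite -[t ^- 2]opprK.
    exact: is_deriveN.
  suff <- : (t^-1 ^+ n) *: (expR (- t^-1) / t ^+ 2) +
      (expR (- t^-1)) *: (n%:R * t^-1 ^+ n.-1 * - t ^- 2) =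
      flat n.+2 t - n%:R * flat n.+1 t by exact: is_deriveM dX dE.
  rewrite /flat t0 /= /GRing.scale /=.
  case: n {dX} => [|n]; rewrite ?mul0r ?subr0 ?oppr0 ?mulr0 ?addr0 -?exprVn.
    by rewrite expr0 mul1r mulrC.
  by rewrite /= !exprS; ring.
- have flat0 m : flat m 0 = 0 by rewrite /flat ltxx.
  rewrite !flat0 mulr0 subr0.
  (* By [flat_le] the difference quotient at 0 is at most this multiple of |h|, and squeezing gives
     the derivative 0. *)
  have H0 : (n.+2)`!%:R * `|h| @[h --> (0 : R)^'] --> (0 : R).
    rewrite -[X in _ --> X](mulr0 (n.+2)`!%:R); apply: cvgMr.
    rewrite -[X in _ --> X](@normr0 _ R); apply: cvg_norm.
    exact: cvg_within.
  have H : h^-1 *: ((flat n \o shift 0) (h *: (1 : R)) - flat n 0) @[h --> 0^'] --> (0 : R).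
    apply: (@squeeze_cvgr _ _ _ _ (fun h => - ((n.+2)`!%:R * `|h|))
      (fun h => (n.+2)`!%:R * `|h|)).
    + near=> h.
      have h0 : h != 0 by near: h; exact: nbhs_dnbhs_neq.
      rewrite -ler_norml /= flat0 subr0 addr0 [h *: 1]mulr1 normrM normfV.
      rewrite mulrC ler_pdivrMr ?normr_gt0// -mulrA -expr2 real_normK ?num_real//.
      exact: flat_le.
    + by rewrite -[X in _ --> X]oppr0; apply: cvgN; exact: H0.
    + exact: H0.
  apply: DeriveDef; first by apply: (cvgP 0).
  exact: cvg_lim.
Unshelve. all: by end_near.
Qed.

Lemma flat_smooth n : smooth (flat n).
Proof.
move=> k; elim: k n => [//|k IH] n.
exists (fun t => flat n.+2 t - n%:R * flat n.+1 t); first exact: is_derive_flat.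
apply: smooth_nD; first exact: IH.
rewrite (_ : (fun x => _) = (fun x => - n%:R * flat n.+1 x)); last first.
  by apply/funext => x; rewrite mulNr.
by apply: smooth_nM; [exact: smooth_n_cst|exact: IH].
Qed.

End smooth.

(** * Product test functions and smooth approximations of indicators *)

Section tests.
Context {R : realType}.
Local Notation P2 := (measurableTypeR R * measurableTypeR R)%type.

Definition bounded_support (a : R -> R) :=
  exists r : R, forall x, r < `|x| -> a x = 0.

Definition smooth_compact (a : R -> R) := smooth a /\ bounded_support a.

Definition tensor (a b : R -> R) (z : R * R) : R := a z.1 * b z.2.

Lemma tensor_continuous (a b : R -> R) : continuous a -> continuous b ->
  continuous (tensor a b).
Proof.
move=> ca cb z; apply: (@cvgM _ _ _ _ (a \o fst) (b \o snd)).
  by apply: cvg_comp; [exact: cvg_fst|exact: ca].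
by apply: cvg_comp; [exact: cvg_snd|exact: cb].
Qed.

Lemma is_derive_tensor0 (a b : R -> R) (z : R * R) : smooth a ->
  is_derive z (basis2 ord0) (tensor a b) (tensor a^`()%classic b z).
Proof.
move=> sa; have [da dav] := smooth_is_derive z.1 sa.
have H : h^-1 *: ((tensor a b \o shift z) (h *: basis2 ord0) - tensor a b z)
    @[h --> 0^'] --> tensor a^`()%classic b z.
  rewrite /tensor /basis2 /=.
  rewrite (_ : (fun h => _) = (fun h => (h^-1 *: ((a \o shift z.1) (h *: 1) - a z.1)) * b z.2)).
    by apply: cvgMl; rewrite -dav; exact: da.
  apply/funext => h; rewrite /= !scaler0 !add0r.
  by rewrite -mulrBl scalerAl.
by apply: DeriveDef; [exact: (cvgP _ H)|exact: cvg_lim].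
Qed.

Lemma is_derive_tensor1 (a b : R -> R) (z : R * R) : smooth b ->
  is_derive z (basis2 (lift ord0 ord0)) (tensor a b) (tensor a b^`()%classic z).
Proof.
move=> sb; have [db dbv] := smooth_is_derive z.2 sb.
have H : h^-1 *: ((tensor a b \o shift z) (h *: basis2 (lift ord0 ord0)) - tensor a b z)
    @[h --> 0^'] --> tensor a b^`()%classic z.
  rewrite /tensor /basis2 /=.
  rewrite (_ : (fun h => _) = (fun h => a z.1 * (h^-1 *: ((b \o shift z.2) (h *: 1) - b z.2)))).
    by apply: cvgMr; rewrite -dbv; exact: db.
  apply/funext => h; rewrite /= !scaler0 !add0r.
  by rewrite -mulrBr scalerAr.
by apply: DeriveDef; [exact: (cvgP _ H)|exact: cvg_lim].
Qed.

Lemma ord2P (P : 'I_2 -> Prop) : P ord0 -> P (lift ord0 ord0) -> forall i, P i.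
Proof.
move=> P0 P1 [[|[|//]] h].
  by rewrite (_ : Ordinal h = ord0)//; exact: val_inj.
by rewrite (_ : Ordinal h = lift ord0 ord0)//; exact: val_inj.
Qed.

Lemma Ck_tensor k (a b : R -> R) : smooth a -> smooth b -> Ck k (tensor a b).
Proof.
elim: k a b => [|k IH] a b sa sb; (split;
  first by apply: tensor_continuous; exact: smooth_continuous) => //.
have sa' := smooth_derive1 sa; have sb' := smooth_derive1 sb.
elim/ord2P; split.
- by move=> z; have [] := is_derive_tensor0 b z sa.
- rewrite (_ : 'D_(basis2 ord0) (tensor a b) = tensor a^`()%classic b); first exact: IH.
  by apply/funext => z; have [] := is_derive_tensor0 b z sa.
- by move=> z; have [] := is_derive_tensor1 a z sb.
- rewrite (_ : 'D_(basis2 (lift ord0 ord0)) (tensor a b) = tensor a b^`()%classic); first exact: IH.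
  by apply/funext => z; have [] := is_derive_tensor1 a z sb.
Qed.

Lemma test_function_tensor (a b : R -> R) :
  smooth_compact a -> smooth_compact b -> test_function (tensor a b).
Proof.
move=> [sa [ra ha]] [sb [rb hb]]; split; first by move=> k; exact: Ck_tensor.
have cK : compact (`[- ra, ra]%classic `*` `[- rb, rb]%classic : set (R * R)).
  by apply: compact_setX; exact: segment_compact.
apply: (subclosed_compact _ cK); first exact: closed_closure.
have clK := compact_closed (@norm_hausdorff _ (R * R)%type) cK.
rewrite [X in _ `<=` X]((closure_id _).1 clK).
apply: closure_subset => -[x y] /= nz; rewrite !in_itv/= -!ler_norml !leNgt.
split; apply/negP => h; move: nz; rewrite /tensor /=.
  by rewrite ha// mul0r eqxx.
by rewrite hb// mulr0 eqxx.
Qed.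

Lemma smooth_compact_derive1 (a : R -> R) : smooth_compact a ->
  smooth_compact a^`()%classic.
Proof.
move=> [sa [r hr]]; split; first exact: smooth_derive1.
exists r => x rx; rewrite derive1E.
rewrite (@near_eq_derive _ _ _ a (cst 0) x 1).
  exact: derive_cst.
have : \forall y \near x, r < `|y|.
  have h : `|y| @[y --> x] --> `|x| by exact: norm_continuous.
  exact: (cvgr_gt _ h _ rx).
by apply: filterS => y; exact: hr.
Qed.

Lemma smooth_compact_bounded (a : R -> R) : smooth_compact a ->
  exists2 C : R, 0 < C & forall x, `|a x| <= C.
Proof.
move=> [sa [r hr]].
have : compact (a @` `[-r, r]%classic).
  apply: continuous_compact; last exact: segment_compact.
  by apply: continuous_subspaceT; exact: smooth_continuous.
move=> /compact_bounded [C [_ HC]].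
exists (`|C| + 1); first by rewrite ltr_wpDl.
move=> x; have [/hr->|xr] := ltP r `|x|; first by rewrite normr0 addr_ge0.
apply: (HC (`|C| + 1)); first by rewrite ltr_pwDr// ler_norm.
by exists x => //=; rewrite in_itv/= -ler_norml.
Qed.

(** Smooth functions below the indicator of ]c, d[ and converging to it pointwise as [n] grows. The
    arguments are spelled as affine functions of [t] to match [smooth_affine]; [plateauE] gives the
    readable form. *)
Definition plateau (c d : R) (n : nat) (t : R) : R :=
  flat 0 (n.+1%:R * t + - n.+1%:R * c) * flat 0 (- n.+1%:R * t + n.+1%:R * d).

Lemma plateauE c d n t :
  plateau c d n t = flat 0 (n.+1%:R * (t - c)) * flat 0 (n.+1%:R * (d - t)).
Proof. by rewrite /plateau; congr (flat _ _ * flat _ _); ring. Qed.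

Lemma flat0_ge0 (t : R) : 0 <= flat 0 t.
Proof. by rewrite /flat; case: ifP => // _; rewrite mul1r expR_ge0. Qed.

Lemma flat0_le1 (t : R) : flat 0 t <= 1.
Proof.
rewrite /flat; case: ifP => // t0.
by rewrite mul1r -expR0 ler_expR oppr_le0 invr_ge0 ltW.
Qed.

Lemma plateau_ge0 c d n t : 0 <= plateau c d n t.
Proof. by rewrite mulr_ge0 ?flat0_ge0. Qed.

Lemma plateau_out c d n t : ~~ (c < t < d) -> plateau c d n t = 0.
Proof.
have n0 : 0 < n.+1%:R :> R by [].
rewrite plateauE /flat !pmulr_rgt0// !subr_gt0.
by rewrite negb_and => /orP[] /negbTE ->; rewrite ?mul0r ?mulr0.
Qed.

Lemma plateau_le c d n t : plateau c d n t <= \1_(`]c, d[%classic) t.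
Proof.
rewrite indicE; case: (boolP (t \in _)) => [_|]; first by rewrite mulr_ile1 ?flat0_ge0 ?flat0_le1.
by rewrite notin_setE /= in_itv/= => /negP/plateau_out ->.
Qed.

Lemma plateau_smooth_compact c d n : smooth_compact (plateau c d n).
Proof.
split; first by apply: smoothM; apply: smooth_affine; exact: flat_smooth.
exists (Num.max `|c| `|d|) => x; rewrite gt_max => /andP[cx dx].
apply: plateau_out; apply/negP => /andP[c1 d1].
have := ler_norm (- c); have := ler_norm d; rewrite normrN => h1 h2.
have [x0|x0] := leP 0 x.
  by move: dx; rewrite (ger0_norm x0); lra.
by move: cx; rewrite (ltr0_norm x0); lra.
Qed.

Lemma flat0_cvg (s : R) : 0 < s -> flat 0 (n.+1%:R * s) @[n --> \oo] --> (1 : R).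
Proof.
move=> s0.
rewrite (_ : (fun n => _) = (fun n => expR (- (s^-1 * n.+1%:R^-1)))); last first.
  apply/funext => n; rewrite /flat pmulr_rgt0// s0 mul1r invfM.
  by rewrite mulrC.
rewrite -[X in _ --> X]expR0; apply: (continuous_cvg _ (@continuous_expR R _)).
rewrite -[X in _ --> X]oppr0; apply: cvgN.
rewrite -[X in _ --> X](mulr0 s^-1); apply: cvgMr.
exact: cvg_harmonic.
Qed.

Lemma plateau_cvg c d t : plateau c d n t @[n --> \oo] --> (\1_(`]c, d[%classic) t : R).
Proof.
rewrite indicE; case: (boolP (t \in _)) => [|].
  rewrite inE /= in_itv/= => /andP[ct td].
  rewrite (_ : (fun n => _) = (fun n => flat 0 (n.+1%:R * (t - c)) * flat 0 (n.+1%:R * (d - t)))).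
    rewrite -[X in _ --> X](mulr1 1).
    by apply: cvgM; apply: flat0_cvg; rewrite subr_gt0.
  by apply/funext => n; rewrite plateauE.
rewrite notin_setE /= in_itv/= => /negP h.
rewrite (_ : (fun n => _) = (fun=> 0)); first exact: cvg_cst.
by apply/funext => n; rewrite plateau_out.
Qed.

End tests.

(** * Locally integrable functions *)

Section locally_integrable.
Context {R : realType}.
Local Notation P2 := (measurableTypeR R * measurableTypeR R)%type.

Definition box (r : R) : set P2 := orect (- r) r (- r) r.

Lemma measurable_box r : measurable (box r).
Proof. exact: measurable_orect. Qed.

Definition loc_integrable (k : P2 -> R) :=
  measurable_fun setT k /\ forall r, leb2.-integrable (box r) (EFin \o k).

Lemma boxE (r : R) (z : P2) : box r z <-> `|z.1| < r /\ `|z.2| < r.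
Proof. by rewrite /box /orect /= !in_itv/= !ltr_norml. Qed.

Lemma orect_sub_box (a b c d : R) : exists r, orect a b c d `<=` box r.
Proof.
exists (`|a| + `|b| + `|c| + `|d|) => -[x y]; rewrite /orect /= !in_itv /=.
move=> [/andP[ax xb] /andP[cy yd]]; apply/boxE => /=.
have := ler_norm a; have := ler_norm b; have := ler_norm c; have := ler_norm d.
have := ler_norm (- a); have := ler_norm (- b); have := ler_norm (- c); have := ler_norm (- d).
rewrite !normrN !ltr_norml; lra.
Qed.

Lemma measurable_tensor (a b : R -> R) : measurable_fun setT a -> measurable_fun setT b ->
  measurable_fun [set: P2] (tensor a b).
Proof.
move=> ma mb; apply: measurable_funM.
  exact: (measurableT_comp ma measurable_fst).
exact: (measurableT_comp mb measurable_snd).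
Qed.

Lemma loc_integrableM (k h : P2 -> R) (C r : R) : loc_integrable k ->
  measurable_fun setT h -> (forall z, `|h z| <= C) ->
  (forall z, ~ box r z -> h z = 0) ->
  leb2.-integrable setT (fun z => (k z * h z)%:E).
Proof.
move=> [mk ik] mh hC h0.
have C0 : 0 <= C := le_trans (normr_ge0 _) (hC 0).
have i1 : leb2.-integrable setT (fun z : P2 => (C%:E * (EFin \o k \_ (box r)) z)%E).
  apply: integrableZl => //; rewrite -restrict_EFin.
  by apply/(integrable_mkcond _ (measurable_box r)).
apply: le_integrable i1 => //.
  by apply/measurable_EFinP; exact: measurable_funM.
move=> z _; rewrite lee_fin /= patchE normrM.
case: ifPn => [_|]; first by rewrite normrM (ger0_norm C0) [leRHS]mulrC ler_wpM2l.
by rewrite notin_setE => /h0 ->; rewrite normr0 mulr0.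
Qed.

Lemma tensor_support (a b : R -> R) : bounded_support a -> bounded_support b ->
  exists r, forall z : P2, ~ box r z -> tensor a b z = 0.
Proof.
move=> [r hr] [s hs]; exists (Num.max r s + 1) => z /boxE/not_andP h.
rewrite /tensor.
have [l1 l2] : r <= Num.max r s /\ s <= Num.max r s by rewrite !le_max !lexx orbT.
by case: h => /negP; rewrite -leNgt => h; [rewrite hr ?mul0r|rewrite hs ?mulr0] => //; lra.
Qed.

Lemma smooth_measurable (a : R -> R) : smooth a -> measurable_fun setT a.
Proof. by move=> /smooth_continuous; exact: continuous_measurable_fun. Qed.

Lemma integrable_tensor (k : P2 -> R) (a b : R -> R) : loc_integrable k ->
  smooth_compact a -> smooth_compact b ->
  leb2.-integrable setT (fun z => (k z * tensor a b z)%:E).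
Proof.
move=> lk sa sb.
have [A A0 hA] := smooth_compact_bounded sa.
have [B B0 hB] := smooth_compact_bounded sb.
have [r hr] := tensor_support sa.2 sb.2.
apply: (loc_integrableM (C := A * B) lk _ _ hr).
  by apply: measurable_tensor; apply: smooth_measurable; [case: sa|case: sb].
by move=> z; rewrite /tensor normrM ler_pM.
Qed.

(** The fundamental lemma of the calculus of variations for product tests: products of plateaus
    converge to the indicator of a rectangle under the majorant |k| times that indicator, and
    vanishing over rectangles is enough. *)
Lemma tensor_integral_eq0 (k : P2 -> R) : loc_integrable k ->
  (forall a b, smooth_compact a -> smooth_compact b ->
     \int[leb2]_z (k z * tensor a b z) = 0) ->
  {ae leb2, forall z, k z = 0}.
Proof.
move=> lk k0; apply: rect_integral_eq0 => [n|a b c d]; first exact: lk.2.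
have [r hr] := orect_sub_box a b c d.
pose t n := tensor (plateau a b n) (plateau c d n).
have mt n : measurable_fun setT (t n : P2 -> R).
  by apply: measurable_tensor; apply: smooth_measurable; apply: proj1 (plateau_smooth_compact _ _ _).
have t_ge0 n z : 0 <= t n z by rewrite mulr_ge0// plateau_ge0.
have indE z : \1_(`]a, b[%classic) z.1 * \1_(`]c, d[%classic) z.2 =
    \1_(orect a b c d) z :> R.
  by rewrite !indicE -natrM mulnb in_setX.
have t_le n z : t n z <= \1_(orect a b c d) z.
  by rewrite -indE ler_pM ?plateau_ge0 ?plateau_le.
have i1 : leb2.-integrable setT (fun z : P2 => (k z * \1_(orect a b c d) z)%:E).
  apply: (loc_integrableM (C := 1) (r := r) lk).
  - by apply: measurable_indic; exact: measurable_orect.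
  - by move=> z; rewrite indicE ger0_norm// lern1 leq_b1.
  - by move=> z nz; rewrite indicE memNset// => /hr.
pose f_ n z := (k z * t n z)%:E.
pose f z := (k z * \1_(orect a b c d) z)%:E.
have mf_ n : measurable_fun setT (f_ n : P2 -> _).
  by apply/measurable_EFinP/measurable_funM => //; case: lk.
have ff_ : {ae leb2, forall z, setT z -> f_ ^~ z @ \oo --> f z}.
  apply: aeW => z _; apply: cvg_EFin; first exact: nearW.
  by apply: cvgMr; rewrite -indE; apply: cvgM; exact: plateau_cvg.
have f_le : {ae leb2, forall z n, setT z -> (`|f_ n z| <= `|f z|)%E}.
  apply: aeW => z n _.
  rewrite lee_fin (normrM (k z) (t n z)) (normrM (k z) (\1_(orect a b c d) z)).
  by rewrite ler_wpM2l// (ger0_norm (t_ge0 n z)) ger0_norm ?t_le// indicE.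
have [_ _] := dominated_convergence measurableT mf_ (measurable_int _ i1) ff_
  (integrable_abse i1) f_le.
rewrite (_ : (fun n => _) = (fun=> 0%E)); last first.
  apply/funext => n; have := k0 _ _ (plateau_smooth_compact a b n) (plateau_smooth_compact c d n).
  rewrite /Rintegral => h.
  (* The hypothesis concerns the real-valued integral, which would also be 0 for an infinite one;
     integrability excludes this. *)
  rewrite -[LHS]fineK ?h//; apply: integrable_fin_num => //.
  by apply: integrable_tensor => //; exact: plateau_smooth_compact.
move=> /cvg_lim; rewrite lim_cst// => I0.
transitivity (\int[leb2]_z f z)%E; last by rewrite -I0.
rewrite [LHS]integral_mkcond; apply: eq_integral => z _.
by rewrite patchE /f indicE; case: (z \in _); rewrite ?mulr1 ?mulr0.
Qed.

End locally_integrable.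

(** * Square integrability, and invariance under translations and the swap of coordinates *)

Section square_integrable.
Context d (T : measurableType d) (R : realType).
Variable mu : {measure set T -> \bar R}.

Lemma Lfun2P (f : T -> R) :
  f \in Lfun mu 2%:E <->
  measurable_fun setT f /\ mu.-integrable setT (fun x => (f x ^+ 2)%:E).
Proof.
split=> [h|[mf /integrableP[_ foo]]].
  split; last exact: Lfun2_integrable_sqr.
  by case/andP: h => /[!inE].
apply/andP; split; rewrite inE//= /finite_norm unlock /Lnorm.
apply: poweR_lty; move: foo.
rewrite (eq_integral (fun x => (`|(f x)%:E| `^ 2)%E))// => x _ /=.
by rewrite powR_mulrn// ger0_norm ?sqr_ge0// -normrX ger0_norm ?sqr_ge0.
Qed.

End square_integrable.

Section invariance.
Context {R : realType}.
Local Notation mu := (@lebesgue_measure R).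
Local Notation P2 := (measurableTypeR R * measurableTypeR R)%type.
Local Open Scope ereal_scope.

(** Tonelli yields invariance for nonnegative functions; positive and negative parts carry it over
    to integrable ones. *)
Lemma integral_preserving (phi : P2 -> P2) (f : P2 -> \bar R) :
  measurable_fun setT phi ->
  (forall g : P2 -> \bar R, measurable_fun setT g -> (forall x, 0 <= g x) ->
     \int[leb2]_z g (phi z) = \int[leb2]_z g z) ->
  leb2.-integrable setT f ->
  leb2.-integrable setT (f \o phi) /\
  \int[leb2]_z f (phi z) = \int[leb2]_z f z.
Proof.
move=> mphi H /integrableP[mf foo]; split.
  apply/integrableP; split; first exact: measurableT_comp.
  rewrite (H (fun x => `|f x|))//.
  exact: measurableT_comp.
rewrite integralE [RHS]integralE; congr (_ - _).
- transitivity (\int[leb2]_z f^\+ (phi z)); last first.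
    by apply: (H f^\+) => //; exact: measurable_funepos.
  by apply: eq_integral => z _; rewrite (funepos_comp f phi).
- transitivity (\int[leb2]_z f^\- (phi z)); last first.
    by apply: (H f^\-) => //; exact: measurable_funeneg.
  by apply: eq_integral => z _; rewrite (funeneg_comp f phi).
Qed.

Lemma integral_leb2_translate (s : P2) (f : P2 -> \bar R) :
  leb2.-integrable setT f ->
  leb2.-integrable setT (fun z => f (z + s)%R) /\
  \int[leb2]_z f (z + s)%R = \int[leb2]_z f z.
Proof.
apply: integral_preserving; first exact: measurable_fun_pairD.
by move=> g mg g0; exact: ge0_integral_leb2_translate.
Qed.

Lemma measurable_swap2 : measurable_fun setT (fun z : P2 => (z.2, z.1) : P2).
Proof. exact: measurable_swap. Qed.

Lemma ge0_integral_leb2_swap (f : P2 -> \bar R) :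
  measurable_fun setT f -> (forall x, 0 <= f x) ->
  \int[leb2]_z f (z.2, z.1) = \int[leb2]_z f z.
Proof.
move=> mf f0; rewrite [RHS]ge0_integral_leb2'// ge0_integral_leb2//.
exact: (measurableT_comp mf measurable_swap2).
Qed.

Lemma integral_leb2_swap (f : P2 -> \bar R) :
  leb2.-integrable setT f ->
  leb2.-integrable setT (fun z => f (z.2, z.1)) /\
  \int[leb2]_z f (z.2, z.1) = \int[leb2]_z f z.
Proof.
apply: integral_preserving; first exact: measurable_swap2.
exact: ge0_integral_leb2_swap.
Qed.

End invariance.

Section L2_plane.
Context {R : realType}.
Local Notation P2 := (measurableTypeR R * measurableTypeR R)%type.

Lemma leb2_orect (a b c d : R) : a <= b -> c <= d ->
  leb2 (orect a b c d) = ((b - a) * (d - c))%:E.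
Proof.
move=> ab cd; rewrite /leb2 /orect product_measure1E//=.
rewrite !lebesgue_measure_itv/= !lte_fin EFinM -!EFinB.
have -> : (if a < b then (b - a)%:E else 0%E) = (b - a)%:E.
  by case: ltP => // ba; rewrite (@le_anti _ _ a b) ?ab// subrr.
by case: ltP => // dc; rewrite (@le_anti _ _ c d) ?cd// subrr.
Qed.

Lemma leb2_box_lty (r : R) : (leb2 (box r) < +oo)%E.
Proof.
apply: (@le_lt_trans _ _ (leb2 (box `|r|))).
  rewrite le_measure ?inE//; try exact: measurable_box.
  move=> z /boxE[z1 z2]; apply/boxE.
  by have := ler_norm r => ?; split; lra.
rewrite leb2_orect ?ltry//; have := normr_ge0 r; lra.
Qed.

(** On a square, which has finite measure, |f| <= 1 + f^2. *)
Lemma Lfun2_loc_integrable (f : P2 -> R) :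
  f \in Lfun leb2 2%:E -> loc_integrable f.
Proof.
move=> /Lfun2P[mf if2]; split=> // r.
have mB := measurable_box r.
have i1 : leb2.-integrable (box r) (EFin \o (fun x : P2 => 1 + f x ^+ 2)).
  rewrite (_ : EFin \o _ = (fun=> 1%:E) \+ (fun x => (f x ^+ 2)%:E)); last first.
    by apply/funext => x /=; rewrite EFinD.
  apply: integrableD => //; last exact: integrableS if2.
  apply: measurable_bounded_integrable => //; first exact: leb2_box_lty.
  by exists 1; split => // M M1 x _ /=; rewrite normr1 ltW.
apply: le_integrable i1 => //.
  by apply/measurable_EFinP; exact: measurable_funTS.
move=> z _; rewrite lee_fin /= [leRHS]ger0_norm ?addr_ge0 ?sqr_ge0//.
rewrite -(real_normK (num_real (f z))).
have := sqr_ge0 (`|f z| - 1); have := sqr_ge0 `|f z|; nra.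
Qed.

End L2_plane.

(** * Weak derivatives and translations *)

Section sliding.
Context {R : realType}.
Local Notation mu := (@lebesgue_measure R).

Lemma smooth_compact_integrable (a : R -> R) : smooth_compact a ->
  mu.-integrable setT (EFin \o a).
Proof.
move=> [sa [r hr]].
have ca : {within `[- r, r], continuous a}.
  by apply: continuous_subspaceT; exact: smooth_continuous.
have ia := continuous_compact_integrable (@segment_compact _ (- r) r) ca.
have -> : EFin \o a = (EFin \o a) \_ (`[- r, r]).
  apply/funext => x; rewrite patchE /=; case: ifPn => //.
  rewrite notin_setE /= in_itv/= -ler_norml => /negP; rewrite -ltNge => /hr ->.
  by [].
have mI : measurable (`[- r, r]%classic : set (measurableTypeR R)) by exact: measurable_itv.
by apply/(integrable_mkcond _ mI).
Qed.

Lemma smooth_compact_primitive (a : R -> R) : smooth_compact a ->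
  exists2 P : R -> R, smooth P & forall x : R, is_derive x (1 : R) P (a x).
Proof.
move=> ca; pose P x := \int[mu]_(t in `]-oo, x]) a t.
have dP x : is_derive (x : R) (1 : R) P (a x).
  have [||||dp pE] := @continuous_FTC1 R a -oo%O x (x + 1).
  - by rewrite ltrDl.
  - apply: integrableS (smooth_compact_integrable ca) => //.
  - by rewrite ltNyr.
  - by apply: smooth_continuous; case: ca.
  - by apply: DeriveDef; [exact: dp|rewrite -derive1E; exact: pE].
by exists P => //; apply: (smooth_primitive dP); case: ca.
Qed.

(** [A] is the sliding average P(x) - P(x - h) of [a], with P a primitive. Unlike P it has bounded
    support, so it is an admissible test function, and its derivative is the increment of [a] over
    the step [h]. *)
Lemma smooth_compact_sliding (a : R -> R) (h : R) : smooth_compact a -> 0 < h ->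
  exists A : R -> R, [/\ smooth_compact A,
    forall x : R, is_derive x (1 : R) A (a x - a (x - h)) &
    forall x, (\int[mu]_(s in `[0%R, h]) (a (x - s))%:E = (A x)%:E)%E].
Proof.
move=> ca h0; have [P sP dP] := smooth_compact_primitive ca.
have [sa [r hr]] := ca.
pose A x := P x - P (x - h).
have dPc (b c : R) x : is_derive (x : R) (1 : R) (fun y => P (b * y + c)) (b * a (b * x + c)).
  rewrite mulrC.
  have -> : (fun y => P (b * y + c)) = P \o (fun y => b * y + c) by [].
  apply: is_derive1_comp; rewrite -[X in is_derive _ _ _ X]addr0.
  apply: is_deriveD; rewrite -[X in is_derive _ _ _ X]mulr1.
  exact: (is_deriveZ b (is_derive_id x 1)).
have AE x : (\int[mu]_(s in `[0%R, h]) (a (x - s))%:E = (A x)%:E)%E.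
  pose F s := - P (-1 * s + x).
  have dF s : is_derive (s : R) (1 : R) F (a (x - s)).
    have := is_deriveN (dPc (-1) x s); rewrite !mulN1r opprK.
    by rewrite addrC.
  have cF : continuous F.
    move=> s; apply: differentiable_continuous; apply/derivable1_diffP.
    by have [] := dF s.
  rewrite (@continuous_FTC2 R (fun s => a (x - s)) F 0 h)//.
  - by rewrite -EFinB /F /A mulN1r mulr0 add0r opprK addrC [- h + x]addrC.
  - apply: continuous_subspaceT => s.
    apply: continuous_comp; last exact: smooth_continuous.
    by apply: cvgB; [exact: cvg_cst|exact: cvg_id].
  - split.
    + by move=> s _; have [] := dF s.
    + exact: cvg_at_right_filter (cF 0).
    + exact: cvg_at_left_filter (cF h).
  - by move=> s _; rewrite derive1E; have [] := dF s.
exists A; split => //.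
  split.
    apply: smoothD => // k.
    rewrite (_ : (fun x => _) = (fun x => -1 * P (1 * x + - h))); last first.
      by apply/funext => x; rewrite mulN1r mul1r.
    apply: smooth_nM; first exact: smooth_n_cst.
    exact: smooth_n_affine.
  exists (r + h) => x rx.
  apply: EFin_inj; rewrite -AE integral0_eq// => s /=; rewrite in_itv/= => /andP[s0 sh].
  rewrite hr//; apply: (@lt_le_trans _ _ (`|x| - `|s|)); last exact: lerB_dist.
  rewrite (ger0_norm s0); lra.
move=> x; have := dPc 1 (- h) x; rewrite !mul1r => dPh.
rewrite (_ : A = P - (fun y => P (1 * y + - h))); first exact: is_deriveB.
by apply/funext => y; rewrite /A -[in LHS](mul1r y) /= !fctE !mul1r.
Qed.

End sliding.

Section line_average.
Context {R : realType}.
Local Notation mu := (@lebesgue_measure R).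
Local Notation R1 := (measurableTypeR R).
Local Notation P2 := (measurableTypeR R * measurableTypeR R)%type.
Local Open Scope ereal_scope.

Variables (g : P2 -> R) (lg : loc_integrable g) (h : R).
Hypothesis h0 : (0 < h)%R.

Let mg : measurable_fun setT g. Proof. by case: lg. Qed.

(** Only shifts along the first axis are treated; the second axis is reached by swapping the
    coordinates. *)
Definition hshift (w : P2 * R1) : P2 := (w.1.1 + w.2, w.1.2)%R.

Lemma measurable_hshift : measurable_fun setT hshift.
Proof.
apply/measurable_fun_pairP; split.
- apply: measurable_funD => //=.
  exact: (measurableT_comp measurable_fst measurable_fst).
- exact: (measurableT_comp measurable_snd measurable_fst).
Qed.

Let I : set R1 := `[0%R, h]%classic.
Let mI : measurable I. Proof. exact: measurable_itv. Qed.

(** [F1 t] puts the average over [0, h] on [g], and [F2 t] below puts it on [t]. For a fixed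
    parameter s they are translates of each other, so exchanging the order of integration identifies
    their integrals. *)
Let F1 (t : P2 -> R) (w : P2 * R1) : \bar R :=
  (g (hshift w) * (t w.1 * \1_I w.2))%:E.
Let F2 (t : P2 -> R) (w : P2 * R1) : \bar R :=
  (g w.1 * (t (hshift (w.1, - w.2)%R) * \1_I w.2))%:E.

Let mI2 : measurable_fun setT (fun w : P2 * R1 => \1_I w.2 : R).
Proof. by apply: measurableT_comp; [exact: measurable_indic|exact: measurable_snd]. Qed.

Let mF1 t : measurable_fun setT t -> measurable_fun setT (F1 t).
Proof.
move=> mt; apply/measurable_EFinP/measurable_funM.
  exact: (measurableT_comp mg measurable_hshift).
by apply: measurable_funM => //; exact: (measurableT_comp mt measurable_fst).
Qed.

Let mF2 t : measurable_fun setT t -> measurable_fun setT (F2 t).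
Proof.
move=> mt; apply/measurable_EFinP/measurable_funM.
  exact: (measurableT_comp mg measurable_fst).
apply: measurable_funM => //; apply: (measurableT_comp mt).
apply: (measurableT_comp measurable_hshift).
apply/measurable_fun_pairP; split; first exact: measurable_fst.
exact: (measurable_funN measurable_snd).
Qed.

Section bounded_test.
Variables (t : P2 -> R) (C r : R).
Hypothesis mt : measurable_fun setT t.
Hypothesis tC : forall z, (`|t z| <= C)%R.
Hypothesis t0 : forall z, ~ box r z -> t z = 0%R.

Let N := \int[leb2]_(z in box (r + h)) `|(g z)%:E|.

Let Noo : N < +oo.
Proof. by have [_ /(_ (r + h)%R)/integrableP[_]] := lg. Qed.

Let N0 : 0 <= N. Proof. exact: integral_ge0. Qed.

Let C0 : (0 <= C)%R. Proof. exact: le_trans (tC 0%R). Qed.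

(** A shift by s in [0, h] moves the support of [t] into the square of half-side r + h, so a single
    local norm of [g] serves all s. *)
Let slice (s : R1) : \int[leb2]_z `|F1 t (z, s)| <= C%:E * N * (\1_I s)%:E.
Proof.
have mFs : measurable_fun setT (fun z => `|F1 t (z, s)|).
  apply: measurableT_comp => //.
  exact: (measurableT_comp (mF1 mt) (measurable_pair2 s)).
rewrite indicE; case: (boolP (s \in I)) => sI; last first.
  rewrite mule0 integral0_eq// => z _; rewrite /F1 /= indicE (negbTE sI).
  by rewrite !mulr0 normr0.
rewrite mule1.
pose K : P2 -> \bar R := (fun z => `|(g z)%:E|) \_ (box (r + h)).
have mK : measurable_fun setT K.
  apply/(measurable_restrictT _ (measurable_box _)).
  by apply: measurable_funTS; do 2 apply: measurableT_comp => //.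
have K0 z : 0 <= K z by rewrite /K patchE; case: ifPn.
have -> : N = \int[leb2]_z K (z + (s, 0%R))%R.
  by rewrite (ge0_integral_leb2_translate (s, 0%R) mK K0) /N integral_mkcond.
rewrite -ge0_integralZl//=.
- apply: ge0_le_integral => //.
  + apply: emeasurable_funM => //.
    exact: (measurableT_comp mK (measurable_fun_pairD _)).
  + move=> z _; rewrite /F1 /= indicE sI mulr1 /K patchE.
    have -> : hshift (z, s) = (z + (s, 0))%R :> P2.
      by rewrite /hshift /=; congr (_, _); rewrite /= addr0.
    have [zB|zB] := pselect (box r z); last first.
      rewrite t0// mulr0 normr0; case: ifPn => _; last by rewrite mule0.
      by rewrite mule_ge0// lee_fin.
    rewrite mem_set; first by rewrite -EFinM lee_fin normrM mulrC ler_wpM2r.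
    move: zB sI => /boxE[z1 z2]; rewrite inE /I /= in_itv/= => /andP[s0 sh].
    apply/boxE; split => /=.
      by rewrite (le_lt_trans (ler_normD _ _))// (ger0_norm s0) ltr_leD.
    by rewrite addr0; lra.
- exact: (measurableT_comp mK (measurable_fun_pairD _)).
Qed.

Let slices_lty : \int[mu]_s (C%:E * N * (\1_I s)%:E) < +oo.
Proof.
rewrite ge0_integralZl//=; last 2 first.
- by apply/measurable_EFinP; exact: measurable_indic.
- by rewrite mule_ge0// lee_fin.
rewrite integral_indic// setIT lte_mul_pinfty ?mule_ge0 ?lee_fin//.
  by rewrite fin_numM// ge0_fin_numE.
by rewrite /I /= lebesgue_measure_itv/= lte_fin h0 -EFinB ltry.
Qed.

Let iF1 : (leb2 \x mu).-integrable setT (F1 t).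
Proof.
apply/integrable21ltyP; first exact: mF1.
apply: le_lt_trans slices_lty; apply: ge0_le_integral => //.
- by move=> s _; exact: integral_ge0.
- apply: (measurable_fun_fubini_tonelli_G (fun w => `|F1 t w|)) => //.
  by apply: measurableT_comp => //; exact: mF1.
- apply: emeasurable_funM => //.
  by apply/measurable_EFinP; exact: measurable_indic.
Qed.

Let F12 (s : R1) (z : P2) : F2 t ((z + (s, 0))%R : P2, s) = F1 t (z, s).
Proof.
have -> : (z + (s, 0))%R = (z.1 + s, z.2)%R :> P2.
  by rewrite [LHS]surjective_pairing /= addr0.
by rewrite /F2 /F1 /hshift /= addrK -surjective_pairing.
Qed.

Let iF2 : (leb2 \x mu).-integrable setT (F2 t).
Proof.
apply/integrable21ltyP; first exact: mF2.
apply: le_lt_trans slices_lty; apply: ge0_le_integral => //.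
- by move=> s _; exact: integral_ge0.
- apply: (measurable_fun_fubini_tonelli_G (fun w => `|F2 t w|)) => //.
  by apply: measurableT_comp => //; exact: mF2.
- apply: emeasurable_funM => //.
  by apply/measurable_EFinP; exact: measurable_indic.
- move=> s _; apply: le_trans (slice s).
  rewrite -(@ge0_integral_leb2_translate _ (s, 0%R) (fun z => `|F2 t (z, s)|))//.
    by under eq_integral do rewrite F12.
  by apply: measurableT_comp => //; exact: (measurableT_comp (mF2 mt) (measurable_pair2 s)).
Qed.

Lemma line_average_integrable : (leb2 \x mu).-integrable setT (F1 t).
Proof. exact: iF1. Qed.

Lemma line_average_fubini :
  \int[leb2]_z \int[mu]_s F1 t (z, s) = \int[leb2]_z \int[mu]_s F2 t (z, s).
Proof.
rewrite (Fubini iF1) (Fubini iF2).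
have := ae_integrable2 iF2.
move=> ae2; apply: ae_eq_integral => //.
- exact: (measurable_fubini_G iF1).
- exact: (measurable_fubini_G iF2).
- apply: filterS ae2 => s is2 _.
  rewrite -[RHS](integral_leb2_translate (s, 0%R) is2).2.
  by apply: eq_integral => z _; rewrite F12.
Qed.

End bounded_test.

Definition line_average (z : P2) : R := (\int[mu]_(s in I) g (hshift (z, s)))%R.

Let indic_box r : measurable_fun setT (\1_(box r) : P2 -> R).
Proof. by apply: measurable_indic; exact: measurable_box. Qed.

Let indic_box1 (r : R) (z : P2) : (`|\1_(box r) z : R| <= 1)%R.
Proof. by rewrite indicE ger0_norm// lern1 leq_b1. Qed.

Let indic_box0 (r : R) (z : P2) : ~ box r z -> \1_(box r) z = 0%R :> R.
Proof. by move=> nz; rewrite indicE memNset. Qed.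

(** Fubini gives this for almost every z of each square, by taking the indicator of the square as
    the test; countably many squares cover the plane. *)
Lemma ae_line_integrable :
  {ae leb2, forall z, mu.-integrable I (fun s => (g (hshift (z, s)))%:E)}.
Proof.
have H n := ae_integrable1 (line_average_integrable (indic_box n%:R)
  (@indic_box1 n%:R) (@indic_box0 n%:R)).
apply: filterS (ae_foralln H) => z Hz.
have [n _ Bz] : (\bigcup_n orect (- n%:R) n%:R (- n%:R) n%:R) z.
  by rewrite bigcup_orect.
apply/(integrable_mkcond _ mI); have := Hz n.
congr (_.-integrable _ _); apply/funext => s.
rewrite /F1 /= !indicE mem_set//= mul1r patchE.
by case: (s \in I); rewrite ?mulr1 ?mulr0.
Qed.

Lemma measurable_line_average : measurable_fun setT line_average.
Proof.
have m1 : measurable_fun setT (F1 (fun=> 1%R)) by exact: mF1.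
pose G z := \int[mu]_s F1 (fun=> 1%R) (z, s).
have mG : measurable_fun setT G.
  rewrite (_ : G = (fun z => \int[mu]_s (F1 (fun=> 1%R))^\+ (z, s)) \-
                   (fun z => \int[mu]_s (F1 (fun=> 1%R))^\- (z, s))).
    apply: emeasurable_funB; apply: measurable_fun_fubini_tonelli_F => //.
      exact: measurable_funepos.
    exact: measurable_funeneg.
  apply/funext => z; rewrite /G integralE; congr (_ - _).
    by apply: eq_integral => s _; rewrite (funepos_comp (F1 (fun=> 1%R)) (pair z)).
  by apply: eq_integral => s _; rewrite (funeneg_comp (F1 (fun=> 1%R)) (pair z)).
rewrite (_ : line_average = fine \o G); first exact: measurableT_comp.
apply/funext => z; rewrite /line_average /Rintegral /G /=; congr fine.
rewrite integral_mkcond; apply: eq_integral => s _; rewrite patchE /F1 /= indicE mul1r.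
by case: (s \in I); rewrite ?mulr1 ?mulr0.
Qed.

Let line_averageE (t : P2 -> R) : {ae leb2, forall z,
  (line_average z * t z)%:E = \int[mu]_s F1 t (z, s)}.
Proof.
apply: filterS ae_line_integrable => z iz.
rewrite /line_average /Rintegral EFinM muleC fineK ?integrable_fin_num//.
rewrite -integralZl// [LHS]integral_mkcond; apply: eq_integral => s _.
rewrite patchE /F1 /= indicE; case: (s \in I); last by rewrite !mulr0.
by rewrite mulr1 -EFinM mulrC.
Qed.

Lemma loc_integrable_line_average : loc_integrable line_average.
Proof.
split; first exact: measurable_line_average.
move=> r; apply/(integrable_mkcond _ (measurable_box r)).
have i1 := integrable_fubini_F (line_average_integrable (indic_box r)
  (@indic_box1 r) (@indic_box0 r)).
apply/integrableP; split.
  apply/(measurable_restrictT _ (measurable_box _))/measurable_funTS.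
  by apply/measurable_EFinP; exact: measurable_line_average.
move: i1 => /integrableP[m1 i1]; apply: le_lt_trans i1.
rewrite le_eqVlt; apply/orP; left; apply/eqP.
apply: ae_eq_integral => //.
- apply: measurableT_comp => //.
  apply/(measurable_restrictT _ (measurable_box _))/measurable_funTS.
  by apply/measurable_EFinP; exact: measurable_line_average.
- exact: measurableT_comp.
- apply: filterS (line_averageE (\1_(box r))) => z Hz _.
  rewrite /= /fubini_F -[X in _ = `|X|]Hz patchE indicE; case: (z \in _); rewrite ?mulr1 ?mulr0//.
Qed.

(** The average is transferred from [g] to the first factor of the test function, where it becomes
    the sliding average [A]. *)
Lemma line_average_tensor (a b A : R -> R) :
  smooth_compact a -> smooth_compact b -> smooth_compact A ->
  (forall x, \int[mu]_(s in I) (a (x - s)%R)%:E = (A x)%:E) ->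
  \int[leb2]_z (line_average z * tensor a b z)%:E =
  \int[leb2]_z (g z * tensor A b z)%:E.
Proof.
move=> ca cb cA AE.
have [Ca Ca0 hCa] := smooth_compact_bounded ca.
have [Cb Cb0 hCb] := smooth_compact_bounded cb.
have [r hr] := tensor_support ca.2 cb.2.
have mab : measurable_fun setT (tensor a b : P2 -> R).
  by apply: measurable_tensor; apply: smooth_measurable; [case: ca|case: cb].
have tC z : (`|tensor a b z| <= Ca * Cb)%R by rewrite /tensor normrM ler_pM.
transitivity (\int[leb2]_z \int[mu]_s F1 (tensor a b) (z, s)).
  apply: ae_eq_integral => //.
  - apply/measurable_EFinP/measurable_funM => //; exact: measurable_line_average.
  - exact: measurable_fubini_F (line_average_integrable mab tC hr).
  - by apply: filterS (line_averageE (tensor a b)).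
rewrite (line_average_fubini mab tC hr); apply: eq_integral => z _.
rewrite /F2 /tensor /hshift /= EFinM [in RHS]EFinM.
rewrite -(AE z.1) [_ * (b z.2)%:E]muleC muleA -EFinM -integralZl//; last first.
  apply: (@continuous_compact_integrable _ (fun s => a (z.1 - s)%R)).
    exact: segment_compact.
  apply: continuous_subspaceT => s; apply: continuous_comp.
    by apply: cvgB; [exact: cvg_cst|exact: cvg_id].
  by apply: smooth_continuous; case: ca.
rewrite [RHS]integral_mkcond; apply: eq_integral => s _.
rewrite patchE indicE; case: (s \in I); last by rewrite !mulr0.
by rewrite mulr1 -!EFinM; congr EFin; ring.
Qed.

End line_average.

(** * Increments of weakly differentiable functions *)

Section translation_estimate.
Context {R : realType}.
Local Notation mu := (@lebesgue_measure R).
Local Notation R1 := (measurableTypeR R).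
Local Notation P2 := (measurableTypeR R * measurableTypeR R)%type.

(** The weak derivative along the first axis, tested against products only. This form is preserved
    by the swap of coordinates, which turns the second partial derivative into a first one. *)
Definition tensor_weak (f g : P2 -> R) : Prop :=
  forall a b, smooth_compact a -> smooth_compact b ->
    \int[leb2]_z (f z * tensor a^`()%classic b z) =
    - \int[leb2]_z (g z * tensor a b z).

Lemma weak_partial_tensor0 (f g : P2 -> R) : weak_partial ord0 f g -> tensor_weak f g.
Proof.
move=> w a b ca cb; rewrite -(w _ (test_function_tensor ca cb)).
apply: eq_Rintegral => z _; congr (_ * _).
by have [] := is_derive_tensor0 b z ca.1.
Qed.

Lemma weak_partial_tensor1 (f g : P2 -> R) :
  loc_integrable f -> loc_integrable g ->
  weak_partial (lift ord0 ord0) f g ->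
  tensor_weak (fun z => f (z.2, z.1)) (fun z => g (z.2, z.1)).
Proof.
move=> lf lg w a b ca cb.
have sw (k : P2 -> R) (c d : R -> R) : loc_integrable k ->
    smooth_compact c -> smooth_compact d ->
    \int[leb2]_z (k (z.2, z.1) * tensor c d z) = \int[leb2]_z (k z * tensor d c z).
  move=> lk cc cd; rewrite /Rintegral; congr fine.
  rewrite -(integral_leb2_swap (integrable_tensor lk cd cc)).2.
  by apply: eq_integral => z _; rewrite /tensor /= [c _ * _]mulrC.
rewrite !sw//; last exact: smooth_compact_derive1.
rewrite -(w _ (test_function_tensor cb ca)).
apply: eq_Rintegral => z _; congr (_ * _).
by have [] := is_derive_tensor1 b z ca.1.
Qed.

Lemma loc_integrable_translate (f : P2 -> R) (h : R) : loc_integrable f ->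
  loc_integrable (fun z => f (z + (h, 0))).
Proof.
move=> [mf lf]; split; first exact: (measurableT_comp mf (measurable_fun_pairD _)).
move=> r; apply/(integrable_mkcond _ (measurable_box r)).
have i1 : leb2.-integrable setT ((EFin \o f) \_ (box (r + `|h|))).
  by apply/(integrable_mkcond _ (measurable_box _)).
have [i2 _] := integral_leb2_translate (h, 0) i1.
apply: le_integrable i2 => //.
  apply/(measurable_restrictT _ (measurable_box _))/measurable_funTS.
  by apply/measurable_EFinP; exact: (measurableT_comp mf (measurable_fun_pairD _)).
move=> z _; rewrite !patchE; case: ifPn => [|_]; last by rewrite abse0 abse_ge0.
rewrite inE => /boxE[z1 z2]; rewrite mem_set//; apply/boxE; split => /=.
  by rewrite (le_lt_trans (ler_normD _ _))// ltrD2r.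
by rewrite addr0 (lt_le_trans z2)// lerDl.
Qed.

Lemma loc_integrableB (f g : P2 -> R) : loc_integrable f -> loc_integrable g ->
  loc_integrable (fun z => f z - g z).
Proof.
move=> [mf lf] [mg lg]; split; first exact: measurable_funB.
move=> r; rewrite (_ : _ \o _ = (EFin \o f) \- (EFin \o g))%E; last first.
  by apply/funext => z /=; rewrite EFinB.
by apply: integrableB => //; exact: measurable_box.
Qed.

(** The fundamental theorem of calculus for weak derivatives. Against a(x1) b(x2) the increment of
    [f] becomes minus the integral of f A' b with [A] the sliding average of [a], hence the integral
    of g A b, which is the line average of [g] tested against the same product. *)
Lemma tensor_weak_translate (f g : P2 -> R) (h : R) : 0 < h ->
  loc_integrable f -> loc_integrable g -> tensor_weak f g ->
  {ae leb2, forall z : P2, f (z + (h, 0)) - f z = line_average g h z}.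
Proof.
move=> h0 lf lg w.
have lfh := loc_integrable_translate h lf.
have lla := loc_integrable_line_average lg h0.
suff : {ae leb2, forall z : P2, f (z + (h, 0)) - f z - line_average g h z = 0}.
  by move=> H; apply: filterS H => z /eqP; rewrite subr_eq0 => /eqP.
apply: tensor_integral_eq0; first by apply: loc_integrableB => //; exact: loc_integrableB.
move=> a b ca cb.
have [A [cA dA AE]] := smooth_compact_sliding ca h0.
have i1 := integrable_tensor lfh ca cb.
have i2 := integrable_tensor lf ca cb.
have i3 := integrable_tensor lla ca cb.
rewrite (_ : (fun z => _) = (fun z => f (z + (h, 0)) * tensor a b z -
   f z * tensor a b z - line_average g h z * tensor a b z)); last first.
  by apply/funext => z; rewrite !mulrBl.
rewrite RintegralB//; last first.
  rewrite (_ : EFin \o _ = (fun z => (f (z + (h, 0)) * tensor a b z)%:E) \-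
     (fun z => (f z * tensor a b z)%:E))%E; first exact: integrableB.
  by apply/funext => z /=; rewrite EFinB.
rewrite RintegralB//.
have -> : \int[leb2]_z (line_average g h z * tensor a b z) =
    \int[leb2]_z (g z * tensor A b z).
  by rewrite /Rintegral (line_average_tensor lg h0 ca cb cA AE).
apply/eqP; rewrite subr_eq0 -[X in _ == X]opprK -w//.
(* The translate a(x - h), in the affine form expected by [smooth_affine]. *)
pose a' x := a (1 * x + - h).
have ca' : smooth_compact a'.
  case: ca => sa [r hr]; split; first exact: smooth_affine.
  exists (r + h) => x rx; apply: hr; rewrite mul1r.
  apply: (@lt_le_trans _ _ (`|x| - `|h|)); last exact: lerB_dist.
  by rewrite (ger0_norm (ltW h0)); lra.
have i4 := integrable_tensor lf ca' cb.
have -> : \int[leb2]_z (f (z + (h, 0)) * tensor a b z) =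
    \int[leb2]_z (f z * tensor a' b z).
  rewrite /Rintegral; congr fine.
  rewrite -[RHS](integral_leb2_translate (h, 0) i4).2.
  apply: eq_integral => z _; rewrite /tensor /a' /=.
  by rewrite mul1r addrK addr0.
have -> : \int[leb2]_z (f z * tensor A^`()%classic b z) =
    \int[leb2]_z (f z * tensor a b z) - \int[leb2]_z (f z * tensor a' b z).
  rewrite -RintegralB//; apply: eq_Rintegral => z _; rewrite /tensor.
  have -> : A^`()%classic z.1 = a z.1 - a' z.1.
    by rewrite derive1E; have [_ ->] := dA z.1; rewrite /a' mul1r.
  ring.
by rewrite opprB.
Qed.

(** The Cauchy-Schwarz inequality against a constant, obtained by integrating (phi - m)^2 >= 0 with
    m the mean of phi. If phi^2 has infinite integral there is nothing to prove. *)
Lemma sqr_integral_le (phi : R -> R) (h : R) : 0 < h ->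
  measurable_fun `[0, h] phi ->
  mu.-integrable `[0, h] (EFin \o phi) ->
  (((\int[mu]_(s in `[0%R, h]) phi s)%R ^+ 2)%R%:E <=
   h%:E * \int[mu]_(s in `[0%R, h]) (phi s ^+ 2)%:E)%E.
Proof.
move=> h0 mphi iphi.
set J := \int[mu]_(s in _) phi s.
have muI : mu `[0, h]%classic = h%:E.
  by rewrite lebesgue_measure_itv/= lte_fin h0 -EFinB subr0.
pose m := J / h.
have mI : measurable (`[0, h]%classic : set R1) by exact: measurable_itv.
have mphi2 : measurable_fun `[0, h] (fun s => (phi s ^+ 2)%:E).
  by apply/measurable_EFinP; exact: measurable_funX.
have i1 : mu.-integrable `[0, h] (fun s => (2 * m * phi s)%:E).
  exact: (integrableZl mI (2 * m) iphi).
have i2 : mu.-integrable `[0, h] (fun=> (m ^+ 2)%:E).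
  apply: measurable_bounded_integrable => //; first by rewrite [X in (X < _)%E]muI ltry.
  by exists `|m ^+ 2|; split => // N ltN x _ /=; exact: ltW.
have [foo|] := ltP (\int[mu]_(s in `[0%R, h]) (phi s ^+ 2)%:E)%E +oo%E; last first.
  by rewrite leye_eq => /eqP ->; rewrite gt0_muley ?lte_fin// leey.
have i3 : mu.-integrable `[0, h] (fun s => (phi s ^+ 2)%:E).
  apply/integrableP; split => //.
  by under eq_integral do rewrite gee0_abs ?lee_fin ?sqr_ge0//.
have : \int[mu]_(s in `[0, h]) (2 * m * phi s - m ^+ 2) <=
    \int[mu]_(s in `[0, h]) (phi s ^+ 2).
  apply: le_Rintegral => //.
    rewrite (_ : EFin \o _ = (fun s => (2 * m * phi s)%:E) \- (fun=> (m ^+ 2)%:E))%E.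
      exact: integrableB.
    by apply/funext => s /=; rewrite EFinB.
  by move=> s _; have := sqr_ge0 (phi s - m); lra.
rewrite RintegralB// RintegralZl// Rintegral_cst// -/J [X in fine X]muI /=.
rewrite -[X in (_ <= _ * X)%E]fineK ?integrable_fin_num// -EFinM lee_fin -/(Rintegral _ _ _).
set K := Rintegral _ _ _ => JK.
have -> : J ^+ 2 = h * (2 * m * J - m ^+ 2 * h) by rewrite /m; field; rewrite gt_eqF.
by rewrite ler_pM2l.
Qed.

(** One factor h comes from Cauchy-Schwarz on each line, the other from integrating the
    translation-invariant norm of [g] over s in [0, h]. *)
Lemma tensor_weak_translate_le (f g : P2 -> R) (h : R) : 0 <= h ->
  loc_integrable f -> loc_integrable g -> tensor_weak f g ->
  (\int[leb2]_z ((f (z + (h, 0)) - f z) ^+ 2)%:E <=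
   (h ^+ 2)%:E * \int[leb2]_z (g z ^+ 2)%:E)%E.
Proof.
rewrite le_eqVlt => /predU1P[<- _ _ _|h0 lf lg w].
  rewrite integral0_eq.
    by rewrite expr0n mul0e.
  by move=> z _; rewrite (_ : (0, 0) = 0)// addr0 subrr expr0n.
have [mf _] := lf; have [mg _] := lg.
pose I : set R1 := `[0, h]%classic.
have mI : measurable I by exact: measurable_itv.
pose G (w : P2 * R1) := ((g (hshift w)) ^+ 2 * \1_I w.2)%:E.
have mG : measurable_fun setT G.
  apply/measurable_EFinP/measurable_funM.
    by apply: measurable_funX; exact: (measurableT_comp mg measurable_hshift).
  by apply: measurableT_comp; [exact: measurable_indic|exact: measurable_snd].
have G0 q : (0 <= G q)%E by rewrite lee_fin mulr_ge0// sqr_ge0.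
have mD : measurable_fun setT (fun z : P2 => ((f (z + (h, 0)) - f z) ^+ 2)%:E).
  apply/measurable_EFinP/measurable_funX/measurable_funB => //.
  exact: (measurableT_comp mf (measurable_fun_pairD _)).
have mGF : measurable_fun setT (fun z => h%:E * \int[mu]_s G (z, s))%E.
  by apply: emeasurable_funM => //; exact: measurable_fun_fubini_tonelli_F.
apply: (@le_trans _ _ (\int[leb2]_z (h%:E * \int[mu]_s G (z, s)))%E).
  apply: ae_ge0_le_integral => //.
  - by move=> z _; rewrite lee_fin sqr_ge0.
  - by move=> z _; rewrite mule_ge0 ?lee_fin ?(ltW h0)// integral_ge0.
  - have := tensor_weak_translate h0 lf lg w.
    apply: filterS2 (ae_line_integrable lg h0) => z iz -> _.
    apply: (le_trans (sqr_integral_le h0 _ iz)).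
      by case/integrableP : iz => /measurable_EFinP.
    rewrite lee_wpmul2l ?lee_fin ?(ltW h0)//.
    rewrite integral_mkcond le_eqVlt; apply/orP; left; apply/eqP.
    apply: eq_integral => s _; rewrite patchE /G /= indicE.
    by case: (s \in _); rewrite ?mulr1 ?mulr0.
rewrite ge0_integralZl//; last 3 first.
- exact: measurable_fun_fubini_tonelli_F.
- by move=> z _; exact: integral_ge0.
- by rewrite lee_fin ltW.
rewrite (fubini_tonelli G)// expr2 EFinM -muleA lee_wpmul2l ?lee_fin ?(ltW h0)//.
set N := (\int[leb2]_z (g z ^+ 2)%:E)%E.
have N0 : (0 <= N)%E by apply: integral_ge0 => z _; rewrite lee_fin sqr_ge0.
rewrite (_ : (h%:E * N)%E = (\int[mu]_s (N * (\1_I s)%:E))%E); last first.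
  rewrite ge0_integralZl//=; last by apply/measurable_EFinP; exact: measurable_indic.
  rewrite integral_indic// setIT muleC; congr (_ * _)%E.
  by rewrite /I /= lebesgue_measure_itv/= lte_fin h0 -EFinB subr0.
rewrite le_eqVlt; apply/orP; left; apply/eqP.
apply: eq_integral => s _; rewrite /G /= indicE; case: (s \in I) => /=; last first.
  by rewrite mule0 integral0_eq// => z _; rewrite mulr0.
rewrite mule1 /N.
rewrite -(ge0_integral_leb2_translate (s, 0) (f := fun z => (g z ^+ 2)%:E)).
- apply: eq_integral => z _; rewrite mulr1; congr ((g _ ^+ 2)%:E).
  by rewrite /hshift /= [RHS]surjective_pairing /= addr0.
- by apply/measurable_EFinP; exact: measurable_funX.
- by move=> z; rewrite lee_fin sqr_ge0.
Qed.

End translation_estimate.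

(** * Upper bound on the entropy *)

Section smearing.
Context {R : realType}.
Local Notation P2 := (measurableTypeR R * measurableTypeR R)%type.
Local Open Scope ereal_scope.

Lemma measurable_fun_pair_add :
  measurable_fun setT (fun w : P2 * P2 => (w.1 + w.2)%R : P2).
Proof.
apply/measurable_fun_pairP; split; apply: measurable_funD => /=.
- exact: (measurableT_comp measurable_fst measurable_fst).
- exact: (measurableT_comp measurable_fst measurable_snd).
- exact: (measurableT_comp measurable_snd measurable_fst).
- exact: (measurableT_comp measurable_snd measurable_snd).
Qed.

(* Comparing [u z] with [u (z + s)] for [s] in a square of side [h], the mass of
   [rho] above the level [2 M / h^2] is controlled by the energy. *)
Lemma truncated_mass_le (f1 f2 : P2 -> R) (M K h : R) :
  (0 < h)%R ->
  measurable_fun setT f1 -> measurable_fun setT f2 ->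
  \int[leb2]_z (f1 z ^+ 2 + f2 z ^+ 2)%:E = M%:E ->
  (forall s : P2, orect 0 h 0 h s ->
     \int[leb2]_z ((f1 (z + s)%R - f1 z) ^+ 2 + (f2 (z + s)%R - f2 z) ^+ 2)%:E <=
     (2 * h ^+ 2 * K)%:E) ->
  \int[leb2]_z (Num.max (f1 z ^+ 2 + f2 z ^+ 2 - 2 * M / h ^+ 2) 0)%:E <=
  (4 * h ^+ 2 * K)%:E.
Proof.
move=> h0 mf1 mf2 intM HK.
have h20 : (0 < h ^+ 2)%R by rewrite exprn_gt0.
pose Q := @orect R 0 h 0 h.
have mQ : measurable Q by exact: measurable_orect.
have leb2Q : leb2 Q = (h ^+ 2)%:E by rewrite leb2_orect ?subr0 ?expr2// ltW.
pose rho z : R := (f1 z ^+ 2 + f2 z ^+ 2)%R.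
pose D (w : P2 * P2) : R :=
  ((f1 (w.1 + w.2)%R - f1 w.1) ^+ 2 + (f2 (w.1 + w.2)%R - f2 w.1) ^+ 2)%R.
have mrho : measurable_fun setT rho.
  by apply: measurable_funD; exact: measurable_funX.
have rho0 z : (0 <= rho z)%R by rewrite addr_ge0 ?sqr_ge0.
have D0 w : (0 <= D w)%R by rewrite addr_ge0 ?sqr_ge0.
have mD : measurable_fun setT D.
  apply: measurable_funD; apply: measurable_funX; apply: measurable_funB.
  - exact: (measurableT_comp mf1 measurable_fun_pair_add).
  - exact: (measurableT_comp mf1 measurable_fst).
  - exact: (measurableT_comp mf2 measurable_fun_pair_add).
  - exact: (measurableT_comp mf2 measurable_fst).
pose G (w : P2 * P2) : \bar R := (D w * \1_Q w.2)%:E.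
have mG : measurable_fun setT G.
  apply/measurable_EFinP/measurable_funM => //.
  by apply: measurableT_comp; [exact: measurable_indic|exact: measurable_snd].
have G0 w : 0 <= G w by rewrite lee_fin mulr_ge0.
(* For each s one has rho(z) <= 2 D(z, s) + 2 rho(z + s). Integrating over s in the square, of area
   h^2, the last term contributes at most 2 M. *)
have pw z : (h ^+ 2 * Num.max (rho z - 2 * M / h ^+ 2) 0)%:E <=
    2%:E * \int[leb2]_s G (z, s).
  rewrite EFinM; have [le0|gt0] := leP (rho z - 2 * M / h ^+ 2)%R 0%R.
    by rewrite mule0 mule_ge0// integral_ge0.
  have mGz : measurable_fun setT (fun s => G (z, s)).
    exact: (measurableT_comp mG (measurable_pair1 z)).
  have mz : measurable_fun setT (fun s : P2 => (rho (z + s)%R)%:E).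
    apply/measurable_EFinP; apply: (measurableT_comp mrho).
    rewrite (_ : +%R z = (fun s => s + z)%R); first exact: measurable_fun_pairD.
    by apply/funext => s; rewrite addrC.
  have : (h ^+ 2 * rho z)%:E <= \int[leb2]_s (2%:E * G (z, s) + 2%:E * (rho (z + s)%R)%:E).
    have -> : (h ^+ 2 * rho z)%:E = \int[leb2]_s ((rho z)%:E * (\1_Q s)%:E).
      rewrite ge0_integralZl//=; last 2 first.
      - by apply/measurable_EFinP; exact: measurable_indic.
      - by rewrite lee_fin.
      by rewrite integral_indic// setIT [X in _ * X]leb2Q -EFinM mulrC.
    apply: ge0_le_integral => //.
    - by move=> s _; rewrite mule_ge0// lee_fin.
    - by apply: emeasurable_funM => //; apply/measurable_EFinP; exact: measurable_indic.
    - by apply: emeasurable_funD; apply: emeasurable_funM.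
    - move=> s _; rewrite /G -!EFinM -EFinD lee_fin /= indicE.
      case: (s \in Q); last by rewrite !mulr0 add0r mulr_ge0.
      rewrite !mulr1 /rho /D /=.
      have := sqr_ge0 (f1 (z + s)%R + (f1 (z + s)%R - f1 z)).
      have := sqr_ge0 (f2 (z + s)%R + (f2 (z + s)%R - f2 z)).
      nra.
  rewrite ge0_integralD//; last 4 first.
  - by move=> s _; rewrite mule_ge0.
  - by apply: emeasurable_funM.
  - by move=> s _; rewrite mule_ge0// lee_fin.
  - by apply: emeasurable_funM.
  rewrite ge0_integralZl// ge0_integralZl//; last by move=> s _; rewrite lee_fin.
  have -> : \int[leb2]_s (rho (z + s)%R)%:E = M%:E.
    under eq_integral do rewrite addrC.
    rewrite (ge0_integral_leb2_translate z (f := EFin \o rho))//.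
    exact/measurable_EFinP.
  move=> le1; rewrite -EFinM mulrBr EFinB leeBlDr//.
  apply: (le_trans le1); rewrite leeD2l// -EFinM lee_fin.
  by rewrite mulrCA divff ?mulr1// gt_eqF.
have mmax : measurable_fun setT (fun z => (Num.max (rho z - 2 * M / h ^+ 2) 0)%:E).
  apply/measurable_EFinP; apply: measurable_maxr => //.
  exact: measurable_funB.
have : \int[leb2]_z ((h ^+ 2)%:E * (Num.max (rho z - 2 * M / h ^+ 2) 0)%:E) <=
    \int[leb2]_z (2%:E * \int[leb2]_s G (z, s)).
  apply: ge0_le_integral => //.
  - by move=> z _; rewrite mule_ge0// lee_fin ?(ltW h20)// le_max lexx orbT.
  - by apply: emeasurable_funM.
  - apply: emeasurable_funM => //.
    exact: (measurable_fun_fubini_tonelli_F G).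
  - by move=> z _; rewrite -EFinM; exact: pw.
rewrite ge0_integralZl//; last 2 first.
- by move=> z _; rewrite lee_fin le_max lexx orbT.
- by rewrite lee_fin ltW.
rewrite ge0_integralZl//; last 2 first.
- exact: (measurable_fun_fubini_tonelli_F G).
- by move=> z _; exact: integral_ge0.
rewrite (fubini_tonelli G)//.
have le2 : \int[leb2]_s \int[leb2]_z G (z, s) <= (2 * h ^+ 2 * K)%:E * (h ^+ 2)%:E.
  have -> : (2 * h ^+ 2 * K)%:E * (h ^+ 2)%:E = \int[leb2]_(s in Q) (2 * h ^+ 2 * K)%:E.
    by rewrite integral_cst// -leb2Q.
  rewrite [leRHS]integral_mkcond; apply: ge0_le_integral => //.
  - by move=> s _; exact: integral_ge0.
  - exact: (measurable_fun_fubini_tonelli_G G).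
  - by apply/(measurable_restrictT _ mQ).
  - move=> s _; rewrite patchE /G /= indicE; case: (boolP (s \in Q)) => sQ; last first.
      by rewrite integral0_eq// => z _; rewrite mulr0.
    rewrite inE in sQ; apply: le_trans (HK _ sQ).
    by under eq_integral do rewrite mulr1.
move=> le3; rewrite -(@lee_pmul2l _ (h ^+ 2)%:E)//; apply: (le_trans le3).
apply: (@le_trans _ _ (2%:E * ((2 * h ^+ 2 * K)%:E * (h ^+ 2)%:E))).
  by rewrite lee_wpmul2l.
by rewrite -!EFinM lee_fin; nra.
Qed.

End smearing.

Section H1_facts.
Context {R : realType}.
Local Notation P2 := (measurableTypeR R * measurableTypeR R)%type.

Lemma wpartialP (f : P2 -> R) (i : 'I_2) : H1_real f ->
  wpartial i f \in Lfun leb2 2%:E /\ weak_partial i f (wpartial i f).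
Proof.
move=> [_ /(_ i)[g g2 gw]].
exact: (@xgetPex _ _ [set g | g \in Lfun leb2 2%:E /\ weak_partial i f g]
  (ex_intro _ g (conj g2 gw))).
Qed.

Let lee_sum_scaled (c d : R) (A B X Y : \bar R) : 0 <= c -> (0 <= X)%E -> (0 <= Y)%E ->
  (A <= d%:E * X)%E -> (B <= d%:E * Y)%E ->
  (c%:E * A + c%:E * B <= (c * d)%:E * (X + Y))%E.
Proof.
move=> c0 X0 Y0 AX BY; rewrite (ge0_muleDr _ X0 Y0) EFinM -!muleA.
by apply: leeD; apply: lee_wpmul2l; rewrite ?lee_fin.
Qed.

(** The shift by (s1, s2) is split into one shift along each axis; the factor 2 comes from (a + b)^2
    <= 2 a^2 + 2 b^2. *)
Lemma H1_translate_le (f : P2 -> R) (h : R) (s : P2) : 0 < h -> H1_real f ->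
  orect 0 h 0 h s ->
  (\int[leb2]_z ((f (z + s) - f z) ^+ 2)%:E <=
   (2 * h ^+ 2)%:E * (\int[leb2]_z (wpartial ord0 f z ^+ 2)%:E +
     \int[leb2]_z (wpartial (lift ord0 ord0) f z ^+ 2)%:E))%E.
Proof.
move=> h0 Hf; have [f2 _] := Hf.
have [g02 w0] := wpartialP ord0 Hf.
have [g12 w1] := wpartialP (lift ord0 ord0) Hf.
set g0 := wpartial ord0 f in g02 w0 *; set g1 := wpartial _ f in g12 w1 *.
have lf := Lfun2_loc_integrable f2.
have lg0 := Lfun2_loc_integrable g02.
have lg1 := Lfun2_loc_integrable g12.
have [mf _] := lf; have [mg1 _] := lg1.
case: s => s1 s2 /=; rewrite /orect /= !in_itv/= => -[/andP[s10 s1h] /andP[s20 s2h]].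
pose a (z : P2) := f (z + (s1, 0)) - f z.
pose b (z : P2) := f (z + (0, s2)) - f z.
have ma : measurable_fun setT a.
  by apply: measurable_funB => //; exact: (measurableT_comp mf (measurable_fun_pairD _)).
have mb : measurable_fun setT b.
  by apply: measurable_funB => //; exact: (measurableT_comp mf (measurable_fun_pairD _)).
have sq (k : P2 -> R) : measurable_fun setT k ->
    measurable_fun setT (fun z => (k z ^+ 2)%:E).
  by move=> mk; apply/measurable_EFinP; exact: measurable_funX.
have la : (\int[leb2]_z (a z ^+ 2)%:E <= (h ^+ 2)%:E * \int[leb2]_z (g0 z ^+ 2)%:E)%E.
  apply: le_trans (tensor_weak_translate_le (ltW s10) lf lg0 (weak_partial_tensor0 w0)) _.
  rewrite lee_wpmul2r ?lee_fin; first by [].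
    by apply: integral_ge0 => z _; rewrite lee_fin sqr_ge0.
  by rewrite lerXn2r ?nnegrE ?(ltW s10) ?(ltW h0)// ltW.
have lb : (\int[leb2]_z (b z ^+ 2)%:E <= (h ^+ 2)%:E * \int[leb2]_z (g1 z ^+ 2)%:E)%E.
  have swl (k : P2 -> R) : loc_integrable k -> loc_integrable (fun z => k (z.2, z.1)).
    move=> [mk lk]; split; first exact: (measurableT_comp mk measurable_swap2).
    move=> r; apply/(integrable_mkcond _ (measurable_box r)).
    have i1 : leb2.-integrable setT ((EFin \o k) \_ (box r)).
      by apply/(integrable_mkcond _ (measurable_box _)).
    have [i2 _] := integral_leb2_swap i1; move: i2.
    congr (_.-integrable _ _); apply/funext => z; rewrite !patchE.
    have -> : ((z.2, z.1) \in box r) = (z \in box r).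
      by apply/idP/idP; rewrite !inE => /boxE[? ?]; exact/boxE.
    by [].
  have := tensor_weak_translate_le (ltW s20) (swl _ lf) (swl _ lg1)
    (weak_partial_tensor1 lf lg1 w1).
  rewrite (ge0_integral_leb2_swap (f := fun z => (g1 z ^+ 2)%:E)); last 2 first.
  - exact: sq.
  - by move=> z; rewrite lee_fin sqr_ge0.
  have -> : (\int[leb2]_z ((f ((z + (s2, 0)%R).2, (z + (s2, 0)%R).1) - f (z.2, z.1)) ^+ 2)%:E
     = \int[leb2]_z (b z ^+ 2)%:E)%E.
    rewrite -[RHS](ge0_integral_leb2_swap (f := fun z => (b z ^+ 2)%:E)).
    - apply: eq_integral => z _; by rewrite /b.
    - exact: sq.
    - by move=> z; rewrite lee_fin sqr_ge0.
  move=> le1; apply: (le_trans le1); rewrite lee_wpmul2r ?lee_fin; first by [].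
    by apply: integral_ge0 => z _; rewrite lee_fin sqr_ge0.
  by rewrite lerXn2r ?nnegrE ?(ltW s20) ?(ltW h0)// ltW.
have mas : measurable_fun setT (fun z : P2 => (a (z + (0, s2)) ^+ 2)%:E).
  by apply: sq; exact: (measurableT_comp ma (measurable_fun_pairD _)).
apply: (@le_trans _ _ (\int[leb2]_z (2%:E * (a (z + (0, s2))%R ^+ 2)%:E +
    2%:E * (b z ^+ 2)%:E))%E).
  apply: ge0_le_integral => //.
  - by move=> z _; rewrite lee_fin sqr_ge0.
  - apply: sq; apply: measurable_funB => //.
    exact: (measurableT_comp mf (measurable_fun_pairD _)).
  - by apply: emeasurable_funD; apply: emeasurable_funM => //; exact: sq.
  - move=> z _; rewrite -!EFinM -EFinD lee_fin /a /b.
    have -> : z + (s1, s2) = z + (0, s2) + (s1, 0).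
      by rewrite -addrA [in RHS]/GRing.add /= ; congr (_ + _); congr pair; rewrite ?add0r ?addr0.
    by have := sqr_ge0 (f (z + (0, s2) + (s1, 0)) - f (z + (0, s2)) - (f (z + (0, s2)) - f z)); nra.
have -> : (\int[leb2]_z (2%:E * (a (z + (0, s2))%R ^+ 2)%:E + 2%:E * (b z ^+ 2)%:E) =
    2%:E * \int[leb2]_z (a z ^+ 2)%:E + 2%:E * \int[leb2]_z (b z ^+ 2)%:E)%E.
  rewrite -(ge0_integral_leb2_translate (0, s2) (f := fun z => (a z ^+ 2)%:E)); last 2 first.
  - exact: sq.
  - by move=> z; rewrite lee_fin sqr_ge0.
  rewrite -ge0_integralZl//; last by move=> z _; rewrite lee_fin sqr_ge0.
  rewrite -ge0_integralZl//; last 2 first.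
  - exact: sq.
  - by move=> z _; rewrite lee_fin sqr_ge0.
  apply: ge0_integralD => //.
  - by move=> z _; rewrite mule_ge0// lee_fin sqr_ge0.
  - by apply: emeasurable_funM.
  - by move=> z _; rewrite mule_ge0// lee_fin sqr_ge0.
  - by apply: emeasurable_funM => //; exact: sq.
have X00 : (0 <= \int[leb2]_z (g0 z ^+ 2)%:E)%E.
  by apply: integral_ge0 => z _; rewrite lee_fin sqr_ge0.
have X10 : (0 <= \int[leb2]_z (g1 z ^+ 2)%:E)%E.
  by apply: integral_ge0 => z _; rewrite lee_fin sqr_ge0.
exact: (lee_sum_scaled (ler0n R 2) X00 X10 la lb).
Qed.

End H1_facts.

(** * Entropy controlled by an arbitrarily small part of the Dirichlet energy *)

Section entropy_upper_bound.
Context {R : realType}.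
Local Notation P2 := (measurableTypeR R * measurableTypeR R)%type.

Lemma ln2_le1 : ln (2 : R) <= 1.
Proof. by have := @le_ln1Dx R 1; apply; lra. Qed.

(** Let m be least with r < 2^(m+1) l. As ln 2 <= 1, the left side is at most m r. For each n < m
    one has 2^(n+1) l <= r, so the n-th layer is at least r / 2. *)
Lemma mul_ln_le_layers (r l : R) : 0 <= r -> 0 < l ->
  exists N, r * ln r - r * (ln l + 1) <=
    2 * \sum_(0 <= n < N) Num.max (r - 2 ^+ n * l) 0.
Proof.
move=> r0 l0.
have ex : exists m, r < 2 ^+ m.+1 * l.
  exists (Num.truncn (r / l)).
  rewrite -ltr_pdivrMr// (lt_trans (truncnS_gt _))//.
  by rewrite -natrX ltr_nat ltn_expl.
pose m := ex_minn ex; exists m.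
have [rm mmin] : r < 2 ^+ m.+1 * l /\ forall n, (n < m)%N -> 2 ^+ n.+1 * l <= r.
  rewrite /m; case: ex_minnP => k rk kmin; split => // n nk.
  by rewrite leNgt; apply/negP => /kmin; rewrite leqNgt nk.
have le1 : r * ln r - r * (ln l + 1) <= m%:R * r.
  move: r0; rewrite le_eqVlt => /predU1P[<-|r0]; first by rewrite !mul0r subrr mulr0.
  rewrite -mulrBr mulrC ler_pM2r//.
  have : ln r <= m.+1%:R * ln 2 + ln l.
    rewrite mulr_natl -lnXn// -lnM ?posrE ?exprn_gt0//.
    by rewrite ler_ln ?posrE ?mulr_gt0 ?exprn_gt0// ltW.
  have := ln2_le1; have : 0 <= ln (2 : R) by rewrite ln_ge0// ler1n.
  rewrite -natr1; have : 0 <= m%:R :> R by [].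
  nra.
apply: (le_trans le1).
rewrite mulr_sumr (_ : m%:R * r = \sum_(0 <= n < m) r); last first.
  by rewrite big_const_nat iter_addr_0 mulr_natl subn0.
apply: ler_sum_nat => n /andP[_ nm].
have := mmin n nm; rewrite exprS -mulrA => h.
have : r - 2 ^+ n * l <= Num.max (r - 2 ^+ n * l) 0 by rewrite le_max lexx.
lra.
Qed.

Definition energy_mass (f : P2 -> R) : \bar R :=
  (\int[leb2]_z (wpartial ord0 f z ^+ 2)%:E +
   \int[leb2]_z (wpartial (lift ord0 ord0) f z ^+ 2)%:E)%E.

Lemma energy_mass_ge0 f : (0 <= energy_mass f)%E.
Proof. by apply: adde_ge0; apply: integral_ge0 => z _; rewrite lee_fin sqr_ge0. Qed.

Lemma H1_measurable (f : P2 -> R) : H1_real f -> measurable_fun setT f.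
Proof. by move=> [/Lfun2P[]]. Qed.

(** The side h of the averaging square is chosen so that the threshold 2 M / h^2 equals [l]. *)
Lemma H1_truncated_mass (f1 f2 : P2 -> R) (M K l : R) :
  0 < M -> 0 < l -> H1_real f1 -> H1_real f2 ->
  (\int[leb2]_z (f1 z ^+ 2 + f2 z ^+ 2)%:E = M%:E)%E ->
  (energy_mass f1 + energy_mass f2 = K%:E)%E ->
  (\int[leb2]_z (Num.max (f1 z ^+ 2 + f2 z ^+ 2 - l) 0)%:E <= (8 * M * K / l)%:E)%E.
Proof.
move=> M0 l0 H1 H2 intM EK.
pose h := Num.sqrt (2 * M / l).
have h2 : h ^+ 2 = 2 * M / l by rewrite sqr_sqrtr// divr_ge0 ?mulr_ge0 ?(ltW M0) ?(ltW l0).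
have h0 : 0 < h by rewrite sqrtr_gt0 divr_gt0 ?mulr_gt0.
have lE : 2 * M / h ^+ 2 = l by rewrite h2; field; rewrite !gt_eqF.
have m1 := H1_measurable H1; have m2 := H1_measurable H2.
have := @truncated_mass_le R f1 f2 M K h h0 m1 m2 intM; rewrite lE.
have -> : 4 * h ^+ 2 * K = 8 * M * K / l by rewrite h2; field; rewrite gt_eqF.
apply => s Qs.
have sq (k : P2 -> R) : measurable_fun setT k ->
    measurable_fun setT (fun z : P2 => ((k (z + s) - k z) ^+ 2)%:E).
  move=> mk; apply/measurable_EFinP/measurable_funX/measurable_funB => //.
  exact: (measurableT_comp mk (measurable_fun_pairD _)).
have s0 (k : P2 -> R) : forall z : P2, setT z -> (0%R <= ((k (z + s) - k z) ^+ 2)%:E)%E.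
  by move=> z _; rewrite lee_fin sqr_ge0.
under eq_integral do rewrite EFinD.
rewrite (ge0_integralD _ measurableT (s0 f1) (sq _ m1) (s0 f2) (sq _ m2)).
apply: (le_trans (leeD (H1_translate_le h0 H1 Qs) (H1_translate_le h0 H2 Qs))).
rewrite -(ge0_muleDr _ (energy_mass_ge0 f1) (energy_mass_ge0 f2)) EK -EFinM.
exact: lexx.
Qed.

Lemma H1_entropy_le (M eps : R) : 0 < M -> 0 < eps ->
  exists C : R, forall (f1 f2 : P2 -> R) (K : R), H1_real f1 -> H1_real f2 ->
  (\int[leb2]_z (f1 z ^+ 2 + f2 z ^+ 2)%:E = M%:E)%E ->
  (energy_mass f1 + energy_mass f2 = K%:E)%E ->
  leb2.-integrable setT (fun z => ((f1 z ^+ 2 + f2 z ^+ 2) * ln (f1 z ^+ 2 + f2 z ^+ 2))%:E) ->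
  \int[leb2]_z ((f1 z ^+ 2 + f2 z ^+ 2) * ln (f1 z ^+ 2 + f2 z ^+ 2)) <= eps * K + C.
Proof.
(* The layers at levels 2^n l contribute 8 M K / (2^n l), in total 16 M K / l; the factor 2 of
   [mul_ln_le_layers] makes it 32 M K / l, which is eps K. *)
move=> M0 e0; pose l := 32 * M / eps.
have l0 : 0 < l by rewrite divr_gt0 ?mulr_gt0.
exists (M * (ln l + 1)) => f1 f2 K H1 H2 intM EK ient.
pose rho z := f1 z ^+ 2 + f2 z ^+ 2.
have m1 := H1_measurable H1; have m2 := H1_measurable H2.
have mrho : measurable_fun setT rho by apply: measurable_funD; exact: measurable_funX.
have rho0 z : 0 <= rho z by rewrite addr_ge0 ?sqr_ge0.
have irho : leb2.-integrable setT (EFin \o rho).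
  apply/integrableP; split; first exact/measurable_EFinP.
  under eq_integral do rewrite gee0_abs ?lee_fin ?rho0//.
  by rewrite [ltLHS]intM ltry.
have K0 : 0 <= K.
  by rewrite -lee_fin -EK adde_ge0// energy_mass_ge0.
pose F n z := (Num.max (rho z - 2 ^+ n * l) 0)%:E.
have F0 n z : (0 <= F n z)%E by rewrite lee_fin le_max lexx orbT.
have mF n : measurable_fun setT (F n).
  apply/measurable_EFinP; apply: measurable_maxr => //.
  exact: measurable_funB.
pose G z := (\sum_(0 <= n <oo) F n z)%E.
have G0 z : (0 <= G z)%E by exact: nneseries_ge0.
have mG : measurable_fun setT G by apply: ge0_emeasurable_sum.
have intG : (\int[leb2]_z G z <= (16 * M * K / l)%:E)%E.
  rewrite /G (integral_nneseries _ measurableT mF); last by move=> n z _; exact: F0.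
  (* The geometric series: 8 M K / (2^n l) is 16 M K / l divided by 2^(n+1). *)
  have := @epsilon_trick0 R (16 * M * K / l) xpredT.
  move=> /(_ _)/(le_trans _); apply; last first.
    by rewrite divr_ge0 ?(ltW l0)// !mulr_ge0 ?(ltW M0).
  apply: lee_nneseries => [n _ _|n _]; first by apply: integral_ge0 => z _; exact: F0.
  have ln0 : 0 < 2 ^+ n * l by rewrite mulr_gt0 ?exprn_gt0.
  have := H1_truncated_mass M0 ln0 H1 H2 intM EK.
  move=> /le_trans; apply; rewrite lee_fin natrX exprS.
  rewrite le_eqVlt; apply/orP; left; apply/eqP; field.
  by rewrite !gt_eqF// exprn_gt0.
have iG : leb2.-integrable setT (fun z => 2%:E * G z)%E.
  apply: integrableZl => //; apply/integrableP; split => //.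
  under eq_integral do rewrite gee0_abs//.
  by apply: le_lt_trans intG _; rewrite ltry.
pose c := ln l + 1.
have i2 : leb2.-integrable setT (fun z => (rho z * ln (rho z) - rho z * c)%:E).
  rewrite (_ : (fun z => _) = (fun z => (rho z * ln (rho z))%:E) \- (fun z => (rho z)%:E * c%:E))%E.
    by apply: integrableB => //; exact: integrableZr.
  by apply/funext => z; rewrite EFinB EFinM.
have le1 : (\int[leb2]_z (rho z * ln (rho z) - rho z * c)%:E <= \int[leb2]_z (2%:E * G z))%E.
  apply: le_integral => // z _.
  have [N] := mul_ln_le_layers (rho0 z) l0; rewrite -lee_fin => /le_trans; apply.
  rewrite EFinM lee_wpmul2l// -sumEFin.
  by apply: (nneseries_lim_ge (u_ := fun n => F n z)) => n _ _; exact: F0.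
have irc : leb2.-integrable setT (fun z => (rho z * c)%:E).
  by rewrite (_ : (fun z => _) = (fun z => (rho z)%:E * c%:E)%E)//; exact: integrableZr.
have E1 : \int[leb2]_z (rho z * ln (rho z) - rho z * c) =
    \int[leb2]_z (rho z * ln (rho z)) - M * c.
  rewrite RintegralB// RintegralZr//; congr (_ - _ * _).
  by rewrite /Rintegral intM.
have : ((\int[leb2]_z (rho z * ln (rho z) - rho z * c))%R%:E <= (eps * K)%:E)%E.
  rewrite /Rintegral fineK ?integrable_fin_num//; apply: (le_trans le1).
  rewrite ge0_integralZl//; apply: (@le_trans _ _ (2%:E * (16 * M * K / l)%:E)%E).
    by rewrite lee_wpmul2l.
  rewrite -EFinM lee_fin le_eqVlt; apply/orP; left; apply/eqP.
  by rewrite /l; field; rewrite !gt_eqF.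
by rewrite lee_fin E1 lerBlDr.
Qed.

End entropy_upper_bound.

(** * A logarithmic kernel *)

Section kernel_profile.
Context {R : realType}.
Local Notation mu := (@lebesgue_measure R).
Variables (d c : R).
Hypotheses (d0 : 0 < d) (d1 : d <= 1).

(** For t > 0 this is (t / exp c)^d, so c only sets a length scale; this is why the bounds on the
    integral of [kprof] are independent of c. *)
Definition kexp (t : R) : R := expR (d * (ln t - c)).

(* The derivative on [0 < t] of [kexp t / (1 + kexp t)], written with
   exponentials only; it behaves like [t ^ (d - 1)] near [0] and like
   [t ^ (- d - 1)] near infinity. *)
Definition kprof (t : R) : R :=
  d * expR ((d - 1) * ln `|t| - d * c - 2 * ln (1 + kexp `|t|)).

Lemma kprof_gt0 t : 0 < kprof t.
Proof. by rewrite mulr_gt0 ?expR_gt0. Qed.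

Lemma kprofN t : kprof (- t) = kprof t.
Proof. by rewrite /kprof normrN. Qed.

Let kexp1_gt0 t : 0 < 1 + kexp t.
Proof. by rewrite addr_gt0 ?expR_gt0. Qed.

(** The profile decreases away from 0: the exponent d - 1 is nonpositive and the denominator
    grows. *)
Lemma kprof_le (s t : R) : 0 < `|s| -> `|s| <= `|t| -> kprof t <= kprof s.
Proof.
move=> s0 st; have t0 := lt_le_trans s0 st.
have lnst : ln `|s| <= ln `|t| by rewrite ler_ln.
rewrite /kprof (ler_pM2l d0) ler_expR.
have : ln (1 + kexp `|s|) <= ln (1 + kexp `|t|).
  by rewrite ler_ln ?posrE ?kexp1_gt0// lerD2l ler_expR (ler_pM2l d0) lerD2r.
have := d1; nra.
Qed.

Lemma measurable_kprof : measurable_fun setT kprof.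
Proof.
have mln : measurable_fun setT (fun t : R => ln `|t|).
  by apply: measurableT_comp; [exact: measurable_ln|exact: normr_measurable].
apply: measurable_funM => //; apply: (measurableT_comp (@measurable_expR R)).
apply: measurable_funB.
  by apply: measurable_funB => //; exact: measurable_funM.
apply: measurable_funM => //; apply: (measurableT_comp (@measurable_ln R)).
apply: measurable_funD => //; apply: (measurableT_comp (@measurable_expR R)).
by apply: measurable_funM => //; exact: measurable_funB.
Qed.

Let kprim (t : R) : R := kexp t / (1 + kexp t).

Lemma is_derive_kprim (t : R) : 0 < t -> is_derive t (1 : R) kprim (kprof t).
Proof.
move=> t0.
have dE : is_derive t (1 : R) kexp (kexp t * (d * t^-1)).
  apply: (@is_derive1_comp _ expR (fun x => d * (ln x - c))).
  apply: (@is_deriveZ _ _ _ (fun x => ln x - c)).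
  rewrite -[t^-1]subr0.
  apply: (@is_deriveB _ _ _ (@ln R) (cst c)); exact: is_derive1_ln.
have dV : is_derive t (1 : R) (fun x => (1 + kexp x)^-1)
    (- (1 + kexp t) ^- 2 *: (kexp t * (d * t^-1))).
  apply: is_deriveV; first by rewrite gt_eqF.
  rewrite -[X in is_derive _ _ _ X]add0r.
  exact: (is_deriveD (is_derive_cst (1 : R) t (1 : R)) dE).
have := is_deriveM dE dV.
suff -> : kexp t *: (- (1 + kexp t) ^- 2 *: (kexp t * (d * t^-1))) +
  (1 + kexp t)^-1 *: (kexp t * (d * t^-1)) = kprof t by [].
rewrite /GRing.scale /=.
have E0 : 1 + kexp t != 0 by rewrite gt_eqF.
have tn0 : t != 0 by rewrite gt_eqF.
have -> : kprof t = d * kexp t / t / (1 + kexp t) ^+ 2.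
  rewrite /kprof gtr0_norm//.
  have -> : (d - 1) * ln t - d * c - 2 * ln (1 + kexp t) =
    d * (ln t - c) + - ln t + - (ln (1 + kexp t) + ln (1 + kexp t)) by ring.
  rewrite !expRD expRN expRN expRD !lnK ?posrE// -/(kexp t).
  by field; rewrite E0.
by field; rewrite E0.
Qed.

Let kprim_ge0 t : 0 <= kprim t.
Proof. by rewrite divr_ge0 ?expR_ge0// ltW. Qed.

Let kprim_le1 t : kprim t <= 1.
Proof. by rewrite ler_pdivrMr// mul1r lerDr. Qed.

(** The explicit primitive takes its values in [0, 1], whatever c and d are. *)
Lemma integral_kprof_itv (a b : R) : 0 < a -> a < b ->
  (\int[mu]_(t in `[a, b]) (kprof t)%:E <= 1)%E.
Proof.
move=> a0 ab.
have cprof t : 0 < t -> {for t, continuous kprof}.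
  move=> t0.
  have cln : {for t, continuous (fun x : R => ln `|x|)}.
    apply: (@continuous_comp _ _ _ (fun x : R => `|x|) (@ln R)).
      exact: norm_continuous.
    by apply: continuous_ln; rewrite normr_gt0 gt_eqF.
  have clin (a' b' : R) : {for t, continuous (fun x : R => a' * ln `|x| + b')}.
    by apply: cvgD; [apply: cvgMr; exact: cln|exact: cvg_cst].
  have cE : {for t, continuous (fun x => kexp `|x|)}.
    rewrite /kexp (_ : (fun x => _) = expR \o (fun x => d * ln `|x| + - (d * c))).
      by apply: continuous_comp; [exact: clin|exact: continuous_expR].
    by apply/funext => x /=; rewrite mulrBr.
  rewrite /kprof; apply: cvgMr.
  apply: continuous_cvg; first exact: continuous_expR.
  apply: cvgB; first exact: clin.
  apply: cvgMr; apply: continuous_cvg; first exact: continuous_ln.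
  by apply: cvgD; [exact: cvg_cst|exact: cE].
rewrite (@continuous_FTC2 _ kprof kprim)//.
- rewrite -EFinB lee_fin; have := kprim_ge0 a; have := kprim_le1 b; lra.
- apply: continuous_in_subspaceT => t; rewrite inE /= in_itv/= => /andP[at_ _].
  exact: cprof (lt_le_trans a0 at_).
- have cprim t : 0 < t -> {for t, continuous kprim}.
    move=> t0; apply: differentiable_continuous; apply/derivable1_diffP.
    by have [] := is_derive_kprim t0.
  split.
  + move=> t; rewrite in_itv/= => /andP[at_ _].
    by have [] := is_derive_kprim (lt_trans a0 at_).
  + exact: cvg_at_right_filter (cprim _ a0).
  + exact: cvg_at_left_filter (cprim _ (lt_trans a0 ab)).
- move=> t; rewrite in_itv/= => /andP[at_ _].
  by rewrite derive1E; have [] := is_derive_kprim (lt_trans a0 at_).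
Qed.

End kernel_profile.

Section planar_kernel.
Context {R : realType}.
Local Notation mu := (@lebesgue_measure R).
Local Notation P2 := (measurableTypeR R * measurableTypeR R)%type.
Local Open Scope ereal_scope.

Lemma integral_kprof_gt0 (d c : R) : (0 < d)%R -> (d <= 1)%R ->
  \int[mu]_(t in `]0%R, +oo[) (kprof d c t)%:E <= 1.
Proof.
move=> d0 d1.
(* The right end point is [i.+2] so that the interval is nondegenerate already for i = 0. *)
pose F (i : nat) : set (measurableTypeR R) := `[(i.+1%:R^-1 : R)%R, i.+2%:R]%classic.
have FU : \bigcup_i F i = `]0%R, +oo[%classic.
  apply/seteqP; split => [t [i _]|t]; rewrite /F /= !in_itv/= ?andbT.
    by move=> /andP[it _]; apply: lt_le_trans it; rewrite invr_gt0.
  move=> t0; exists (Num.truncn (t^-1 + t)) => //=; rewrite in_itv/=.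
  have := truncnS_gt (t^-1 + t); set n := Num.truncn _ => tn.
  have ti0 : (0 < t^-1)%R by rewrite invr_gt0.
  apply/andP; split.
    by rewrite invf_ple ?posrE//; lra.
  by rewrite -natr1; lra.
rewrite -FU.
have ndF : nondecreasing_seq F.
  move=> i j ij; apply/subsetPset => t; rewrite /F /= !in_itv/= => /andP[ti it].
  apply/andP; split; first by apply: le_trans ti; rewrite lef_pV2 ?posrE// ler_nat ltnS.
  by apply: (le_trans it); rewrite ler_nat !ltnS.
have mk := measurable_kprof d c.
have := @ge0_nondecreasing_set_cvg_integral _ _ _ F (EFin \o kprof d c) mu.
move=> /(_ _ _ _ _)/cvg_lim <-//.
- apply: lime_le.
    apply: ereal_nondecreasing_is_cvgn.
    apply: ge0_nondecreasing_set_nondecreasing_integral => //.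
    + by move=> i; exact: measurable_itv.
    + by move=> i; apply/measurable_EFinP/measurable_funTS.
    + by move=> i x _; rewrite lee_fin ltW// kprof_gt0.
  apply: nearW => i; apply: integral_kprof_itv => //.
  apply: (@le_lt_trans _ _ 1%R); first by rewrite invf_le1// ler1n.
  by rewrite ltr1n.
- by move=> i; exact: measurable_itv.
- by move=> i; apply/measurable_EFinP/measurable_funTS.
- by move=> i x _; rewrite lee_fin ltW// kprof_gt0.
Qed.

(* The value at [0] makes the pointwise bound below hold on the diagonal. *)
Definition kprofE (d c t : R) : \bar R := if t == 0%R then +oo else (kprof d c t)%:E.

Lemma kprofE_ge0 d c t : (0 < d)%R -> 0 <= kprofE d c t.
Proof. by move=> d0; rewrite /kprofE; case: ifP => // _; rewrite lee_fin ltW// kprof_gt0. Qed.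

Lemma measurable_kprofE d c : measurable_fun setT (kprofE d c).
Proof.
apply: measurable_fun_if => //.
- exact: measurable_fun_eqr.
- by apply: measurable_funTS; apply/measurable_EFinP; exact: measurable_kprof.
Qed.

Lemma integral_kprofE (d c : R) : (0 < d)%R -> (d <= 1)%R ->
  \int[mu]_t kprofE d c t <= 2%:E.
Proof.
move=> d0 d1.
have mk := measurable_kprofE d c.
have k0 t := @kprofE_ge0 d c t d0.
have pos : \int[mu]_(t in `]0%R, +oo[) kprofE d c t <= 1.
  apply: le_trans (integral_kprof_gt0 c d0 d1).
  rewrite le_eqVlt; apply/orP; left; apply/eqP.
  apply: eq_integral => t; rewrite inE /= in_itv/= andbT => t0.
  by rewrite /kprofE gt_eqF.
have neg : \int[mu]_(t in `]-oo, 0%R]) kprofE d c t <= 1.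
  apply: le_trans pos.
  rewrite (integral_itv_obnd_cbnd (f := kprofE d c)); last exact: measurable_funTS.
  rewrite (ge0_integration_by_substitution0 mk k0).
  rewrite le_eqVlt; apply/orP; left; apply/eqP.
  by apply: eq_integral => t _; rewrite /kprofE oppr_eq0 kprofN.
rewrite (_ : setT = `]-oo, 0%R]%classic `|` `]0%R, +oo[%classic :> set R); last first.
  apply/seteqP; split => // t _; rewrite /= !in_itv/= andbT.
  by have [|] := leP t 0%R; [left|right].
rewrite ge0_integral_setU//=.
- by rewrite (_ : 2%:E = 1 + 1)//; exact: leeD.
- exact: measurable_funTS.
- apply/disj_setPS => t []; rewrite /= !in_itv/= andbT => t1 t2.
  by move: (lt_le_trans t2 t1); rewrite ltxx.
Qed.

(** Both coordinates of z are at most |z| in absolute value and the profile is decreasing, so the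
    product dominates the radial kernel kprof(|z|)^2 while its integral factors into one-dimensional
    ones. The d^2 cancels the factors d in [kprof], and 16 is the 2^4 lost in [ln_le_kernelE]. *)
Definition kernelE (d c : R) (z : P2) : \bar R :=
  (16 / d ^+ 2)%:E * (kprofE d c z.1 * kprofE d c z.2).

Lemma kernelE_ge0 d c z : (0 < d)%R -> 0 <= kernelE d c z.
Proof.
move=> d0; apply: mule_ge0; first by rewrite lee_fin divr_ge0// sqr_ge0.
by apply: mule_ge0; exact: kprofE_ge0.
Qed.

Lemma measurable_kernelE d c : measurable_fun setT (kernelE d c).
Proof.
apply: emeasurable_funM => //; apply: emeasurable_funM.
- exact: (measurableT_comp (measurable_kprofE d c) measurable_fst).
- exact: (measurableT_comp (measurable_kprofE d c) measurable_snd).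
Qed.

Lemma integral_kernelE d c : (0 < d)%R -> (d <= 1)%R ->
  \int[leb2]_z kernelE d c z <= (64 / d ^+ 2)%:E.
Proof.
move=> d0 d1.
have mk := measurable_kprofE d c.
have k0 t := @kprofE_ge0 d c t d0.
rewrite (ge0_integral_leb2 (measurable_kernelE d c)); last first.
  by move=> z; exact: kernelE_ge0.
set J := \int[mu]_t kprofE d c t.
have J0 : 0 <= J by apply: integral_ge0 => t _; exact: k0.
have c0 : (0 <= 16 / d ^+ 2 :> R)%R by rewrite divr_ge0// sqr_ge0.
have -> : \int[mu]_x \int[mu]_y kernelE d c (x, y) =
    \int[mu]_x ((16 / d ^+ 2)%:E * J * kprofE d c x).
  apply: eq_integral => x _; rewrite /kernelE /=.
  under eq_integral do rewrite muleA.
  rewrite ge0_integralZl//; last by rewrite mule_ge0.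
  by rewrite -/J muleAC.
rewrite ge0_integralZl//; last by rewrite mule_ge0.
rewrite -/J -muleA.
have J2 : J <= 2%:E by exact: integral_kprofE.
apply: (@le_trans _ _ ((16 / d ^+ 2)%:E * (2%:E * 2%:E))).
  by apply: lee_wpmul2l => //; apply: lee_pmul.
by rewrite -!EFinM lee_fin; lra.
Qed.

End planar_kernel.

Section log_kernel.
Context {R : realType}.
Local Notation P2 := (measurableTypeR R * measurableTypeR R)%type.

Lemma enorm_ge0 (z : R * R) : 0 <= enorm z.
Proof. exact: sqrtr_ge0. Qed.

Lemma enorm_sqr (z : R * R) : enorm z ^+ 2 = z.1 ^+ 2 + z.2 ^+ 2.
Proof. by rewrite sqr_sqrtr// addr_ge0 ?sqr_ge0. Qed.

Lemma normr_fst_le_enorm (z : R * R) : `|z.1| <= enorm z.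
Proof. by rewrite -sqrtr_sqr ler_wsqrtr// lerDl sqr_ge0. Qed.

Lemma normr_snd_le_enorm (z : R * R) : `|z.2| <= enorm z.
Proof. by rewrite -sqrtr_sqr ler_wsqrtr// lerDr sqr_ge0. Qed.

Lemma measurable_enorm : measurable_fun setT (@enorm R : P2 -> R).
Proof.
have -> : (@enorm R : P2 -> R) = Num.sqrt \o (fun z => z.1 ^+ 2 + z.2 ^+ 2) by [].
apply: measurableT_comp; first exact: continuous_measurable_fun (@sqrt_continuous R).
by apply: measurable_funD; apply: measurable_funX;
  [exact: measurable_fst|exact: measurable_snd].
Qed.

Lemma expR_ge_id (x : R) : x <= expR x.
Proof. by apply: le_trans (expR_ge1Dx x); rewrite lerDr. Qed.

(* With [w = - ln r] the bracket is [ln (rad / `|z|)] where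
   [rad ^ 2 = expR (- eps |w - w0|) / r]; [ln t <= t ^ q] for [q = 2 - eps] and
   [q = 2 + eps] makes the bound integrable both near [0] and near infinity. *)
Lemma ln_le_kernelE (eps w0 r : R) (z : P2) : 0 < eps -> eps <= 1 -> 0 < r ->
  ((r * (- ln r / 2 - eps / 2 * `|- ln r - w0| - ln (enorm z)))%:E <=
   kernelE (eps / 2) (w0 / 2) z)%E.
Proof.
move=> e0 e1 r0; set w := - ln r; set s := ln (enorm z).
set L := w / 2 - eps / 2 * `|w - w0| - s.
set d := eps / 2; set c := w0 / 2.
have d0 : 0 < d by rewrite divr_gt0.
have d1 : d <= 1 by rewrite /d; lra.
have [L0|L0] := leP L 0.
  apply: (@le_trans _ _ 0%E); last exact: kernelE_ge0.
  by rewrite lee_fin mulr_ge0_le0// ltW.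
have c16 : 0 < 16 / d ^+ 2 by rewrite divr_gt0// exprn_gt0.
rewrite /kernelE.
have [z1|z1] := eqVneq z.1 0.
  rewrite /kprofE z1 eqxx gt0_mulye; last first.
    by case: ifP => // _; rewrite lte_fin kprof_gt0.
  by rewrite gt0_muley ?lte_fin// leey.
have [z2|z2] := eqVneq z.2 0.
  rewrite /kprofE z2 eqxx (negbTE z1) muleC gt0_muley ?lte_fin ?kprof_gt0//.
  by rewrite gt0_mulye ?lte_fin// leey.
rewrite /kprofE (negbTE z1) (negbTE z2) -!EFinM lee_fin.
have n1 : 0 < `|z.1| by rewrite normr_gt0.
have n2 : 0 < `|z.2| by rewrite normr_gt0.
have D0 : 0 < enorm z := lt_le_trans n1 (normr_fst_le_enorm z).
have nD : `|enorm z| = enorm z by rewrite gtr0_norm.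
apply: (@le_trans _ _ (16 / d ^+ 2 * (kprof d c (enorm z) * kprof d c (enorm z)))); last first.
  have kE0 : 0 <= kprof d c (enorm z) by exact: ltW (kprof_gt0 c d0 _).
  have k1 : kprof d c (enorm z) <= kprof d c z.1.
    by apply: kprof_le => //; rewrite nD; exact: normr_fst_le_enorm.
  have k2 : kprof d c (enorm z) <= kprof d c z.2.
    by apply: kprof_le => //; rewrite nD; exact: normr_snd_le_enorm.
  move: (ltW c16) kE0 k1 k2.
  move: (16 / d ^+ 2) (kprof d c (enorm z)) (kprof d c z.1) (kprof d c z.2) => C a a1 a2.
  by move=> C0 a0 aa1 aa2; rewrite ler_wpM2l// ler_pM.
pose sig := d * (s - c).
have rE : r = expR (- w) by rewrite /w opprK lnK.
(* Here L <= exp((2 + t eps) L), since the exponent is at least 1 for both signs. The penalty eps |w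
   - w0| inside L pays for replacing w by w0, and the resulting bound no longer involves r. *)
have w_dev (t : R) : (t == 1) || (t == -1) ->
    r * L <= expR (- 2 * s - 2 * (t * sig)).
  move=> t1; apply: (@le_trans _ _ (expR (- w + (2 + t * eps) * L))).
    rewrite rE expRD ler_pM2l ?expR_gt0//.
    apply: le_trans (expR_ge_id L) _; rewrite ler_expR.
    by case/orP: t1 => /eqP ->; nra.
  rewrite ler_expR /sig /L /d /c.
  have := ler_norm (w - w0); have := ler_norm (w0 - w); rewrite distrC.
  have := normr_ge0 (w - w0).
  move: (`|w - w0|) => a a0 a1 a2.
  have h1 : eps * (w - w0) <= eps * a by rewrite ler_pM2l.
  have h2 : eps * (w0 - w) <= eps * a by rewrite ler_pM2l.
  have h3 : 0 <= eps * a by rewrite mulr_ge0// ltW.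
  have h4 : 0 <= eps * (eps * a) by rewrite mulr_ge0// ltW.
  have h5 : eps * (eps * a) <= eps * a by rewrite ler_piMl.
  by case/orP: t1 => /eqP ->; nra.
have pos : r * L <= expR (- 2 * s - 2 * (1 * sig)) by apply: w_dev; rewrite eqxx.
have neg : r * L <= expR (- 2 * s - 2 * (-1 * sig)) by apply: w_dev; rewrite eqxx orbT.
rewrite mulN1r in neg; rewrite mul1r in pos.
have -> : 16 / d ^+ 2 * (kprof d c (enorm z) * kprof d c (enorm z)) =
    16 * expR (- 2 * s + 2 * sig - 4 * ln (1 + expR sig)).
  rewrite /kprof /kexp nD -/s -/sig.
  have -> : - 2 * s + 2 * sig - 4 * ln (1 + expR sig) =
    ((d - 1) * s - d * c - 2 * ln (1 + expR sig)) +
    ((d - 1) * s - d * c - 2 * ln (1 + expR sig)) by rewrite /sig; ring.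
  by rewrite [in RHS]expRD; field; rewrite gt_eqF.
have E1 : 0 < 1 + expR sig by rewrite addr_gt0// expR_gt0.
have lnE : expR (- 4 * ln (1 + expR sig)) = (1 + expR sig) ^- 4.
  by rewrite mulNr expRN mulrC -[4]/(4%:R) expRM_natr lnK.
have -> : - 2 * s + 2 * sig - 4 * ln (1 + expR sig) =
   - 2 * s + 2 * sig + - 4 * ln (1 + expR sig) by ring.
rewrite expRD lnE mulrA ler_pdivlMr ?exprn_gt0//.
(* The two bounds together give exp(- 2 s - 2 |sig|), and 1 + exp(sig) is at most 2 exp(sig) or at
   most 2 according to the sign of sig. Raised to the fourth power this produces the constant 16. *)
have [sg|sg] := leP 0 sig.
- apply: (@le_trans _ _ (expR (- 2 * s - 2 * sig) * (2 * expR sig) ^+ 4)).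
    apply: ler_pM => //.
    + by rewrite mulr_ge0 ?(ltW r0) ?(ltW L0).
    + rewrite lerXn2r ?nnegrE ?mulr_ge0 ?expR_ge0 ?(ltW E1)//.
      suff : 1 <= expR sig by lra.
      by rewrite -[leLHS]expR0 ler_expR.
  rewrite exprMn -expRM_natr mulrCA -expRD.
  rewrite le_eqVlt; apply/orP; left; apply/eqP; congr (_ * expR _); ring.
- apply: (@le_trans _ _ (expR (- 2 * s - 2 * - sig) * 2 ^+ 4)).
    apply: ler_pM => //.
    + by rewrite mulr_ge0 ?(ltW r0) ?(ltW L0).
    + rewrite lerXn2r ?nnegrE ?(ltW E1)//.
      suff : expR sig <= 1 by lra.
      by rewrite -[leRHS]expR0 ler_expR ltW.
  rewrite mulrC -natrX mulrN opprK.
  by rewrite lexx.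
Qed.

End log_kernel.

(** * Lower bounds on the interaction and on the potential *)

Section product_integrals.
Context {R : realType}.
Local Notation P2 := (measurableTypeR R * measurableTypeR R)%type.
Local Notation nu := (leb2 \x leb2)%E.

Lemma integrable_prod (f g : P2 -> R) :
  leb2.-integrable setT (EFin \o f) -> leb2.-integrable setT (EFin \o g) ->
  nu.-integrable setT (fun w : P2 * P2 => (f w.1 * g w.2)%:E).
Proof.
move=> fi gi.
have mf : measurable_fun setT f by apply/measurable_EFinP; exact: (measurable_int _ fi).
have mg : measurable_fun setT g by apply/measurable_EFinP; exact: (measurable_int _ gi).
apply/integrable12ltyP.
  apply/measurable_EFinP/measurable_funM.
    exact: (measurableT_comp mf measurable_fst).
  exact: (measurableT_comp mg measurable_snd).
move: fi gi => /integrableP[_ fi] /integrableP[_ gi].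
have E x : (\int[leb2]_y `|(f x * g y)%:E| = `|(f x)%:E| * \int[leb2]_y `|(g y)%:E|)%E.
  rewrite -ge0_integralZl//.
  - by apply: eq_integral => y _; rewrite EFinM abseM.
  - by apply: measurableT_comp => //; exact/measurable_EFinP.
under eq_integral do rewrite E.
rewrite ge0_integralZr//; last 2 first.
- by apply: measurableT_comp => //; exact/measurable_EFinP.
- by apply: integral_ge0.
apply: lte_mul_pinfty => //; first exact: integral_ge0.
by rewrite ge0_fin_numE//; exact: integral_ge0.
Qed.

Lemma Rintegral_prod (f g : P2 -> R) :
  leb2.-integrable setT (EFin \o f) -> leb2.-integrable setT (EFin \o g) ->
  \int[nu]_w (f w.1 * g w.2) = (\int[leb2]_x f x) * (\int[leb2]_x g x).
Proof.
move=> fi gi; rewrite /Rintegral -(integral12_prod_meas1 (integrable_prod fi gi)).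
have E x : (\int[leb2]_y (f x * g y)%:E = (f x)%:E * (\int[leb2]_y g y)%R%:E)%E.
  rewrite /Rintegral fineK ?integrable_fin_num// -integralZl//.
rewrite /fubini_F /=; under eq_integral do rewrite E.
rewrite integralZr// -[X in (X * _)%E]fineK ?integrable_fin_num//.
Qed.

Lemma measurable_fun_pair_sub :
  measurable_fun setT (fun w : P2 * P2 => (w.1 - w.2)%R : P2).
Proof.
apply/measurable_fun_pairP; split; apply: measurable_funB => /=.
- exact: (measurableT_comp measurable_fst measurable_fst).
- exact: (measurableT_comp measurable_fst measurable_snd).
- exact: (measurableT_comp measurable_snd measurable_fst).
- exact: (measurableT_comp measurable_snd measurable_snd).
Qed.

Lemma measurable_diff_kernel (f : P2 -> R) (k : P2 -> \bar R) (p : P2 * P2 -> P2) :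
  measurable_fun setT f -> measurable_fun setT k -> measurable_fun setT p ->
  measurable_fun setT (fun w : P2 * P2 => (f (p w))%:E * k (w.1 - w.2)%R)%E.
Proof.
move=> mf mk mp.
apply: emeasurable_funM; last exact: (measurableT_comp mk measurable_fun_pair_sub).
by apply/measurable_EFinP; exact: (measurableT_comp mf mp).
Qed.

Lemma ge0_integral_mulr_le (f : P2 -> R) (c : \bar R) (C : R) :
  (forall x, 0 <= f x) -> leb2.-integrable setT (EFin \o f) ->
  (0 <= c)%E -> (c <= C%:E)%E ->
  (\int[leb2]_x ((f x)%:E * c) <= ((\int[leb2]_x f x)%R * C)%:E)%E.
Proof.
move=> f0 fi c0 cC; rewrite ge0_integralZr//; last 2 first.
- exact: (measurable_int _ fi).
- by move=> x _; rewrite lee_fin.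
rewrite EFinM /Rintegral fineK ?integrable_fin_num//.
by rewrite lee_wpmul2l//; apply: integral_ge0 => x _; rewrite lee_fin.
Qed.

(** By Tonelli and translation invariance the double integral is the product of the two
    integrals. *)
Lemma ge0_integral_diff_kernel (f : P2 -> R) (k : P2 -> \bar R) (C : R) :
  (forall x, 0 <= f x) -> leb2.-integrable setT (EFin \o f) ->
  measurable_fun setT k -> (forall z, 0 <= k z)%E -> (\int[leb2]_z k z <= C%:E)%E ->
  (\int[nu]_w ((f w.2)%:E * k (w.1 - w.2)%R) <= ((\int[leb2]_x f x)%R * C)%:E)%E.
Proof.
move=> f0 fi mk k0 kC.
have mf : measurable_fun setT f by apply/measurable_EFinP; exact: (measurable_int _ fi).
rewrite (fubini_tonelli2 _ (measurable_diff_kernel mf mk measurable_snd)); last first.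
  by move=> w; rewrite mule_ge0 ?lee_fin.
rewrite /fubini_G /=.
have E y : (\int[leb2]_x ((f y)%:E * k (x - y)%R) = (f y)%:E * \int[leb2]_z k z)%E.
  rewrite ge0_integralZl ?lee_fin//; last first.
    exact: (measurableT_comp mk (measurable_fun_pairD (- y))).
  by rewrite (ge0_integral_leb2_translate (- y) mk k0).
under eq_integral do rewrite E.
by apply: ge0_integral_mulr_le => //; exact: integral_ge0.
Qed.

(** With the weight on the first variable, evenness of [k] turns the inner integral into that of a
    translate. *)
Lemma ge0_integral_diff_kernel_fst (f : P2 -> R) (k : P2 -> \bar R) (C : R) :
  (forall x, 0 <= f x) -> leb2.-integrable setT (EFin \o f) ->
  measurable_fun setT k -> (forall z, 0 <= k z)%E -> (forall z, k (- z) = k z) ->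
  (\int[leb2]_z k z <= C%:E)%E ->
  (\int[nu]_w ((f w.1)%:E * k (w.1 - w.2)%R) <= ((\int[leb2]_x f x)%R * C)%:E)%E.
Proof.
move=> f0 fi mk k0 kN kC.
have mf : measurable_fun setT f by apply/measurable_EFinP; exact: (measurable_int _ fi).
rewrite (fubini_tonelli1 _ (measurable_diff_kernel mf mk measurable_fst)); last first.
  by move=> w; rewrite mule_ge0 ?lee_fin.
rewrite /fubini_F /=.
have E y : (\int[leb2]_x ((f y)%:E * k (y - x)%R) = (f y)%:E * \int[leb2]_z k z)%E.
  under eq_integral do rewrite -kN opprB.
  rewrite ge0_integralZl ?lee_fin//; last first.
    exact: (measurableT_comp mk (measurable_fun_pairD (- y))).
  by rewrite (ge0_integral_leb2_translate (- y) mk k0).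
under eq_integral do rewrite E.
by apply: ge0_integral_mulr_le => //; exact: integral_ge0.
Qed.

End product_integrals.

(** Integrability and linearity come together so that long linear combinations can be built one term
    at a time. *)
Lemma Rintegral_axpy d (T : measurableType d) (R : realType)
    (mu : {measure set T -> \bar R}) (a : R) (f g : T -> R) :
  mu.-integrable setT (EFin \o f) -> mu.-integrable setT (EFin \o g) ->
  mu.-integrable setT (EFin \o (fun x => a * f x + g x)) /\
  \int[mu]_x (a * f x + g x) = a * (\int[mu]_x f x) + \int[mu]_x g x.
Proof.
move=> fi gi.
have ai : mu.-integrable setT (EFin \o (fun x => a * f x)).
  by have := integrableZl measurableT a fi.
split; last by rewrite RintegralD// RintegralZl.
rewrite (_ : _ \o _ = (EFin \o (fun x => a * f x)%R) \+ (EFin \o g))%E; last first.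
  by apply/funext => x /=; rewrite EFinD.
exact: integrableD.
Qed.

(** The majorants are kernels that may be infinite, for instance on the diagonal, so the comparison
    takes place in the extended reals. *)
Lemma Rintegral_le_majorant d (T : measurableType d) (R : realType)
    (mu : {measure set T -> \bar R}) (f : T -> R) (g : T -> \bar R) (C : R) :
  mu.-integrable setT (EFin \o f) -> measurable_fun setT g ->
  (forall x, 0 <= g x)%E -> (forall x, (f x)%:E <= g x)%E ->
  (\int[mu]_x g x <= C%:E)%E -> \int[mu]_x f x <= C.
Proof.
move=> fi mg g0 fg gC.
rewrite -lee_fin /Rintegral fineK ?integrable_fin_num//; apply: le_trans gC.
rewrite integralE -[leRHS]sube0; apply: leeB; last exact: integral_ge0.
apply: ge0_le_integral => //.
  exact: measurable_funepos (measurable_int _ fi).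
by move=> x _; rewrite funeposE ge_max fg g0.
Qed.

(** Half of the larger of p and q equals (|p - q| + p + q) / 4; the first conjunct serves when p is
    the larger, the second when q is. The penalty of the other point is dropped. *)
Lemma max_halves (R : realFieldType) (p q a b l : R) : 0 <= a -> 0 <= b ->
  (p - q + p + q) / 4 - a - b - l <= p / 2 - a - l /\
  (q - p + p + q) / 4 - a - b - l <= q / 2 - b - l.
Proof. lra. Qed.

Lemma interaction_ge_combine (R : realFieldType) (M eps t d i s : R) :
  0 < eps -> M * t <= d ->
  - (M / 2) * s + d / 4 - eps * (M * t) - i <=
    M * (256 / eps ^+ 2) + M * (256 / eps ^+ 2) ->
  - (M / 2) * s + (1 / 4 - eps) * d - 512 * M / eps ^+ 2 <= i.
Proof.
move=> e0 td.
have -> : 512 * M / eps ^+ 2 = M * (256 / eps ^+ 2) + M * (256 / eps ^+ 2).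
  by field; rewrite gt_eqF.
by have : eps * (M * t) <= eps * d; [rewrite ler_pM2l|lra].
Qed.

Lemma potential_ge_combine (R : realFieldType) (M eps t d v s : R) :
  0 < M -> 0 < eps -> M * t <= d ->
  - 2 * s - 2 * eps * t - v <= 4 * (256 / eps ^+ 2) ->
  - 2 * s - 2 * eps / M * d - 1024 / eps ^+ 2 <= v.
Proof.
move=> M0 e0; rewrite mulrC -ler_pdivlMr// => td.
have -> : 2 * eps / M * d = 2 * (eps * (d / M)) by ring.
have -> : 1024 / eps ^+ 2 = 4 * (256 / eps ^+ 2) by field; rewrite gt_eqF.
by have : eps * t <= eps * (d / M); [rewrite ler_pM2l|lra].
Qed.

Section interaction.
Context {R : realType}.
Local Notation P2 := (measurableTypeR R * measurableTypeR R)%type.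
Local Notation nu := (leb2 \x leb2)%E.

Lemma kernelEN (d c : R) (z : P2) : kernelE d c (- z) = kernelE d c z.
Proof. by rewrite /kernelE /kprofE /= !oppr_eq0 !kprofN. Qed.

Lemma V_ge (x : P2) : 4 * ln (enorm x) <= V x.
Proof.
rewrite /V; have [n0|n0] := eqVneq (enorm x) 0.
  by rewrite n0 ln0// mulr0 mulr_ge0// ln_ge0// lerDl sqr_ge0.
have {n0}n0 : 0 < enorm x by rewrite lt0r n0 enorm_ge0.
have -> : 4 * ln (enorm x) = 2 * ln (enorm x ^+ 2).
  by rewrite lnXn// mulr_natl; ring.
rewrite ler_wpM2l// ler_ln ?posrE ?exprn_gt0//; last by rewrite ltr_wpDr ?sqr_ge0.
by rewrite lerDr.
Qed.

Section density.
Variables (rho : P2 -> R) (M eps : R).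
Hypotheses (M0 : 0 < M) (eps0 : 0 < eps) (eps1 : eps <= 1).
Hypothesis rho0 : forall x, 0 <= rho x.
Hypothesis irho : leb2.-integrable setT (EFin \o rho).
Hypothesis rhoM : \int[leb2]_x rho x = M.
Hypothesis ient : leb2.-integrable setT (fun x => (rho x * ln (rho x))%:E).

Let S : R := \int[leb2]_x (rho x * ln (rho x)).
Let w (x : P2) : R := - ln (rho x).
Let w0 : R := - S / M.
Let k : P2 -> \bar R := kernelE (eps / 2) (w0 / 2).

Let eps20 : 0 < eps / 2. Proof. by rewrite divr_gt0. Qed.
Let eps21 : eps / 2 <= 1. Proof. have := eps0; have := eps1; lra. Qed.

Let k0 z : (0 <= k z)%E. Proof. exact: kernelE_ge0. Qed.

Let mk : measurable_fun setT k. Proof. exact: measurable_kernelE. Qed.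

Let C : R := 256 / eps ^+ 2.

Let kC : (\int[leb2]_z k z <= C%:E)%E.
Proof.
have := @integral_kernelE R (eps / 2) (w0 / 2) eps20 eps21.
rewrite (_ : 64 / (eps / 2) ^+ 2 = C)//.
by rewrite /C; field; rewrite gt_eqF.
Qed.

Let mrho : measurable_fun setT rho.
Proof. by apply/measurable_EFinP; exact: (measurable_int _ irho). Qed.

Let mw : measurable_fun setT w.
Proof. by apply: measurableT_comp => //; exact: (measurableT_comp (@measurable_ln R) mrho). Qed.

Let irw : leb2.-integrable setT (EFin \o (fun x => rho x * w x)).
Proof.
have -> : EFin \o (fun x => rho x * w x) = (\- (fun x => (rho x * ln (rho x))%:E))%E.
  by apply/funext => x /=; rewrite /w mulrN EFinN.
exact: integrableN.
Qed.

Let rwE : \int[leb2]_x (rho x * w x) = - S.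
Proof.
have -> : (fun x => rho x * w x) = (fun x => - 1 * (rho x * ln (rho x))).
  by apply/funext => x; rewrite /w; ring.
by rewrite RintegralZl// mulN1r.
Qed.

Let dev (x : P2) : R := rho x * `|w x - w0|.

Let dev0 x : 0 <= dev x. Proof. exact: mulr_ge0. Qed.

Let idev : leb2.-integrable setT (EFin \o dev).
Proof.
have [i1 _] := Rintegral_axpy (- w0) irho irw.
apply: le_integrable i1 => //.
  apply/measurable_EFinP/measurable_funM => //.
  by apply: measurableT_comp => //; exact: measurable_funB.
move=> x _; rewrite lee_fin /dev /= normrM normr_id (ger0_norm (rho0 x)).
have -> : - w0 * rho x + rho x * w x = rho x * (w x - w0) by ring.
by rewrite normrM (ger0_norm (rho0 x)).
Qed.

Let T : R := \int[leb2]_x dev x.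

Let spread (z : P2 * P2) : R := rho z.1 * rho z.2 * `|w z.1 - w z.2|.

Let spread0 z : 0 <= spread z.
Proof. by rewrite mulr_ge0// mulr_ge0. Qed.

Let mspread : measurable_fun setT spread.
Proof.
apply: measurable_funM; first apply: measurable_funM.
- exact: (measurableT_comp mrho measurable_fst).
- exact: (measurableT_comp mrho measurable_snd).
- apply: measurableT_comp => //; apply: measurable_funB.
    exact: (measurableT_comp mw measurable_fst).
  exact: (measurableT_comp mw measurable_snd).
Qed.

Let ispread : nu.-integrable setT (EFin \o spread).
Proof.
have [i1 _] := Rintegral_axpy 1 (integrable_prod irho idev) (integrable_prod idev irho).
apply: le_integrable i1 => //; first exact/measurable_EFinP.
move=> z _; rewrite lee_fin /= mul1r (ger0_norm (spread0 z)).
rewrite ger0_norm; last by apply: addr_ge0; apply: mulr_ge0; rewrite ?dev0.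
rewrite /spread /dev.
have -> : rho z.1 * (rho z.2 * `|w z.2 - w0|) + rho z.1 * `|w z.1 - w0| * rho z.2 =
  rho z.1 * rho z.2 * (`|w z.1 - w0| + `|w z.2 - w0|) by ring.
rewrite ler_wpM2l ?mulr_ge0//.
have -> : w z.1 - w z.2 = (w z.1 - w0) - (w z.2 - w0) by ring.
exact: ler_normB.
Qed.

Let D : R := \int[nu]_z spread z.

Let D0 : 0 <= D. Proof. by apply: Rintegral_ge0 => z _; exact: spread0. Qed.

(* Jensen: [w0] is the mean of [w] for the measure [rho / M]. *)
Let dev_le_spread : M * T <= D.
Proof.
have pw x : ((M * dev x)%:E <= \int[leb2]_y (spread (x, y))%:E)%E.
  (* Its integral over y is M rho(x) (w(x) - w0), while its absolute value is the integrand of D. *)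
  pose g y := rho x * (w x * rho y - rho y * w y).
  have iwr : leb2.-integrable setT (EFin \o (fun y => w x * rho y)).
    exact: (integrableZl measurableT (w x) irho).
  have [i2 e2] := Rintegral_axpy (- 1) irw iwr.
  have ig : leb2.-integrable setT (EFin \o g).
    have := integrableZl measurableT (rho x) i2.
    by congr (_.-integrable _ _); apply/funext => y /=; rewrite /g -EFinM; congr EFin; ring.
  have Eg : \int[leb2]_y g y = rho x * (w x * M + S).
    rewrite /g RintegralZl//; last first.
      by move: i2; congr (_.-integrable _ _); apply/funext => y /=; congr EFin; ring.
    congr (_ * _).
    have -> : (fun y => w x * rho y - rho y * w y) = (fun y => - 1 * (rho y * w y) + w x * rho y).
      by apply/funext => y; ring.
    rewrite e2 rwE RintegralZl// rhoM; ring.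
  have -> : M * dev x = `|\int[leb2]_y g y|.
    rewrite Eg normrM (ger0_norm (rho0 x)) /dev mulrCA; congr (_ * _).
    rewrite -{1}(gtr0_norm M0) -normrM /w0; congr `|_|.
    by field; rewrite gt_eqF.
  rewrite EFin_normr_Rintegral//.
  apply: le_trans (le_abse_integral _ measurableT _) _.
    exact: (measurable_int _ ig).
  rewrite le_eqVlt; apply/orP; left; apply/eqP.
  apply: eq_integral => y _; rewrite /g /spread /= -mulrA; congr EFin.
  have -> : w x * rho y - rho y * w y = rho y * (w x - w y) by ring.
  by rewrite !normrM (ger0_norm (rho0 x)) (ger0_norm (rho0 y)).
rewrite -lee_fin /T /D /Rintegral EFinM !fineK ?integrable_fin_num//.
rewrite -integralZl//.
rewrite (fubini_tonelli1 (EFin \o spread))//; last exact/measurable_EFinP.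
rewrite /fubini_F; apply: ge0_le_integral => //.
- by move=> x _; rewrite lee_fin mulr_ge0 ?(ltW M0)// /dev mulr_ge0.
- by apply: emeasurable_funM => //; exact: (measurable_int _ idev).
- apply: (measurable_fun_fubini_tonelli_F (EFin \o spread)) => //.
  exact/measurable_EFinP.
- by move=> x _; rewrite -EFinM; exact: pw.
Qed.

Let kernel_bound (x z : P2) (r : R) : rho x = r -> 0 < r ->
  ((r * (w x / 2 - eps / 2 * `|w x - w0| - ln (enorm z)))%:E <= k z)%E.
Proof. by move=> <- r0; exact: ln_le_kernelE. Qed.

Hypothesis iint : nu.-integrable setT
  (fun z => (rho z.1 * ln (enorm (z.1 - z.2)) * rho z.2)%:E).
Hypothesis iV : leb2.-integrable setT (fun x => (V x * rho x)%:E).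

Let I : R := \int[nu]_z (rho z.1 * ln (enorm (z.1 - z.2)) * rho z.2).

(** At a pair (x, y) the kernel bound is applied at the point with the larger w, that is the smaller
    density, and multiplied by the density at the other point. This choice yields the term D / 4.
    Keeping both products in the majorant gives twice M times 256 / eps^2. *)
Lemma interaction_ge_spread : - (M / 2) * S + (1 / 4 - eps) * D - 512 * M / eps ^+ 2 <= I.
Proof.
have [i1 e1] := Rintegral_axpy (- (eps / 2)) (integrable_prod idev irho) (integrableN iint).
have [i2 e2] := Rintegral_axpy (- (eps / 2)) (integrable_prod irho idev) i1.
have [i3 e3] := Rintegral_axpy (1 / 4) (integrable_prod irw irho) i2.
have [i4 e4] := Rintegral_axpy (1 / 4) (integrable_prod irho irw) i3.
have [i5 e5] := Rintegral_axpy (1 / 4) ispread i4.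
move: i5 e5; set A := (fun x => _ * spread x + _) => i5 e5.
have EA : \int[nu]_z A z = - (M / 2) * S + D / 4 - eps * (M * T) - I.
  have p1 : \int[nu]_z (dev z.1 * rho z.2) = T * M.
    by rewrite -rhoM; exact: (Rintegral_prod idev irho).
  have p2 : \int[nu]_z (rho z.1 * dev z.2) = M * T.
    by rewrite -rhoM; exact: (Rintegral_prod irho idev).
  have p3 : \int[nu]_z (rho z.1 * w z.1 * rho z.2) = - S * M.
    by rewrite -rhoM -rwE; exact: (Rintegral_prod irw irho).
  have p4 : \int[nu]_z (rho z.1 * (rho z.2 * w z.2)) = M * - S.
    by rewrite -rhoM -rwE; exact: (Rintegral_prod irho irw).
  have p5 : \int[nu]_z - (rho z.1 * ln (enorm (z.1 - z.2)) * rho z.2) = - I.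
    rewrite -[RHS]mulN1r -RintegralZl//; apply: eq_Rintegral => z _; by rewrite mulN1r.
  move: e1 e2 e3 e4 e5; rewrite /= p1 p2 p3 p4 p5 -/D.
  move=> e1; rewrite e1 => e2; rewrite e2 => e3; rewrite e3 => e4; rewrite e4 => e5.
  by rewrite [LHS]e5; field.
  pose B (z : P2 * P2) : \bar R := ((rho z.1)%:E * k (z.1 - z.2)%R + (rho z.2)%:E * k (z.1 - z.2)%R)%E.
have B10 z : (0 <= (rho z.1)%:E * k (z.1 - z.2)%R)%E by rewrite mule_ge0 ?lee_fin.
have B20 z : (0 <= (rho z.2)%:E * k (z.1 - z.2)%R)%E by rewrite mule_ge0 ?lee_fin.
have mB1 : measurable_fun setT (fun z : P2 * P2 => (rho z.1)%:E * k (z.1 - z.2)%R)%E.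
  exact: (measurable_diff_kernel mrho mk measurable_fst).
have mB2 : measurable_fun setT (fun z : P2 * P2 => (rho z.2)%:E * k (z.1 - z.2)%R)%E.
  exact: (measurable_diff_kernel mrho mk measurable_snd).
have iB : (\int[nu]_z B z <= (M * C + M * C)%:E)%E.
  rewrite /B ge0_integralD// EFinD leeD//.
    have := ge0_integral_diff_kernel_fst rho0 irho mk k0 (kernelEN _ _) kC.
    by rewrite rhoM.
  have := ge0_integral_diff_kernel rho0 irho mk k0 kC.
  by rewrite rhoM.
have AB z : ((A z)%:E <= B z)%E.
  (* Every term of [A] carries the factor rho(z1) rho(z2), so zeros of the density, where w has its
     default value 0, are harmless. *)
  have [r1|r1] := eqVneq (rho z.1) 0.
    rewrite (_ : A z = 0) ?adde_ge0//.
    by rewrite /A /spread /dev r1 /=; ring.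
  have [r2|r2] := eqVneq (rho z.2) 0.
    rewrite (_ : A z = 0) ?adde_ge0//.
    by rewrite /A /spread /dev r2 /=; ring.
  have {r1}r1 : 0 < rho z.1 by rewrite lt0r r1 rho0.
  have {r2}r2 : 0 < rho z.2 by rewrite lt0r r2 rho0.
  have k1 := kernel_bound (z.1 - z.2) (erefl (rho z.1)) r1.
  have k2 := kernel_bound (z.1 - z.2) (erefl (rho z.2)) r2.
  have AE : A z = rho z.1 * rho z.2 * ((`|w z.1 - w z.2| + w z.1 + w z.2) / 4
     - eps / 2 * `|w z.1 - w0| - eps / 2 * `|w z.2 - w0| - ln (enorm (z.1 - z.2))).
    by rewrite /A /spread /dev /=; field.
  have r10 : (0 <= (rho z.1)%:E)%E by rewrite lee_fin.
  have r20 : (0 <= (rho z.2)%:E)%E by rewrite lee_fin.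
  have n1 : 0 <= eps / 2 * `|w z.1 - w0| by rewrite mulr_ge0// ltW.
  have n2 : 0 <= eps / 2 * `|w z.2 - w0| by rewrite mulr_ge0// ltW.
  have l1 := lee_wpmul2l (r20 : 0 <= (rho z.2)%:E)%E k1.
  have l2 := lee_wpmul2l (r10 : 0 <= (rho z.1)%:E)%E k2.
  rewrite AE /B; have [ww|/ltW ww] := lerP (w z.2) (w z.1).
    apply: (@le_trans _ _ ((rho z.2)%:E * k (z.1 - z.2)%R)%E); last by rewrite leeDr.
    apply: le_trans l1.
    rewrite -EFinM lee_fin mulrA (mulrC (rho z.2)) ler_wpM2l ?mulr_ge0//.
    exact: (max_halves _ _ _ n1 n2).1.
  apply: (@le_trans _ _ ((rho z.1)%:E * k (z.1 - z.2)%R)%E); last by rewrite leeDl.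
  apply: le_trans l2.
  rewrite -EFinM lee_fin mulrA ler_wpM2l ?mulr_ge0//.
  exact: (max_halves _ _ _ n1 n2).2.
have mB : measurable_fun setT B by exact: emeasurable_funD.
have B0 z : (0 <= B z)%E by rewrite adde_ge0.
have := Rintegral_le_majorant i5 mB B0 AB iB.
rewrite [X in X <= _]EA; exact: interaction_ge_combine.
Qed.

(** Four times the kernel bound at z = x, combined with V >= 4 ln|x|; the deviation from the mean is
    then bounded by D / M. *)
Lemma potential_ge_spread : - 2 * S - 2 * eps / M * D - 1024 / eps ^+ 2 <= \int[leb2]_x (V x * rho x).
Proof.
have [i1 e1] := Rintegral_axpy (- (2 * eps)) idev (integrableN iV).
have [i2 e2] := Rintegral_axpy 2 irw i1.
move: i2 e2; set A := (fun x => 2 * _ + _) => i2 e2.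
have EA : \int[leb2]_x A x = - 2 * S - 2 * eps * T - \int[leb2]_x (V x * rho x).
  have p5 : \int[leb2]_x - (V x * rho x) = - \int[leb2]_x (V x * rho x).
    rewrite -[RHS]mulN1r -RintegralZl//; apply: eq_Rintegral => z _; by rewrite mulN1r.
  move: e1 e2; rewrite /= p5 rwE -/T => e1; rewrite e1 => e2.
  by rewrite [LHS]e2; ring.
pose B x : \bar R := (4%:E * k x)%E.
have mB : measurable_fun setT B by exact: measurable_funeM.
have B0 x : (0 <= B x)%E by rewrite mule_ge0 ?lee_fin.
have iB : (\int[leb2]_x B x <= (4 * C)%:E)%E.
  by rewrite /B ge0_integralZl// EFinM lee_wpmul2l ?lee_fin.
have AB x : ((A x)%:E <= B x)%E.
  have [r1|r1] := eqVneq (rho x) 0.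
    by rewrite (_ : A x = 0)// /A /dev r1 /=; ring.
  have {r1}r1 : 0 < rho x by rewrite lt0r r1 rho0.
  have k1 := kernel_bound x (erefl (rho x)) r1.
  have l0 : (0 <= (4%R : R)%:E)%E by rewrite lee_fin.
  have l1 := lee_wpmul2l l0 k1.
  rewrite /B; apply: le_trans l1.
  rewrite -EFinM lee_fin /A /dev /=.
  have -> : 4 * (rho x * (w x / 2 - eps / 2 * `|w x - w0| - ln (enorm x))) =
     2 * (rho x * w x) + (- (2 * eps) * (rho x * `|w x - w0|) - rho x * (4 * ln (enorm x))) by field.
  rewrite !lerD2l lerN2 (mulrC (V x)) ler_wpM2l//.
  exact: V_ge.
have := Rintegral_le_majorant i2 mB B0 AB iB.
by rewrite EA; exact: potential_ge_combine.
Qed.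

End density.

(** Both inequalities share the same D: a gain in the first and a loss in the second, to be balanced
    by the choice of [eps]. *)
Lemma interaction_potential_ge (rho : P2 -> R) (M eps : R) :
  0 < M -> 0 < eps -> eps <= 1 -> (forall x, 0 <= rho x) ->
  leb2.-integrable setT (EFin \o rho) -> \int[leb2]_x rho x = M ->
  leb2.-integrable setT (fun x => (rho x * ln (rho x))%:E) ->
  nu.-integrable setT (fun z => (rho z.1 * ln (enorm (z.1 - z.2)) * rho z.2)%:E) ->
  leb2.-integrable setT (fun x => (V x * rho x)%:E) ->
  exists2 D, 0 <= D &
    - (M / 2) * (\int[leb2]_x (rho x * ln (rho x))) + (1 / 4 - eps) * D
      - 512 * M / eps ^+ 2 <=
      \int[nu]_z (rho z.1 * ln (enorm (z.1 - z.2)) * rho z.2) /\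
    - 2 * (\int[leb2]_x (rho x * ln (rho x))) - 2 * eps / M * D - 1024 / eps ^+ 2 <=
      \int[leb2]_x (V x * rho x).
Proof.
move=> M0 e0 e1 r0 ir rM ie ii iV.
exists (\int[nu]_z (rho z.1 * rho z.2 * `|- ln (rho z.1) - - ln (rho z.2)|)); last split.
- by apply: Rintegral_ge0 => z _; rewrite mulr_ge0// mulr_ge0.
- exact: interaction_ge_spread.
- exact: potential_ge_spread.
Qed.

End interaction.

(** * Boundedness from below *)

(** Integrability is not assumed: if one of the two parts has an infinite integral, [fine] sends
    both sides to 0. This matters for [W], whose integrand need not be integrable at every point. *)
Lemma ge0_RintegralZl d (T : measurableType d) (R : realType)
    (mu : {measure set T -> \bar R}) (c : R) (f : T -> R) :
  0 <= c -> measurable_fun setT f ->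
  \int[mu]_x (c * f x) = c * \int[mu]_x f x.
Proof.
move=> c0 mf; have mF : measurable_fun setT (EFin \o f) by exact/measurable_EFinP.
have [->|cn0] := eqVneq c 0.
  rewrite mul0r /Rintegral; under eq_integral do rewrite mul0r.
  by rewrite integral0.
have {cn0}c1 : 0 < c by rewrite lt0r cn0.
have c1i : (c%:E < +oo)%E by rewrite ltry.
rewrite /Rintegral [X in fine X = _]integralE [in RHS]integralE.
have -> : ((fun x => (c * f x)%:E)^\+ = (fun x => c%:E * ((EFin \o f)^\+ x)))%E.
  by rewrite -ge0_funeposM//; congr (_^\+)%E; apply/funext => x; rewrite EFinM.
have -> : ((fun x => (c * f x)%:E)^\- = (fun x => c%:E * ((EFin \o f)^\- x)))%E.
  by rewrite -ge0_funenegM//; congr (_^\-)%E; apply/funext => x; rewrite EFinM.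
rewrite ge0_integralZl//; last exact: measurable_funepos.
rewrite ge0_integralZl//; last exact: measurable_funeneg.
have : (0 <= \int[mu]_x (EFin \o f)^\+ x)%E by exact: integral_ge0.
have : (0 <= \int[mu]_x (EFin \o f)^\- x)%E by exact: integral_ge0.
rewrite -/(EFin \o f).
case: (\int[mu]_x (EFin \o f)^\+ x)%E => [a| |]//; case: (\int[mu]_x (EFin \o f)^\- x)%E => [b| |]// _ _.
- by rewrite -!EFinM -!EFinB /= mulrBr.
- by rewrite gt0_muley//= mulr0.
- by rewrite gt0_muley//= mulr0.
- by rewrite gt0_muley//= mulr0.
Qed.

(** * From the potential W to the double integral of the interaction *)

Section energy_terms.
Context {R : realType}.
Local Notation P2 := (measurableTypeR R * measurableTypeR R)%type.
Local Notation nu := (leb2 \x leb2)%E.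

(** Real and extended inner integrals differ only where the latter is infinite, which is a null
    set. *)
Lemma Rintegral12_prod (F : P2 * P2 -> R) : nu.-integrable setT (EFin \o F) ->
  leb2.-integrable setT (fun x => (\int[leb2]_y F (x, y))%:E) /\
  \int[leb2]_x (\int[leb2]_y F (x, y)) = \int[nu]_z F z.
Proof.
move=> iF; have iG := integrable_fubini_F iF.
have mG := measurable_int _ iG.
have aeG : ae_eq leb2 setT (fubini_F leb2 (EFin \o F)) (EFin \o (fun x => \int[leb2]_y F (x, y))).
  have := integrable_ae measurableT iG; apply: filterS => x /(_ I) h _.
  by rewrite /= /Rintegral fineK.
have mg : measurable_fun setT (fun x => (\int[leb2]_y F (x, y))%:E).
  by apply/measurable_EFinP; exact: (measurableT_comp (@fine_measurable R setT measurableT) mG).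
split.
  apply: (le_integrable measurableT mg _ iG) => x _.
  by rewrite /Rintegral -/(fubini_F leb2 (EFin \o F) x); case: (fubini_F _ _ _) => [r| |] //=; rewrite normr0 leey.
rewrite [RHS]/Rintegral -(integral12_prod_meas1 iF) [LHS]/Rintegral; congr fine.
by apply/esym/ae_eq_integral.
Qed.

Lemma interaction_energy (u : P2 -> R[i]) : measurable_fun setT (sqmod u) ->
  nu.-integrable setT
    (fun z => (sqmod u z.1 * ln (enorm (z.1 - z.2)) * sqmod u z.2)%:E) ->
  2 * pi * \int[leb2]_x (W u x * sqmod u x) =
  - \int[nu]_z (sqmod u z.1 * ln (enorm (z.1 - z.2)) * sqmod u z.2).
Proof.
move=> mu ii; have [i1 <-] := Rintegral12_prod ii.
have u0 x : 0 <= sqmod u x by rewrite sqr_ge0.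
have E x : W u x * sqmod u x =
  - (2 * pi)^-1 * \int[leb2]_y (sqmod u x * ln (enorm (x - y)) * sqmod u y).
  rewrite /W -mulrA; congr (_ * _); rewrite mulrC -ge0_RintegralZl//.
    by apply: eq_Rintegral => y _; ring.
  apply: measurable_funM => //; apply: (measurableT_comp (@measurable_ln R)).
  apply: (measurableT_comp measurable_enorm).
  apply/measurable_fun_pairP; split; apply: measurable_funB => //=.
under eq_Rintegral do rewrite E.
rewrite RintegralZl// mulrA mulrN divff ?mulN1r//.
by rewrite mulf_neq0// gt_eqF// pi_gt0.
Qed.

End energy_terms.

Section lower_bound.
Context {R : realType}.
Local Notation P2 := (measurableTypeR R * measurableTypeR R)%type.
Local Notation nu := (leb2 \x leb2)%E.

Lemma sqmodE (u : P2 -> R[i]) x : sqmod u x = re u x ^+ 2 + im u x ^+ 2.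
Proof.
rewrite /sqmod /re /im; case: (u x) => a b /=.
by rewrite sqr_sqrtr// addr_ge0// sqr_ge0.
Qed.

Lemma V_ge0 (x : P2) : 0 <= V x.
Proof. by rewrite /V mulr_ge0// ln_ge0// lerDl sqr_ge0. Qed.

Lemma ln_enormB_le (x y : P2) : ln (enorm (x - y)) <= V x / 4 + V y / 4.
Proof.
have [n0|n0] := eqVneq (enorm (x - y)) 0.
  by rewrite n0 ln0// addr_ge0// divr_ge0// V_ge0.
have {n0}n0 : 0 < enorm (x - y) by rewrite lt0r n0 enorm_ge0.
have p1 : 0 < 1 + enorm x ^+ 2 by rewrite ltr_pwDl ?sqr_ge0.
have p2 : 0 < 1 + enorm y ^+ 2 by rewrite ltr_pwDl ?sqr_ge0.
have -> : V x / 4 + V y / 4 = ln ((1 + enorm x ^+ 2) * (1 + enorm y ^+ 2)) / 2.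
  by rewrite lnM// /V; field.
have -> : ln (enorm (x - y)) = ln (enorm (x - y) ^+ 2) / 2.
  by rewrite lnXn// mulr2n; field.
rewrite ler_pM2r// ler_ln ?posrE ?exprn_gt0 ?mulr_gt0//.
rewrite !enorm_sqr /=.
(* The difference (1 + |x|^2) (1 + |y|^2) - |x - y|^2 is exactly the sum of these two squares. *)
have := sqr_ge0 (1 + x.1 * y.1 + x.2 * y.2); have := sqr_ge0 (x.1 * y.2 - x.2 * y.1).
nra.
Qed.

Lemma interaction_le (rho : P2 -> R) : (forall x, 0 <= rho x) ->
  leb2.-integrable setT (EFin \o rho) ->
  nu.-integrable setT (fun z => (rho z.1 * ln (enorm (z.1 - z.2)) * rho z.2)%:E) ->
  leb2.-integrable setT (fun x => (V x * rho x)%:E) ->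
  \int[nu]_z (rho z.1 * ln (enorm (z.1 - z.2)) * rho z.2) <=
  (\int[leb2]_x rho x) / 2 * \int[leb2]_x (V x * rho x).
Proof.
move=> r0 ir ii iV.
have [i1 e1] := Rintegral_axpy 1 (integrable_prod iV ir) (integrable_prod ir iV).
have p1 : \int[nu]_z (V z.1 * rho z.1 * rho z.2) =
    (\int[leb2]_x (V x * rho x)) * \int[leb2]_x rho x by exact: (Rintegral_prod iV ir).
have p2 : \int[nu]_z (rho z.1 * (V z.2 * rho z.2)) =
    (\int[leb2]_x rho x) * \int[leb2]_x (V x * rho x) by exact: (Rintegral_prod ir iV).
move: i1 e1; set A := (fun x => 1 * _ + _) => i1 e1.
have EA : \int[nu]_z A z = 2 * ((\int[leb2]_x rho x) * \int[leb2]_x (V x * rho x)).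
  by move: e1; rewrite /= p1 p2 => e1; rewrite [LHS]e1; ring.
have -> : (\int[leb2]_x rho x) / 2 * \int[leb2]_x (V x * rho x) = 4^-1 * \int[nu]_z A z.
  by rewrite EA; field.
rewrite -RintegralZl//; apply: le_Rintegral => //.
  exact: integrableZl i1.
move=> z _; rewrite /A /=.
have -> : 4^-1 * (1 * (V z.1 * rho z.1 * rho z.2) + rho z.1 * (V z.2 * rho z.2)) =
  rho z.1 * (V z.1 / 4 + V z.2 / 4) * rho z.2 by field.
by rewrite ler_wpM2r// ler_wpM2l// ln_enormB_le.
Qed.

Lemma entropy_potential_ge (tau : R) : 1 / 2 < tau ->
  exists C : R, forall rho : P2 -> R, (forall x, 0 <= rho x) ->
    leb2.-integrable setT (EFin \o rho) ->
    leb2.-integrable setT (fun x => (rho x * ln (rho x))%:E) ->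
    leb2.-integrable setT (fun x => (V x * rho x)%:E) ->
    - C <= \int[leb2]_x (rho x * ln (rho x)) + tau * \int[leb2]_x (V x * rho x).
Proof.
move=> t2; have t0 : 0 < tau by apply: lt_trans t2.
(* With w0 = 0 and w >= 0 the bracket of [ln_le_kernelE] is (1 - eps) w / 2 - ln|x|. This choice
   makes the coefficient of w equal to 1 / (4 tau), so multiplying by 4 tau produces the entropy
   with coefficient one. *)
pose eps := 1 - (2 * tau)^-1.
have e0 : 0 < eps by rewrite subr_gt0 invf_lt1 ?mulr_gt0//; lra.
have e1 : eps <= 1 by rewrite gerBl invr_ge0 mulr_ge0// ltW.
have eps20 : 0 < eps / 2 by rewrite divr_gt0.
have eps21 : eps / 2 <= 1 by lra.
exists (4 * tau * (64 / (eps / 2) ^+ 2)) => rho r0 ir ie iV.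
have [i1 e1'] := Rintegral_axpy (- tau) iV (integrableN ie).
have p1 : \int[leb2]_x - (rho x * ln (rho x)) = - \int[leb2]_x (rho x * ln (rho x)).
  rewrite -[RHS]mulN1r -RintegralZl//; apply: eq_Rintegral => z _; by rewrite mulN1r.
rewrite lerNl; move: i1 e1'; rewrite /= p1; set A := (fun x => - tau * _ + _) => i1 e1'.
have -> : - (\int[leb2]_x (rho x * ln (rho x)) + tau * \int[leb2]_x (V x * rho x)) =
  \int[leb2]_x A x by rewrite [RHS]e1'; ring.
pose k : P2 -> \bar R := kernelE (eps / 2) (0 / 2).
have k0 z : (0 <= k z)%E by exact: kernelE_ge0.
have mk : measurable_fun setT k by exact: measurable_kernelE.
have c0 : (0 <= (4 * tau)%:E)%E by rewrite lee_fin mulr_ge0// ltW.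
pose B x : \bar R := ((4 * tau)%:E * k x)%E.
have mB : measurable_fun setT B by exact: measurable_funeM.
have B0 x : (0 <= B x)%E by rewrite mule_ge0.
have iB : (\int[leb2]_x B x <= (4 * tau * (64 / (eps / 2) ^+ 2))%:E)%E.
  rewrite /B ge0_integralZl// [X in (_ <= X)%E]EFinM; apply: lee_wpmul2l => //.
  exact: integral_kernelE.
apply: (Rintegral_le_majorant i1 mB B0 _ iB) => x.
have [r1|r1] := eqVneq (rho x) 0.
  by rewrite (_ : A x = 0)// /A r1 /=; ring.
have {r1}r1 : 0 < rho x by rewrite lt0r r1 r0.
have [w0|w0] := lerP 0 (- ln (rho x)); last first.
  apply: le_trans (B0 x); rewrite lee_fin /A /= -mulrN.
  rewrite mulNr addrC subr_le0 (le_trans (_ : _ <= 0))//.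
    by rewrite mulr_ge0_le0// ltW.
  by rewrite mulr_ge0 ?(ltW t0)// mulr_ge0 ?V_ge0.
have := lee_wpmul2l c0 (ln_le_kernelE 0 x e0 e1 r1).
apply: le_trans; rewrite -EFinM lee_fin subr0 ger0_norm// /A /=.
have -> : 4 * tau * (rho x * (- ln (rho x) / 2 - eps / 2 * - ln (rho x) - ln (enorm x))) =
  - tau * (4 * ln (enorm x) * rho x) - rho x * ln (rho x).
  by rewrite /eps; field; rewrite gt_eqF.
by rewrite lerD2r ler_nM2l ?oppr_lt0// ler_wpM2r// V_ge.
Qed.

End lower_bound.

Lemma integrableD4 d (T : measurableType d) (R : realType)
    (mu : {measure set T -> \bar R}) (f1 f2 f3 f4 h : T -> \bar R) :
  mu.-integrable setT f1 -> mu.-integrable setT f2 ->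
  mu.-integrable setT f3 -> mu.-integrable setT f4 ->
  (forall x, h x = f1 x + f2 x + (f3 x + f4 x))%E ->
  mu.-integrable setT h /\
  ((\int[mu]_x h x = \int[mu]_x f1 x + \int[mu]_x f3 x +
    (\int[mu]_x f2 x + \int[mu]_x f4 x))%E).
Proof.
move=> i1 i2 i3 i4 hE; have -> : h = ((f1 \+ f2) \+ (f3 \+ f4))%E by exact/funext.
have i12 := integrableD measurableT i1 i2.
have i34 := integrableD measurableT i3 i4.
split; first exact: integrableD.
by rewrite integralD// integralD// integralD// addeACA.
Qed.

(** The equality assumed on alpha d says that the loss of D in the potential cancels the gain in the
    interaction exactly. *)
Lemma energy_ge_combine_beta_lt0 (R : realFieldType) (alpha beta gamma M D d eps c1 c2 C s v i k : R) :
  0 <= alpha -> beta < 0 -> 0 <= D -> alpha * d = (- beta / 4 + eps * beta) * D ->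
  - (M / 2) * s + (1 / 4 - eps) * D - c1 <= i ->
  - 2 * s - d - c2 <= v ->
  - C <= k - (2 * alpha - beta * M / 2 - gamma) * s ->
  - (C - beta * c1 + alpha * c2) <= k + alpha * v - beta * i + gamma * s.
Proof.
move=> a0 b0 D0 ad hi hv hk.
have h1 : alpha * (- 2 * s - d - c2) <= alpha * v by rewrite ler_wpM2l.
have h2 : beta * i <= beta * (- (M / 2) * s + (1 / 4 - eps) * D - c1).
  by rewrite ler_nM2l.
move: hk; lra.
Qed.

Lemma energy_ge_combine_gamma_le0 (R : realFieldType) (alpha beta gamma M C s v i k : R) :
  0 <= beta -> M * beta <= 2 * alpha ->
  0 <= v -> i <= M / 2 * v -> - C <= k - (- gamma) * s ->
  - C <= k + alpha * v - beta * i + gamma * s.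
Proof.
move=> b0 ab v0 iv hk.
have h1 : beta * i <= beta * (M / 2 * v) by rewrite ler_wpM2l.
have h2 : 0 <= (2 * alpha - M * beta) * v by rewrite mulr_ge0// subr_ge0.
move: hk; lra.
Qed.

Lemma energy_ge_combine_gamma_gt0 (R : realFieldType) (alpha beta gamma M C s v i k : R) :
  0 <= beta -> 0 < gamma -> 0 <= k ->
  - C <= s + (alpha - beta * M / 2) / gamma * v -> i <= M / 2 * v ->
  - (gamma * C) <= k + alpha * v - beta * i + gamma * s.
Proof.
move=> b0 g0 k0 h iv.
have h1 : beta * i <= beta * (M / 2 * v) by rewrite ler_wpM2l.
have h2 : gamma * - C <= gamma * (s + (alpha - beta * M / 2) / gamma * v).
  by rewrite ler_pM2l.
have : gamma * (s + (alpha - beta * M / 2) / gamma * v) =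
  gamma * s + (alpha - beta * M / 2) * v by field; rewrite gt_eqF.
lra.
Qed.

Section bounded_below.
Context {R : realType}.
Local Notation P2 := (measurableTypeR R * measurableTypeR R)%type.
Local Notation nu := (leb2 \x leb2)%E.

Lemma sqgradE (u : P2 -> R[i]) x : (sqgrad u x)%:E =
  ((wpartial ord0 (re u) x ^+ 2)%:E + (wpartial ord0 (im u) x ^+ 2)%:E +
   ((wpartial (lift ord0 ord0) (re u) x ^+ 2)%:E +
    (wpartial (lift ord0 ord0) (im u) x ^+ 2)%:E))%E.
Proof. by rewrite -!EFinD /sqgrad big_ord_recl big_ord1. Qed.

Lemma sphere_facts (sc : scalars) (M : R) (u : P2 -> R[i]) : sphere sc M u ->
  [/\ H1_real (re u), H1_real (im u), leb2.-integrable setT (EFin \o sqmod u),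
    \int[leb2]_x sqmod u x = M &
    (energy_mass (re u) + energy_mass (im u) = (\int[leb2]_x sqgrad u x)%:E)%E].
Proof.
move=> [[H1 H2 _] uM].
have [] := H1; rewrite Lfun2P => -[_ i1] _; have [] := H2; rewrite Lfun2P => -[_ i2] _.
have ir : leb2.-integrable setT (EFin \o sqmod u).
  have := integrableD measurableT i1 i2; congr (_.-integrable _ _).
  by apply/funext => x /=; rewrite sqmodE EFinD.
split => //.
have [/Lfun2P[_ a1] _] := wpartialP ord0 H1.
have [/Lfun2P[_ a2] _] := wpartialP (lift ord0 ord0) H1.
have [/Lfun2P[_ b1] _] := wpartialP ord0 H2.
have [/Lfun2P[_ b2] _] := wpartialP (lift ord0 ord0) H2.
have [ig Eg] := integrableD4 a1 b1 a2 b2 (sqgradE u).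
by rewrite /Rintegral fineK ?integrable_fin_num// Eg.
Qed.

Lemma energyE (sc : scalars) (M alpha beta gamma : R) (u : P2 -> R[i]) :
  sphere sc M u -> energy_dom u ->
  energy alpha beta gamma u = \int[leb2]_x sqgrad u x
    + alpha * (\int[leb2]_x (V x * sqmod u x))
    - beta * (\int[nu]_z (sqmod u z.1 * ln (enorm (z.1 - z.2)) * sqmod u z.2))
    + gamma * (\int[leb2]_x (sqmod u x * ln (sqmod u x))).
Proof.
move=> /sphere_facts[_ _ ir _ _] [_ _ ii _].
have mu : measurable_fun setT (sqmod u).
  by apply/measurable_EFinP; exact: (measurable_int _ ir).
rewrite /energy -(mulrN beta); congr (_ + _ + _ + _).
by rewrite -(interaction_energy mu ii); ring.
Qed.

Lemma sphere_entropy_le (M kappa : R) : 0 < M -> 0 <= kappa ->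
  exists C : R, forall sc (u : P2 -> R[i]), sphere sc M u -> energy_dom u ->
    - C <= \int[leb2]_x sqgrad u x - kappa * (\int[leb2]_x (sqmod u x * ln (sqmod u x))).
Proof.
move=> M0 k0; have k1 : 0 < kappa + 1 by rewrite ltr_wpDl.
(* With this choice kappa times the energy term in the entropy bound is at most the energy itself,
   also for kappa = 0. *)
have e0 : 0 < (kappa + 1)^-1 by rewrite invr_gt0.
have [C HC] := H1_entropy_le M0 e0.
exists (kappa * C) => sc u us [_ _ _ ie].
have [H1 H2 ir rM EK] := sphere_facts us.
have K0 : 0 <= \int[leb2]_x sqgrad u x.
  by rewrite -lee_fin -EK adde_ge0// energy_mass_ge0.
have sE : sqmod u = (fun z => re u z ^+ 2 + im u z ^+ 2) by apply/funext => z; exact: sqmodE.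
have iM : (\int[leb2]_z (re u z ^+ 2 + im u z ^+ 2)%:E = M%:E)%E.
  by move: ir; rewrite -rM sE => ir'; rewrite [in RHS]/Rintegral fineK ?integrable_fin_num.
have : \int[leb2]_x (sqmod u x * ln (sqmod u x)) <=
    (kappa + 1)^-1 * (\int[leb2]_x sqgrad u x) + C.
  by move: ie; rewrite sE => ie'; exact: HC iM EK ie'.
move: (\int[leb2]_x (sqmod u x * ln (sqmod u x))) (\int[leb2]_x sqgrad u x) K0 => s k k0' sk.
have : kappa * s <= kappa * ((kappa + 1)^-1 * k + C) by rewrite ler_wpM2l.
have : kappa * ((kappa + 1)^-1 * k) <= k.
  by rewrite mulrA ler_piMl// ler_pdivrMr// mul1r lerDl.
lra.
Qed.

Lemma energy_ge_of_beta_lt0 (sc : scalars) (M alpha beta gamma : R) :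
  0 < M -> 0 <= alpha -> beta < 0 -> gamma <= 2 * alpha - beta * M / 2 ->
  energy_bounded_below sc alpha beta gamma M.
Proof.
move=> M0 a0 b0 kg.
have k0 : 0 <= 2 * alpha - beta * M / 2 - gamma by rewrite subr_ge0.
have [C HC] := sphere_entropy_le M0 k0.
(* Cancellation of D requires 2 alpha eps / M = - beta / 4 + eps beta, that is eps c = - beta / 4;
   since c >= - beta, this eps is at most 1/4. *)
pose c := - beta + 2 * alpha / M.
have bc : - beta <= c by rewrite lerDl divr_ge0 ?mulr_ge0// ltW.
have c0 : 0 < c by apply: lt_le_trans bc; rewrite oppr_gt0.
pose eps := - beta / (4 * c).
have e0 : 0 < eps by rewrite divr_gt0 ?oppr_gt0 ?mulr_gt0.
have e1 : eps <= 1 by rewrite /eps ler_pdivrMr ?mulr_gt0//; move: bc c0; lra.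
have ec : eps * c = - beta / 4 by rewrite /eps; field; rewrite gt_eqF.
exists (- (C - beta * (512 * M / eps ^+ 2) + alpha * (1024 / eps ^+ 2))).
move=> _ [u [us ud] <-]; rewrite (energyE _ _ _ us ud).
have := HC _ _ us ud; have [_ _ ir rM _] := sphere_facts us.
have [iV _ ii ie] := ud.
have u0 x : 0 <= sqmod u x by rewrite sqr_ge0.
have [D D0 []] := interaction_potential_ge M0 e0 e1 u0 ir rM ie ii iV.
have {}ec : alpha * (2 * eps / M * D) = (- beta / 4 + eps * beta) * D.
  have -> : alpha * (2 * eps / M * D) = (eps * c + eps * beta) * D.
    by rewrite /c; field; rewrite gt_eqF.
  by rewrite ec.
exact: (@energy_ge_combine_beta_lt0 _ alpha beta gamma M D (2 * eps / M * D) eps).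
Qed.

Lemma energy_ge_of_gamma_le0 (sc : scalars) (M alpha beta gamma : R) :
  0 < M -> 0 <= beta -> gamma <= 0 -> M * beta <= 2 * alpha ->
  energy_bounded_below sc alpha beta gamma M.
Proof.
move=> M0 b0 g0 ab; have k0 : 0 <= - gamma by rewrite oppr_ge0.
have [C HC] := sphere_entropy_le M0 k0.
exists (- C) => _ [u [us ud] <-]; rewrite (energyE _ _ _ us ud).
have := HC _ _ us ud; have [_ _ ir rM _] := sphere_facts us.
have [iV _ ii ie] := ud.
have u0 x : 0 <= sqmod u x by rewrite sqr_ge0.
have := interaction_le u0 ir ii iV; rewrite rM.
have : 0 <= \int[leb2]_x (V x * sqmod u x).
  by apply: Rintegral_ge0 => x _; rewrite mulr_ge0 ?V_ge0.
exact: energy_ge_combine_gamma_le0.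
Qed.

Lemma energy_ge_of_gamma_gt0 (sc : scalars) (M alpha beta gamma : R) :
  0 < M -> 0 <= beta -> 0 < gamma -> M * beta < 2 * alpha - gamma ->
  energy_bounded_below sc alpha beta gamma M.
Proof.
(* Once I is bounded by (M / 2) P, gamma tau is the remaining coefficient of P, and tau > 1/2 is a
   restatement of the strict inequality in the hypothesis. *)
move=> M0 b0 g0 ab; pose tau := (alpha - beta * M / 2) / gamma.
have t2 : 1 / 2 < tau by rewrite ltr_pdivlMr//; move: ab; lra.
have [C HC] := entropy_potential_ge t2.
exists (- (gamma * C)) => _ [u [us ud] <-]; rewrite (energyE _ _ _ us ud).
have [_ _ ir rM EK] := sphere_facts us.
have [iV _ ii ie] := ud.
have u0 x : 0 <= sqmod u x by rewrite sqr_ge0.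
have := interaction_le u0 ir ii iV; rewrite rM.
have := HC _ u0 ir ie iV.
have : 0 <= \int[leb2]_x sqgrad u x.
  by rewrite -lee_fin -EK adde_ge0// energy_mass_ge0.
exact: energy_ge_combine_gamma_gt0.
Qed.

Lemma energy_bounded_below_of (sc : scalars) (M alpha beta gamma : R) : 0 < M ->
  (alpha = 0 /\ beta <= 0 /\ M * beta + 2 * gamma <= 0) \/
  (0 < alpha /\ ((gamma <= 0 /\ M * beta <= 2 * alpha) \/
    (0 < gamma /\ M * beta <= 4 * alpha - 2 * gamma /\ M * beta < 2 * alpha - gamma))) ->
  energy_bounded_below sc alpha beta gamma M.
Proof.
move=> M0 H; have [b0|b0] := ltrP beta 0.
  have Mb : M * beta < 0 by rewrite pmulr_rlt0.
  by apply: energy_ge_of_beta_lt0 => //; move: H => [[-> [_ h]]|[a0 [[g0 h]|[g0 [h h']]]]]; lra.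
case: H => [[a0 [b0' h]]|[a0 [[g0 h]|[g0 [h h']]]]].
- have -> : beta = 0 by apply/eqP; rewrite eq_le b0 b0'.
  by apply: energy_ge_of_gamma_le0; rewrite ?a0; nra.
- exact: energy_ge_of_gamma_le0.
- exact: energy_ge_of_gamma_gt0.
Qed.

End bounded_below.

(** * Classical derivatives as weak derivatives *)

Section continuous2.
Context {R : realType}.
Local Notation P2 := (measurableTypeR R * measurableTypeR R)%type.

(** An open set is the union of the countably many rational rectangles it contains. *)
Lemma open_measurable2 (U : set (R * R)) : open U -> measurable (U : set P2).
Proof.
move=> oU; pose E (q : (rat * rat) * (rat * rat)) : set P2 :=
  orect (ratr q.1.1) (ratr q.1.2) (ratr q.2.1) (ratr q.2.2).
pose F q : set P2 := if `[< E q `<=` U >] then E q else set0.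
have -> : (U : set P2) = \bigcup_q F q.
  apply/seteqP; split => [z Uz|z [q _]]; last first.
    by rewrite /F; case: ifPn => // /asboolP EU /EU.
  have /nbhs_ballP[e /= e0 eU] : nbhs z U by rewrite openE in oU; exact: oU.
  have lt1 t : t - e < t :> R by rewrite gtrBl.
  have lt2 t : t < t + e :> R by rewrite ltrDl.
  have [a] := rat_in_itvoo (lt1 z.1); have [b] := rat_in_itvoo (lt2 z.1).
  have [c] := rat_in_itvoo (lt1 z.2); have [d] := rat_in_itvoo (lt2 z.2).
  rewrite !in_itv/= => /andP[d1 d2] /andP[c1 c2] /andP[b1 b2] /andP[a1 a2].
  exists ((a, b), (c, d)) => //; rewrite /F ifT.
    by rewrite /E /orect /=; split; rewrite /= in_itv/=; apply/andP.
  apply/asboolP => y; rewrite /E /orect /= !in_itv/= => -[/andP[y1 y2] /andP[y3 y4]].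
  apply: eU; split; rewrite /ball /= distrC ltr_distl; apply/andP; split; lra.
apply: countable_bigcupT_measurable; first exact: countableP.
move=> q.
by rewrite /F; case: ifPn => // _; exact: measurable_orect.
Qed.

Lemma continuous_measurable2 (F : R * R -> R) : continuous F ->
  measurable_fun [set: P2] F.
Proof.
move=> cF; apply: (measurability _ (RGenOpens.measurableE R)).
move=> _ [_ [a [b ->] <-]]; rewrite setTI.
apply: open_measurable2; move/continuousP : cF; apply.
exact: interval_open.
Qed.

Lemma continuous_bounded_box (F : R * R -> R) (r : R) : continuous F ->
  exists C : R, forall z, `|z.1| <= r -> `|z.2| <= r -> `|F z| <= C.
Proof.
move=> cF; have cK : compact (`[- r, r]%classic `*` `[- r, r]%classic : set (R * R)).
  by apply: compact_setX; exact: segment_compact.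
have : compact (F @` (`[- r, r]%classic `*` `[- r, r]%classic : set (R * R))).
  by apply: continuous_compact => //; exact: continuous_subspaceT.
move=> /compact_bounded [C [_ HC]].
exists (`|C| + 1) => z z1 z2; apply: (HC (`|C| + 1)); first by rewrite ltr_pwDr// ler_norm.
by exists z => //; split => /=; rewrite in_itv/= -ler_norml.
Qed.

End continuous2.

Lemma pairl_continuous (R : realType) (y : R) : continuous (fun x : R => (x, y) : R * R).
Proof.
move=> x A /nbhs_ballP[e e0 eA]; apply/nbhs_ballP; exists e => // t xt.
by apply: eA; split => //=; exact: ballxx.
Qed.

Lemma pairr_continuous (R : realType) (x : R) : continuous (fun y : R => (x, y) : R * R).
Proof.
move=> y A /nbhs_ballP[e e0 eA]; apply/nbhs_ballP; exists e => // t yt.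
by apply: eA; split => //=; exact: ballxx.
Qed.

Section classical_partials.
Context {R : realType}.
Local Notation P2 := (measurableTypeR R * measurableTypeR R)%type.
Local Notation mu := (@lebesgue_measure R).

Lemma is_derive_slice0 (f : R * R -> R) (x y : R) :
  derivable f (x, y) (basis2 ord0) ->
  is_derive x (1 : R) (fun t => f (t, y)) ('D_(basis2 ord0) f (x, y)).
Proof.
move=> df.
have H : h^-1 *: (((fun t => f (t, y)) \o shift x) (h *: (1 : R)) - f (x, y))
    @[h --> 0^'] --> 'D_(basis2 ord0) f (x, y).
  rewrite (_ : (fun h => _) = (fun h => h^-1 *: ((f \o shift (x, y)) (h *: basis2 ord0) - f (x, y)))).
    exact: df.
  apply/funext => h; congr (_ *: (_ - _)); rewrite /= /basis2 /=; congr f.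
  by rewrite [RHS]surjective_pairing /= scaler0 add0r.
by apply: DeriveDef; [exact: (cvgP _ H)|exact: cvg_lim].
Qed.

Lemma is_derive_slice1 (f : R * R -> R) (x y : R) :
  derivable f (x, y) (basis2 (lift ord0 ord0)) ->
  is_derive y (1 : R) (fun t => f (x, t)) ('D_(basis2 (lift ord0 ord0)) f (x, y)).
Proof.
move=> df.
have H : h^-1 *: (((fun t => f (x, t)) \o shift y) (h *: (1 : R)) - f (x, y))
    @[h --> 0^'] --> 'D_(basis2 (lift ord0 ord0)) f (x, y).
  rewrite (_ : (fun h => _) =
    (fun h => h^-1 *: ((f \o shift (x, y)) (h *: basis2 (lift ord0 ord0)) - f (x, y)))).
    exact: df.
  apply/funext => h; congr (_ *: (_ - _)); rewrite /= /basis2 /=; congr f.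
  by rewrite [RHS]surjective_pairing /= scaler0 add0r.
by apply: DeriveDef; [exact: (cvgP _ H)|exact: cvg_lim].
Qed.

Lemma integral_derive_eq0 (g g' : R -> R) (r : R) :
  (forall x : R, is_derive x (1 : R) g (g' x)) -> continuous g' ->
  (forall x, r < `|x| -> g x = 0) -> (\int[mu]_x (g' x)%:E = 0)%E.
Proof.
move=> dg cg' gr.
have g'r x : r < `|x| -> g' x = 0.
  move=> rx; have [_ <-] := dg x.
  rewrite (@near_eq_derive _ _ _ g (cst 0) x 1); first exact: derive_cst.
  have : \forall y \near x, r < `|y|.
    have h : `|y| @[y --> x] --> `|x| by exact: norm_continuous.
    exact: (cvgr_gt _ h _ rx).
  by apply: filterS => y; exact: gr.
(* The radius r may be negative; L is positive and beyond r, so g vanishes at both end points. *)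
pose L : R := `|r| + 1; have rL : r < L by rewrite ltr_pwDr// ler_norm.
have L0 : 0 < L by rewrite ltr_wpDl.
have cg : continuous g.
  move=> x; apply: differentiable_continuous; apply/derivable1_diffP.
  by have [] := dg x.
transitivity (\int[mu]_(x in `[(- L)%R, L]) (g' x)%:E)%E.
  rewrite [RHS]integral_mkcond; apply: eq_integral => x _; rewrite patchE.
  case: ifPn => //; rewrite notin_setE /= in_itv/= -ler_norml => /negP.
  by rewrite -ltNge => /(lt_trans rL)/g'r ->.
rewrite (@continuous_FTC2 R g' g (- L) L).
- by rewrite !gr ?normrN ?(gtr0_norm L0)// subee.
- by rewrite gtrN.
- exact: continuous_subspaceT.
- split.
  + by move=> x _; have [] := dg x.
  + exact: cvg_at_right_filter (cg _).
  + exact: cvg_at_left_filter (cg _).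
- by move=> x _; rewrite derive1E; have [] := dg x.
Qed.

Lemma continuous_loc_integrable (F : R * R -> R) : continuous F ->
  loc_integrable (F : P2 -> R).
Proof.
move=> cF; have mF := continuous_measurable2 cF; split => // r.
have [C HC] := continuous_bounded_box r cF.
apply: measurable_bounded_integrable.
- exact: measurable_box.
- exact: leb2_box_lty.
- exact: measurable_funTS.
exists C; split; first exact: num_real.
move=> y Cy z /boxE[z1 z2] /=.
by apply: le_trans (ltW Cy); apply: HC; exact: ltW.
Qed.

Lemma Ck1_integrable_mul (f F : R * R -> R) (r : R) : continuous f ->
  (forall z, ~ box r z -> f z = 0) -> continuous F ->
  leb2.-integrable setT (fun z : P2 => (f z * F z)%:E).
Proof.
move=> cf fr cF; have [C HC] := continuous_bounded_box r cf.
have -> : (fun z : P2 => (f z * F z)%:E) = (fun z : P2 => (F z * f z)%:E).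
  by apply/funext => z; rewrite mulrC.
have C0 : 0 <= `|C| by [].
apply: (@loc_integrableM _ _ _ `|C| r) => //.
- exact: continuous_loc_integrable.
- exact: continuous_measurable2.
- move=> z; have [/boxE[z1 z2]|nz] := pselect (box r z).
    by rewrite (le_trans (HC z (ltW z1) (ltW z2)))// ler_norm.
  by rewrite fr// normr0.
Qed.

Lemma derive_support (f : R * R -> R) (r : R) (v z : R * R) :
  (forall z, ~ box r z -> f z = 0) -> ~ box (r + 1) z -> 'D_v f z = 0.
Proof.
move=> fr nz.
rewrite (@near_eq_derive _ _ _ f (cst 0) z v); first exact: derive_cst.
apply/nbhs_ballP; exists 1 => //= y [y1 y2]; apply: fr => /boxE[b1 b2]; apply: nz; apply/boxE.
rewrite /ball /= in y1 y2; split.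
  have := ler_normD (z.1 - y.1) y.1; rewrite subrK; move: y1 b1; lra.
have := ler_normD (z.2 - y.2) y.2; rewrite subrK; move: y2 b2; lra.
Qed.

(** The derivative of f phi in direction i integrates to 0 along each line in that direction; Fubini
    is used with that direction as the inner variable. *)
Lemma weak_partial_classical (f : R * R -> R) (r : R) (i : 'I_2) : Ck 1 f ->
  (forall z, ~ box r z -> f z = 0) -> weak_partial i f ('D_(basis2 i) f).
Proof.
move=> [cf /(_ i)[df [cdf _]]] fr phi [Cphi _].
have [cphi /(_ i)[dphi [cdphi _]]] := Cphi 1%N.
have i1 := Ck1_integrable_mul cf fr cdphi.
have i2 := Ck1_integrable_mul cdf (fun z => @derive_support _ _ (basis2 i) z fr) cphi.
apply/eqP; rewrite -addr_eq0 -RintegralD//; apply/eqP.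
pose G (z : P2) := f z * 'D_(basis2 i) phi z + 'D_(basis2 i) f z * phi z.
have iG : leb2.-integrable setT (EFin \o G).
  by have := integrableD measurableT i1 i2; congr (_.-integrable _ _).
have cG : continuous G.
  move=> z; apply: (@cvgD _ _ _ _ _ (fun z => f z * 'D_(basis2 i) phi z)).
    by apply: cvgM; [exact: cf|exact: cdphi].
  by apply: cvgM; [exact: cdf|exact: cphi].
rewrite /Rintegral -/(EFin \o G).
suff -> : (\int[leb2]_z (EFin \o G) z = 0)%E by [].
move: i df cdf dphi cdphi i1 i2 @G iG cG; elim/ord2P => df cdf dphi cdphi i1 i2 G iG cG.
  rewrite -(integral21_prod_meas1 iG) integral0_eq// => y _.
  apply: (@integral_derive_eq0 (fun x => f (x, y) * phi (x, y)) (fun x => G (x, y)) r).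
  - move=> x; have d1 := is_derive_slice0 (df (x, y)).
    have d2 := is_derive_slice0 (dphi (x, y)).
    have := is_deriveM d1 d2.
    by rewrite /GRing.scale /= /G [phi _ * _]mulrC.
  - move=> x; apply: (continuous_comp (f := fun x => (x, y))); last exact: cG.
    exact: pairl_continuous.
  - move=> x rx; rewrite fr ?mul0r// => /boxE[/= b1 _].
    by move: (lt_trans rx b1); rewrite ltxx.
rewrite -(integral12_prod_meas1 iG) integral0_eq// => x _.
apply: (@integral_derive_eq0 (fun y => f (x, y) * phi (x, y)) (fun y => G (x, y)) r).
- move=> y; have d1 := is_derive_slice1 (df (x, y)).
  have d2 := is_derive_slice1 (dphi (x, y)).
  have := is_deriveM d1 d2.
  by rewrite /GRing.scale /= /G [phi _ * _]mulrC.
- move=> y; apply: (continuous_comp (f := fun y => (x, y))); last exact: cG.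
  exact: pairr_continuous.
- move=> y rx; rewrite fr ?mul0r// => /boxE[_ /= b1].
  by move: (lt_trans rx b1); rewrite ltxx.
Qed.

(** Products of one-variable functions are test functions, and they determine a locally integrable
    function almost everywhere. *)
Lemma weak_partial_unique (f g1 g2 : P2 -> R) (i : 'I_2) :
  g1 \in Lfun leb2 2%:E -> g2 \in Lfun leb2 2%:E ->
  weak_partial i f g1 -> weak_partial i f g2 -> {ae leb2, forall z, g1 z = g2 z}.
Proof.
move=> L1 L2 w1 w2.
have l1 := Lfun2_loc_integrable L1; have l2 := Lfun2_loc_integrable L2.
have := @tensor_integral_eq0 R (fun z => g1 z - g2 z) (loc_integrableB l1 l2).
move=> H; apply: filterS (H _) => [z /eqP|a b sa sb].
  by rewrite subr_eq0 => /eqP.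
have t := test_function_tensor sa sb.
have i1 := integrable_tensor l1 sa sb; have i2 := integrable_tensor l2 sa sb.
have -> : (fun z : P2 => (g1 z - g2 z) * tensor a b z) =
  (fun z => g1 z * tensor a b z - g2 z * tensor a b z).
  by apply/funext => z; rewrite mulrBl.
rewrite RintegralB//; apply/eqP; rewrite subr_eq0 -eqr_opp; apply/eqP.
by rewrite -(w1 _ t) -(w2 _ t).
Qed.

(** [wpartial] is an arbitrary choice of weak derivative; uniqueness identifies it almost everywhere
    with the classical one, hence the equality of integrals. *)
Lemma H1_real_classical (f : R * R -> R) (r : R) : Ck 1 f ->
  (forall z, ~ box r z -> f z = 0) ->
  H1_real f /\ forall i, (\int[leb2]_z (wpartial i f z ^+ 2)%:E =
    \int[leb2]_z ('D_(basis2 i) f z ^+ 2)%:E)%E.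
Proof.
move=> Cf fr; have [cf df] := Cf.
have L2 (h : R * R -> R) (s : R) : continuous h -> (forall z, ~ box s z -> h z = 0) ->
    h \in Lfun leb2 2%:E.
  move=> ch hs; apply/Lfun2P; split; first exact: continuous_measurable2.
  by have := Ck1_integrable_mul ch hs ch; under eq_fun do rewrite -expr2.
have LD i : 'D_(basis2 i) f \in Lfun leb2 2%:E.
  by apply: (L2 _ (r + 1)); [case: (df i) => _ []|by move=> z; exact: derive_support].
have H : H1_real f.
  split; first exact: L2 fr.
  by move=> i; exists ('D_(basis2 i) f) => //; exact: weak_partial_classical fr.
split => // i; have [Lw w] := wpartialP i H.
have := weak_partial_unique Lw (LD i) w (@weak_partial_classical f r i Cf fr).
have [/Lfun2P[mw _] /Lfun2P[mD _]] := (Lw, LD i).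
move=> ae; apply: ae_eq_integral => //.
- by apply/measurable_EFinP; exact: measurable_funX.
- by apply/measurable_EFinP; exact: measurable_funX.
- by apply: filterS ae => z /= -> _.
Qed.

End classical_partials.

(** * Interaction of bounded densities *)

Section densities.
Context {R : realType}.
Local Notation P2 := (measurableTypeR R * measurableTypeR R)%type.
Local Notation nu := (leb2 \x leb2)%E.
Local Notation mu := (@lebesgue_measure R).

(** The square of half-side s centred at (x0, 0): all bumps sit on the first axis. *)
Definition cbox (x0 s : R) : set P2 := `[x0 - s, x0 + s]%classic `*` `[- s, s]%classic.

Lemma cboxP (x0 s : R) z : cbox x0 s z <-> `|z.1 - x0| <= s /\ `|z.2| <= s.
Proof. by rewrite /cbox /= !in_itv/= ler_distl ler_norml. Qed.

Lemma measurable_cbox x0 s : measurable (cbox x0 s).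
Proof. by apply: measurableX; exact: measurable_itv. Qed.

Lemma leb2_cbox x0 s : 0 <= s -> leb2 (cbox x0 s) = (4 * s ^+ 2)%:E.
Proof.
move=> s0; rewrite /leb2 product_measure1E//; try exact: measurable_itv.
have len (a b : R) : a <= b -> mu `[a, b] = (b - a)%:E.
  move=> ab; rewrite lebesgue_measure_itv/= lte_fin; case: ltP => [_|ba].
    by rewrite EFinB.
  by have -> : b = a; [apply/eqP; rewrite eq_le ba ab|rewrite subrr].
transitivity ((x0 + s - (x0 - s))%:E * (s - - s)%:E)%E.
  by congr (_ * _)%E; apply: len; move: s0; lra.
by rewrite -EFinM; congr EFin; ring.
Qed.

Lemma integral_cbox_le (x0 s c : R) (F : P2 -> R) : 0 <= s ->
  measurable_fun setT F -> (forall z, `|F z| <= c) ->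
  (forall z, ~ cbox x0 s z -> F z = 0) ->
  leb2.-integrable setT (EFin \o F) /\ `|\int[leb2]_z F z| <= 4 * c * s ^+ 2.
Proof.
move=> s0 mF Fc F0.
have c0 : 0 <= c := le_trans (normr_ge0 _) (Fc 0).
have mc := measurable_cbox x0 s.
have mI : measurable_fun setT (fun z : P2 => (c * \1_(cbox x0 s) z)%:E).
  by apply/measurable_EFinP/measurable_funM => //; exact: measurable_indic.
have EI : (\int[leb2]_z (c * \1_(cbox x0 s) z)%:E = (4 * c * s ^+ 2)%:E)%E.
  transitivity (\int[leb2]_z (c%:E * (\1_(cbox x0 s) z)%:E))%E.
    by apply: eq_integral => z _; rewrite EFinM.
  rewrite ge0_integralZl//; last first.
    by apply/measurable_EFinP; exact: measurable_indic.
  rewrite integral_indic// setIT.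
  transitivity (c%:E * (4 * s ^+ 2)%:E)%E; first by congr (_ * _)%E; exact: leb2_cbox.
  by rewrite -EFinM; congr EFin; ring.
have i1 : leb2.-integrable setT (fun z => (c * \1_(cbox x0 s) z)%:E).
  apply/integrableP; split => //.
  under eq_integral do rewrite abse_EFin ger0_norm ?mulr_ge0//.
  by rewrite EI ltry.
have le z : `|F z| <= c * \1_(cbox x0 s) z.
  rewrite indicE; case: (boolP (z \in _)) => [_|]; first by rewrite mulr1.
  by rewrite notin_setE => /F0 ->; rewrite normr0 mulr0.
have iF : leb2.-integrable setT (EFin \o F).
  apply: le_integrable i1 => //; first exact/measurable_EFinP.
  by move=> z _; rewrite lee_fin /= (le_trans (le z))// ler_norm.
split => //.
rewrite -lee_fin EFin_normr_Rintegral//.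
apply: le_trans (le_abse_integral _ measurableT _) _; first exact: (measurable_int _ iF).
rewrite -EI; apply: ge0_le_integral => //.
- by apply: measurableT_comp => //; exact: (measurable_int _ iF).
- by move=> z _; rewrite lee_fin.
Qed.

Definition density (x0 s C : R) (q : P2 -> R) :=
  [/\ measurable_fun setT q, forall z, 0 <= q z, forall z, q z <= C &
      forall z, ~ cbox x0 s z -> q z = 0].

Section one.
Variables (x0 s C : R) (q : P2 -> R).
Hypotheses (s0 : 0 <= s) (Hq : density x0 s C q).

Lemma density_integrableM (F : P2 -> R) (c : R) : measurable_fun setT F ->
  (forall z, cbox x0 s z -> `|F z| <= c) ->
  leb2.-integrable setT (fun z => (F z * q z)%:E).
Proof.
move: Hq => [mq q0 qC qz] mF Fc.
have C0 : 0 <= C := le_trans (q0 0) (qC 0).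
apply: (proj1 (@integral_cbox_le x0 s (`|c| * C) (fun z => F z * q z) s0 _ _ _)).
- exact: measurable_funM.
- move=> z; have [zB|nB] := pselect (cbox x0 s z).
    rewrite normrM ler_pM// ?(ger0_norm (q0 z))//.
    by rewrite (le_trans (Fc z zB))// ler_norm.
  by rewrite qz// mulr0 normr0 mulr_ge0.
- by move=> z /qz ->; rewrite mulr0.
Qed.

Lemma density_integrable : leb2.-integrable setT (EFin \o q).
Proof.
have := @density_integrableM (cst 1) 1 (measurable_cst _).
rewrite (_ : (fun z => (cst 1 z * q z)%:E) = EFin \o q).
  by apply => z _; rewrite normr1.
by apply/funext => z; rewrite /= mul1r.
Qed.

Lemma density_integral_between (F : P2 -> R) (l u : R) : measurable_fun setT F ->
  (forall z, cbox x0 s z -> l <= F z <= u) ->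
  l * (\int[leb2]_z q z) <= \int[leb2]_z (F z * q z) <= u * \int[leb2]_z q z.
Proof.
move=> mF Flu; have iq := density_integrable; have [_ q0 _ qz] := Hq.
have iF : leb2.-integrable setT (fun z => (F z * q z)%:E).
  apply: (density_integrableM (c := `|l| + `|u|) mF) => z /Flu /andP[l1 u1].
  have := ler_norm u; have := ler_norm (- l); rewrite normrN ler_norml => h1 h2.
  by apply/andP; split; have := normr_ge0 u; have := normr_ge0 l; lra.
rewrite -!RintegralZl//; apply/andP; split; apply: le_Rintegral => //.
- exact: (integrableZl measurableT l iq).
- move=> z _; have [zB|nB] := pselect (cbox x0 s z).
    by rewrite ler_wpM2r//; have /andP[] := Flu z zB.
  by rewrite qz// !mulr0.
- exact: (integrableZl measurableT u iq).
- move=> z _; have [zB|nB] := pselect (cbox x0 s z).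
    by rewrite ler_wpM2r//; have /andP[] := Flu z zB.
  by rewrite qz// !mulr0.
Qed.

End one.
End densities.

Lemma integrable_le_majorant d (T : measurableType d) (R : realType)
    (mu : {measure set T -> \bar R}) (f : T -> R) (g : T -> \bar R) (C : R) :
  measurable_fun setT f -> measurable_fun setT g ->
  (forall x, (`|f x|)%:E <= g x)%E -> (\int[mu]_x g x <= C%:E)%E ->
  mu.-integrable setT (EFin \o f).
Proof.
move=> mf mg fg gC; apply/integrableP; split; first exact/measurable_EFinP.
apply: (le_lt_trans _ (ltry C)); apply: le_trans gC.
apply: ge0_le_integral => //.
  by apply/measurable_EFinP; exact: measurableT_comp.
by move=> x _; apply: le_trans (fg x); rewrite lee_fin.
Qed.

Lemma mule_add_le (R : realType) (a b l : R) (k : \bar R) : 0 <= a -> a <= b ->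
  (0 <= k)%E -> 0 <= l -> (a%:E * (k + l%:E) <= b%:E * k + l%:E * a%:E)%E.
Proof.
move=> a0 ab k0 l0; have ab' : (a%:E <= b%:E)%E by rewrite lee_fin.
rewrite ge0_muleDr ?lee_fin//.
by apply: leeD; [exact: lee_wpmul2r|rewrite muleC].
Qed.

(** * Integrability and bounds for the interaction of two bounded densities *)

Section density_interaction.
Context {R : realType}.
Local Notation P2 := (measurableTypeR R * measurableTypeR R)%type.
Local Notation nu := (leb2 \x leb2)%E.

Lemma enorm_le_add (z : P2) : enorm z <= `|z.1| + `|z.2|.
Proof.
rewrite -(@ler_pXn2r _ 2)// ?nnegrE ?enorm_ge0 ?addr_ge0// enorm_sqr.
rewrite sqrrD !real_normK ?num_real//.
have : 0 <= `|z.1| * `|z.2| by rewrite mulr_ge0.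
by rewrite mulr2n; lra.
Qed.

Let k1 : P2 -> \bar R := kernelE (1 / 2) (0 / 2).

Let h12 : 0 < 1 / 2 :> R. Proof. by []. Qed.
Let h11 : 1 / 2 <= 1 :> R. Proof. lra. Qed.
Let k10 z : (0 <= k1 z)%E. Proof. exact: kernelE_ge0. Qed.
Let mk1 : measurable_fun setT k1. Proof. exact: measurable_kernelE. Qed.
Let c1 : R := 64 / (1 / 2) ^+ 2.
Let k1C : (\int[leb2]_z k1 z <= c1%:E)%E. Proof. exact: integral_kernelE. Qed.

(** The positive part of the logarithm is at most ln U; the negative part is the kernel bound for
    the constant density 1, with eps = 1 and w0 = 0. *)
Lemma abs_ln_le_kernel (z : P2) (U : R) : 1 <= U -> enorm z <= U ->
  ((`|ln (enorm z)|)%:E <= k1 z + (ln U)%:E)%E.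
Proof.
move=> U1 zU; have U0 : 0 < U by apply: lt_le_trans U1.
have lU : 0 <= ln U by rewrite ln_ge0.
have [n0|n0] := eqVneq (enorm z) 0.
  by rewrite n0 ln0// normr0 adde_ge0// lee_fin.
have {n0}n0 : 0 < enorm z by rewrite lt0r n0 enorm_ge0.
have [l0|l0] := lerP 0 (ln (enorm z)); rewrite ?(ger0_norm l0) ?(ltr0_norm l0).
  by apply: (@le_trans _ _ (ln U)%:E); [rewrite lee_fin ler_ln|rewrite leeDr].
apply: (@le_trans _ _ (k1 z)); last by rewrite leeDl// lee_fin.
have := ln_le_kernelE 0 z (ltr01 : 0 < 1 :> R) (lexx 1) (ltr01 : 0 < 1 :> R).
rewrite (_ : 1 * _ = - ln (enorm z)); first exact.
rewrite ln1 (_ : - 0 - 0 = 0 :> R); last by ring.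
by rewrite normr0; field.
Qed.

Lemma measurable_ln_enormB :
  measurable_fun setT (fun z : P2 * P2 => ln (enorm (z.1 - z.2))).
Proof.
apply: (measurableT_comp (@measurable_ln R)).
exact: (measurableT_comp measurable_enorm measurable_fun_pair_sub).
Qed.

Section two.
Variables (x0 s C y0 t D : R) (p q : P2 -> R).
Hypotheses (s0 : 0 <= s) (t0 : 0 <= t).
Hypotheses (Hp : density x0 s C p) (Hq : density y0 t D q).

(** An upper bound for the distance between points of the two supports, at least 1 so that ln U >=
    0. *)
Let U : R := 1 + `|x0 - y0| + 2 * s + 2 * t.

Let U1 : 1 <= U. Proof. by rewrite /U -!addrA lerDl !addr_ge0// mulr_ge0. Qed.

Let enormB_le z w : cbox x0 s z -> cbox y0 t w -> enorm (z - w) <= U.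
Proof.
move=> /cboxP[z1 z2] /cboxP[w1 w2].
apply: le_trans (enorm_le_add _) _ => /=.
have e1 : `|z.1 - w.1| <= `|z.1 - x0| + `|x0 - y0| + `|w.1 - y0|.
  have -> : z.1 - w.1 = (z.1 - x0) + (x0 - y0) - (w.1 - y0) by ring.
  by apply: le_trans (ler_normB _ _) _; rewrite lerD2r ler_normD.
have e2 := ler_normB z.2 w.2.
rewrite /U; move: z1 z2 w1 w2 e1 e2; lra.
Qed.

Lemma interaction_integrable :
  nu.-integrable setT (fun z => (p z.1 * ln (enorm (z.1 - z.2)) * q z.2)%:E).
Proof.
have [mp p0 pC pz] := Hp; have [mq q0 qD qz] := Hq.
have ip := density_integrable s0 Hp; have iq := density_integrable t0 Hq.
have D0 : 0 <= D := le_trans (q0 0) (qD 0).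
have lU : 0 <= ln U by rewrite ln_ge0.
have mf : measurable_fun setT (fun z : P2 * P2 => p z.1 * ln (enorm (z.1 - z.2)) * q z.2).
  apply: measurable_funM; last exact: (measurableT_comp mq measurable_snd).
  apply: measurable_funM; first exact: (measurableT_comp mp measurable_fst).
  exact: measurable_ln_enormB.
pose g1 (z : P2 * P2) := ((p z.1)%:E * k1 (z.1 - z.2)%R)%E.
have g10 z : (0 <= g1 z)%E by rewrite mule_ge0 ?lee_fin.
have mg1 : measurable_fun setT g1.
  exact: (measurable_diff_kernel mp mk1 measurable_fst).
pose g2 (z : P2 * P2) := (p z.1 * q z.2)%:E.
have g20 z : (0 <= g2 z)%E by rewrite lee_fin mulr_ge0.
have mg2 : measurable_fun setT g2 by exact: (measurable_int _ (integrable_prod ip iq)).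
have D0' : (0 <= D%:E)%E by rewrite lee_fin.
have lU' : (0 <= (ln U)%:E)%E by rewrite lee_fin.
pose g z := (D%:E * g1 z + (ln U)%:E * g2 z)%E.
have mg : measurable_fun setT g by apply: emeasurable_funD; exact: measurable_funeM.
have I1 : (\int[nu]_z g1 z <= ((\int[leb2]_x p x)%R * c1)%:E)%E.
  exact: (ge0_integral_diff_kernel_fst p0 ip mk1 k10 (kernelEN _ _) k1C).
have I2 : (\int[nu]_z g2 z = ((\int[leb2]_x p x)%R * (\int[leb2]_x q x)%R)%:E)%E.
  rewrite -(Rintegral_prod ip iq) /Rintegral fineK//.
  exact: (integrable_fin_num _ (integrable_prod ip iq)).
apply: (@integrable_le_majorant _ _ _ _ _ g
  (D * ((\int[leb2]_x p x)%R * c1) + ln U * ((\int[leb2]_x p x)%R * (\int[leb2]_x q x)%R)) mf mg).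
- move=> z; have [zB|/pz z1] := pselect (cbox x0 s z.1); last first.
    by rewrite z1 !mul0r normr0 adde_ge0// mule_ge0.
  have [wB|/qz z2] := pselect (cbox y0 t z.2); last first.
    by rewrite z2 mulr0 normr0 adde_ge0// mule_ge0.
  have := abs_ln_le_kernel U1 (enormB_le zB wB).
  have pq0 : (0 <= (p z.1 * q z.2)%:E)%E by rewrite lee_fin mulr_ge0.
  move=> /(lee_wpmul2l pq0); rewrite -EFinM.
  have -> : p z.1 * q z.2 * `|ln (enorm (z.1 - z.2))| = `|p z.1 * ln (enorm (z.1 - z.2)) * q z.2|.
    by rewrite !normrM (ger0_norm (p0 _)) (ger0_norm (q0 _)); ring.
  move=> h; apply: le_trans h _; rewrite ge0_muleDr// leeD//.
    rewrite /g1 EFinM [(_ * (q z.2)%:E)%E]muleC -muleA lee_wpmul2r ?lee_fin//.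
    by rewrite mule_ge0 ?lee_fin.
  by rewrite /g2 muleC.
- have D1 : (\int[nu]_z (D%:E * g1 z) = D%:E * \int[nu]_z g1 z)%E.
    exact: (ge0_integralZl _ measurableT mg1 (fun z _ => g10 z) D0').
  have D2 : (\int[nu]_z ((ln U)%:E * g2 z) = (ln U)%:E * \int[nu]_z g2 z)%E.
    exact: (ge0_integralZl _ measurableT mg2 (fun z _ => g20 z) lU').
  rewrite /g ge0_integralD//; last 4 first.
  - by move=> z _; rewrite mule_ge0.
  - exact: measurable_funeM.
  - by move=> z _; rewrite mule_ge0.
  - exact: measurable_funeM.
  rewrite D1 D2 I2 EFinD leeD// EFinM; exact: lee_wpmul2l.
Qed.

Lemma interaction_between (l u : R) :
  (forall z w, cbox x0 s z -> cbox y0 t w -> l <= ln (enorm (z - w)) <= u) ->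
  l * ((\int[leb2]_x p x) * \int[leb2]_x q x) <=
    \int[nu]_z (p z.1 * ln (enorm (z.1 - z.2)) * q z.2) <=
  u * ((\int[leb2]_x p x) * \int[leb2]_x q x).
Proof.
move=> lu; have [mp p0 pC pz] := Hp; have [mq q0 qD qz] := Hq.
have ip := density_integrable s0 Hp; have iq := density_integrable t0 Hq.
have ipq := integrable_prod ip iq.
have pw z : l * (p z.1 * q z.2) <= p z.1 * ln (enorm (z.1 - z.2)) * q z.2 <= u * (p z.1 * q z.2).
  have [zB|/pz z1] := pselect (cbox x0 s z.1); last by rewrite z1 !mul0r !mulr0 lexx.
  have [wB|/qz z2] := pselect (cbox y0 t z.2); last by rewrite z2 !mulr0 lexx.
  have /andP[h1 h2] := lu _ _ zB wB.
  have -> : p z.1 * ln (enorm (z.1 - z.2)) * q z.2 = ln (enorm (z.1 - z.2)) * (p z.1 * q z.2) by ring.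
  by apply/andP; split; apply: ler_wpM2r => //; exact: mulr_ge0.
rewrite -(Rintegral_prod ip iq) -!RintegralZl//; apply/andP; split; apply: le_Rintegral => //.
- exact: (integrableZl measurableT l ipq).
- exact: interaction_integrable.
- by move=> z _; have /andP[] := pw z.
- exact: interaction_integrable.
- exact: (integrableZl measurableT u ipq).
- by move=> z _; have /andP[] := pw z.
Qed.

Lemma slice_integrable (x : P2) :
  leb2.-integrable setT (fun y => (q y * ln (enorm (x - y)))%:E).
Proof.
have [mq q0 qD qz] := Hq; have iq := density_integrable t0 Hq.
have D0 : 0 <= D := le_trans (q0 0) (qD 0).
(* A bound on the distance from x to the support; this local name shadows the external potential. *)
pose V := 1 + `|x.1 - y0| + `|x.2| + 2 * t.
have V1 : 1 <= V by rewrite /V -!addrA lerDl !addr_ge0// mulr_ge0.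
have lV : 0 <= ln V by rewrite ln_ge0.
have md : measurable_fun setT (fun y : P2 => x - y : P2).
  by apply/measurable_fun_pairP; split; apply: measurable_funB.
have mf : measurable_fun setT (fun y : P2 => q y * ln (enorm (x - y))).
  apply: measurable_funM => //; apply: (measurableT_comp (@measurable_ln R)).
  exact: (measurableT_comp measurable_enorm md).
pose g1 (y : P2) := k1 (y + (- x)).
have mg1 : measurable_fun setT g1.
  exact: (measurableT_comp mk1 (measurable_fun_pairD (- x))).
have D0' : (0 <= D%:E)%E by rewrite lee_fin.
have lV' : (0 <= (ln V)%:E)%E by rewrite lee_fin.
have g20 y : (0 <= (q y)%:E)%E by rewrite lee_fin.
have mg2 : measurable_fun setT (fun y => (q y)%:E) by exact/measurable_EFinP.
have g10 y : (0 <= g1 y)%E by exact: k10.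
pose g y := (D%:E * g1 y + (ln V)%:E * (q y)%:E)%E.
have g0 y : (0 <= g y)%E.
  by apply: adde_ge0; [exact: (mule_ge0 D0' (g10 y))|exact: (mule_ge0 lV' (g20 y))].
have mg : measurable_fun setT g by apply: emeasurable_funD; exact: measurable_funeM.
apply: (@integrable_le_majorant _ _ _ _ _ g (D * c1 + ln V * (\int[leb2]_x q x)) mf mg).
- move=> y; have [wB|/qz z2] := pselect (cbox y0 t y); last first.
    by apply: le_trans (g0 y); rewrite z2 mul0r normr0.
  have xy : enorm (x - y) <= V.
    move/cboxP : wB => [w1 w2]; apply: le_trans (enorm_le_add _) _ => /=.
    have e1 : `|x.1 - y.1| <= `|x.1 - y0| + `|y.1 - y0|.
      have -> : x.1 - y.1 = (x.1 - y0) - (y.1 - y0) by ring.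
      exact: ler_normB.
    have e2 := ler_normB x.2 y.2.
    by rewrite /V; move: w1 w2 e1 e2 t0; lra.
  have := abs_ln_le_kernel V1 xy.
  move=> /(lee_wpmul2l (g20 y)); rewrite -EFinM.
  have -> : q y * `|ln (enorm (x - y))| = `|q y * ln (enorm (x - y))|.
    by rewrite !normrM (ger0_norm (q0 _)).
  have gE : k1 (x - y) = g1 y.
    by rewrite /g1 -[RHS](kernelEN (1 / 2) (0 / 2)); congr k1; rewrite opprD opprK addrC.
  rewrite gE => h; apply: le_trans h _.
  exact: (mule_add_le (q0 y) (qD y) (g10 y) lV).
- have D1 : (\int[leb2]_z (D%:E * g1 z) = D%:E * \int[leb2]_z g1 z)%E.
    exact: (ge0_integralZl _ measurableT mg1 (fun z _ => g10 z) D0').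
  have D2 : (\int[leb2]_z ((ln V)%:E * (q z)%:E) = (ln V)%:E * \int[leb2]_z (q z)%:E)%E.
    exact: (ge0_integralZl _ measurableT mg2 (fun z _ => g20 z) lV').
  rewrite /g ge0_integralD//; last 4 first.
  - by move=> z _; exact: (mule_ge0 D0' (g10 z)).
  - exact: measurable_funeM.
  - by move=> z _; exact: (mule_ge0 lV' (g20 z)).
  - exact: measurable_funeM.
  have I1 : (\int[leb2]_z g1 z <= c1%:E)%E.
    by rewrite /g1 (ge0_integral_leb2_translate (- x) mk1 k10).
  rewrite D1 D2 EFinD; apply: leeD; first by rewrite EFinM; exact: lee_wpmul2l.
  by rewrite EFinM /Rintegral fineK// (integrable_fin_num _ iq).
Qed.

End two.
End density_interaction.

Lemma self_interaction_ge_combine (R : realFieldType) (x y c m : R) :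
  - x + y <= c * (m * 256) -> y - 256 * c * m <= x.
Proof. lra. Qed.

(** * Entropy and self-interaction of a profile of width s *)

Section profiles.
Context {R : realType}.
Local Notation P2 := (measurableTypeR R * measurableTypeR R)%type.
Local Notation nu := (leb2 \x leb2)%E.

Lemma abs_mul_ln_le (t c : R) : 0 <= t -> t <= c -> `|t * ln t| <= 1 + c ^+ 2.
Proof.
move=> t0 tc; have [->|tn0] := eqVneq t 0.
  by rewrite mul0r normr0 addr_ge0// sqr_ge0.
have {tn0}t1 : 0 < t by rewrite lt0r tn0.
have lnle (a : R) : 0 < a -> ln a <= a.
  by move=> a0; rewrite -[leRHS](lnK a0) expR_ge_id.
have [l0|l0] := lerP 0 (ln t).
  rewrite ger0_norm ?mulr_ge0// (@le_trans _ _ (t * t)) ?ler_wpM2l ?lnle//.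
  have : t * t <= c ^+ 2 by rewrite -expr2 ler_pXn2r ?nnegrE// (le_trans t0).
  lra.
rewrite ler0_norm ?mulr_ge0_le0 ?(ltW l0)// -mulrN -lnV//.
apply: (@le_trans _ _ (t * t^-1)); first by rewrite ler_wpM2l ?lnle ?invr_gt0.
by rewrite divff ?gt_eqF// lerDl sqr_ge0.
Qed.

Lemma density_entropy_integrable (x0 s C : R) (q : P2 -> R) : 0 <= s ->
  density x0 s C q -> leb2.-integrable setT (fun x => (q x * ln (q x))%:E).
Proof.
move=> s0 [mq q0 qC qz].
apply: (proj1 (@integral_cbox_le R x0 s (1 + C ^+ 2) _ s0 _ _ _)).
- by apply: measurable_funM => //; exact: (measurableT_comp (@measurable_ln R) mq).
- by move=> z; exact: abs_mul_ln_le.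
- by move=> z /qz ->; rewrite mul0r.
Qed.

Lemma measurable_V : measurable_fun setT (V : P2 -> R).
Proof.
apply: measurable_funM => //; apply: (measurableT_comp (@measurable_ln R)).
apply: measurable_funD => //; apply: measurable_funX; exact: measurable_enorm.
Qed.

Lemma density_potential_integrable (x0 s C : R) (q : P2 -> R) : 0 <= s ->
  density x0 s C q -> leb2.-integrable setT (fun x => (V x * q x)%:E).
Proof.
move=> s0 Hq; apply: (density_integrableM (c := V (`|x0| + s, s)) s0 Hq measurable_V).
move=> z /cboxP[z1 z2]; rewrite ger0_norm ?V_ge0// /V.
rewrite ler_wpM2l// ler_ln ?posrE; try by rewrite ltr_pwDl ?sqr_ge0.
rewrite lerD2l !enorm_sqr /= lerD//.
  rewrite -[leLHS]real_normK ?num_real// ler_pXn2r ?nnegrE ?addr_ge0//.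
  by have := ler_normD (z.1 - x0) x0; rewrite subrK; move: z1; lra.
by rewrite -[leLHS]real_normK ?num_real// ler_pXn2r.
Qed.

Section one_profile.
Variables (x0 s C : R) (q : P2 -> R).
Hypotheses (s1 : 1 <= s) (Hq : density x0 s (C / s ^+ 2) q).

Let s0 : 0 < s. Proof. exact: lt_le_trans s1. Qed.
Let m : R := \int[leb2]_x q x.

(** With Q = s^2 q, which lies between 0 and C, the combined integrand is s^-2 Q ln Q; it is bounded
    by s^-2 (1 + C^2) on a square of area 4 s^2. *)
Lemma profile_entropy :
  `|\int[leb2]_x (q x * ln (q x)) + 2 * ln s * m| <= 4 * (1 + C ^+ 2).
Proof.
have [mq q0 qC qz] := Hq.
have iq := density_integrable (ltW s0) Hq.
have ie := density_entropy_integrable (ltW s0) Hq.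
have s20 : 0 < s ^+ 2 by rewrite exprn_gt0.
have [iA EA] := Rintegral_axpy (2 * ln s) iq ie.
rewrite addrC -[X in `|X|]EA.
have -> : 4 * (1 + C ^+ 2) = 4 * ((1 + C ^+ 2) / s ^+ 2) * s ^+ 2.
  by field; rewrite gt_eqF.
apply: (proj2 (@integral_cbox_le R x0 s _ _ (ltW s0) _ _ _)).
- by apply/measurable_EFinP; exact: (measurable_int _ iA).
- move=> z; have [->|qn0] := eqVneq (q z) 0.
    by rewrite mulr0 mul0r addr0 normr0 divr_ge0 ?addr_ge0 ?sqr_ge0// ltW.
  have qp : 0 < q z by rewrite lt0r qn0 q0.
  have -> : 2 * ln s * q z + q z * ln (q z) = (s ^+ 2)^-1 * (q z * s ^+ 2 * ln (q z * s ^+ 2)).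
    by rewrite lnM// lnXn// mulr2n; field; rewrite gt_eqF.
  rewrite normrM ger0_norm ?invr_ge0 ?sqr_ge0// mulrC ler_wpM2r ?invr_ge0 ?sqr_ge0//.
  by apply: abs_mul_ln_le; [rewrite mulr_ge0 ?(ltW qp) ?sqr_ge0|rewrite -ler_pdivlMr].
- by move=> z /qz ->; rewrite mulr0 mul0r addr0.
Qed.

Let k : P2 -> \bar R := kernelE (1 / 2) ((2 * ln s) / 2).

(** The upper bound holds because two points of the support are at distance at most 4 s. The lower
    bound controls the logarithmic singularity by the kernel at length scale s, at a cost that does
    not depend on s. *)
Lemma profile_self_interaction :
  ln s * (m * m) - 256 * C * m <=
  \int[nu]_z (q z.1 * ln (enorm (z.1 - z.2)) * q z.2) <= (ln s + ln 4) * (m * m).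
Proof.
have [mq q0 qC qz] := Hq.
have iq := density_integrable (ltW s0) Hq.
have s20 : 0 < s ^+ 2 by rewrite exprn_gt0.
have ii := interaction_integrable (ltW s0) (ltW s0) Hq Hq.
have ls0 : 0 <= ln s by rewrite ln_ge0.
have C0 : 0 <= C by have := le_trans (q0 0) (qC 0); rewrite pmulr_lge0// invr_gt0.
have iqq := integrable_prod iq iq.
pose pr (z : P2 * P2) := q z.1 * q z.2.
pose up (z : P2 * P2) := q z.1 * ln (enorm (z.1 - z.2)) * q z.2.
have Epr : \int[nu]_z pr z = m * m by exact: (Rintegral_prod iq iq).
apply/andP; split; last first.
  rewrite -Epr -RintegralZl//; apply: le_Rintegral => //.
    exact: (integrableZl measurableT (ln s + ln 4) iqq).
  move=> z _; rewrite /pr.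
  have [/cboxP[a1 a2]|/qz z1] := pselect (cbox x0 s z.1); last by rewrite z1 !mul0r mulr0.
  have [/cboxP[b1 b2]|/qz z2] := pselect (cbox x0 s z.2); last by rewrite z2 !mulr0.
  have -> : q z.1 * ln (enorm (z.1 - z.2)) * q z.2 = ln (enorm (z.1 - z.2)) * (q z.1 * q z.2) by ring.
  rewrite ler_wpM2r ?mulr_ge0//.
  have [n0|n0] := eqVneq (enorm (z.1 - z.2)) 0.
    by rewrite n0 ln0// addr_ge0// ln_ge0//; lra.
  rewrite -lnM ?posrE// ler_ln ?posrE ?mulr_gt0//; last by rewrite lt0r n0 enorm_ge0.
  apply: le_trans (enorm_le_add _) _ => /=.
  have e1 : `|z.1.1 - z.2.1| <= `|z.1.1 - x0| + `|z.2.1 - x0|.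
    have -> : z.1.1 - z.2.1 = (z.1.1 - x0) - (z.2.1 - x0) by ring.
    exact: ler_normB.
  have e2 := ler_normB z.1.2 z.2.2.
  by move: a1 a2 b1 b2 e1 e2; lra.
have k0 z : (0 <= k z)%E by apply: kernelE_ge0.
have mk : measurable_fun setT k by exact: measurable_kernelE.
have kC : (\int[leb2]_z k z <= 256%:E)%E.
  rewrite (_ : 256 = 64 / (1 / 2) ^+ 2); last by field.
  by apply: integral_kernelE => //; lra.
pose g1 (z : P2 * P2) := ((q z.1)%:E * k (z.1 - z.2)%R)%E.
have g10 z : (0 <= g1 z)%E by rewrite mule_ge0 ?lee_fin.
have mg1 : measurable_fun setT g1.
  exact: (measurable_diff_kernel mq mk measurable_fst).
have C0' : (0 <= C%:E)%E by rewrite lee_fin.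
have I1 : (\int[nu]_z g1 z <= (m * 256)%:E)%E.
  exact: (ge0_integral_diff_kernel_fst q0 iq mk k0 (kernelEN _ _) kC).
pose g z := (C%:E * g1 z)%E.
have mg : measurable_fun setT g by exact: measurable_funeM.
have g0 z : (0 <= g z)%E by exact: mule_ge0.
have Ig : (\int[nu]_z g z <= (C * (m * 256))%:E)%E.
  rewrite /g (ge0_integralZl _ measurableT mg1 (fun z _ => g10 z) C0') EFinM.
  exact: lee_wpmul2l.
have ipr : nu.-integrable setT (EFin \o (fun z => ln s * pr z)).
  exact: (integrableZl measurableT (ln s) iqq).
have iup : nu.-integrable setT (EFin \o up) by exact: ii.
have [i1 e1'] := Rintegral_axpy (-1) iup ipr.
have e1 : \int[nu]_z (-1 * up z + ln s * pr z) = - (\int[nu]_z up z) + ln s * (m * m).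
  have <- : \int[nu]_z (ln s * pr z) = ln s * (m * m) by rewrite RintegralZl// Epr.
  by etransitivity; [exact: e1'|rewrite mulN1r].
suff le z : ((-1 * up z + ln s * pr z)%:E <= g z)%E.
  have := Rintegral_le_majorant i1 mg g0 le Ig.
  by rewrite [X in X <= _]e1; exact: self_interaction_ge_combine.
have [z1|z1] := eqVneq (q z.1) 0.
  by rewrite /up /pr z1 !mul0r !mulr0 addr0.
have [z2|z2] := eqVneq (q z.2) 0.
  by rewrite /up /pr z2 !mulr0 addr0.
have {z1}z1 : 0 < q z.1 by rewrite lt0r z1 q0.
have {z2}z2 : 0 < q z.2 by rewrite lt0r z2 q0.
pose D := ln s - ln (enorm (z.1 - z.2)).
have -> : -1 * up z + ln s * pr z = q z.1 * q z.2 * D by rewrite /up /pr /D; ring.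
have [D0|D0] := lerP D 0.
  by apply: le_trans (g0 z); rewrite lee_fin mulr_ge0_le0// mulr_ge0.
have r0 : 0 < (s ^+ 2)^-1 by rewrite invr_gt0.
(* For r = s^-2 and w0 = 2 ln s = - ln r the penalty vanishes and the bracket is D; the factor C
   then compensates for q <= C r. *)
have := ln_le_kernelE (2 * ln s) (z.1 - z.2) (ltr01 : 0 < 1 :> R) (lexx 1) r0.
have lr : - ln (s ^+ 2)^-1 = 2 * ln s by rewrite lnV// opprK lnXn// mulr2n; ring.
rewrite lr subrr normr0 mulr0 subr0 (_ : 2 * ln s / 2 - _ = D); last by rewrite /D; field.
have qC0 : (0 <= (C * q z.1)%:E)%E by rewrite lee_fin mulr_ge0.
rewrite -/k => /(lee_wpmul2l qC0).
have -> : ((C * q z.1)%:E * k (z.1 - z.2)%R)%E = g z by rewrite EFinM -muleA.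
rewrite -EFinM; apply: le_trans.
rewrite lee_fin.
have -> : C * q z.1 * ((s ^+ 2)^-1 * D) = q z.1 * (C / s ^+ 2) * D by ring.
by rewrite ler_wpM2r ?(ltW D0)// ler_wpM2l.
Qed.

End one_profile.
End profiles.

(** * Trial functions and unboundedness *)

Section humps.
Context {R : realType}.
Local Notation P2 := (measurableTypeR R * measurableTypeR R)%type.

Let h : R -> R := plateau (-1) 1 0.

Let h_le1 t : h t <= 1.
Proof. by rewrite mulr_ile1 ?flat0_ge0 ?flat0_le1. Qed.

Let h_out t : 1 < `|t| -> h t = 0.
Proof.
move=> t1; apply: plateau_out; rewrite -ltr_norml -leNgt; exact: ltW.
Qed.

Let h_ge t : `|t| <= 1 / 2 -> expR (- 4) <= h t.
Proof.
rewrite ler_norml => /andP[t1 t2].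
have fl (u : R) : 1 / 2 <= u -> expR (- 2) <= flat 0 u.
  move=> u2; have u0 : 0 < u by apply: lt_le_trans u2.
  rewrite /flat u0 mul1r ler_expR lerN2 -[leRHS]invrK lef_pV2 ?posrE ?invr_gt0//.
  by move: u2; lra.
rewrite /h plateauE (_ : - 4 = - 2 + - 2); last by ring.
rewrite expRD; apply: ler_pM; rewrite ?expR_ge0//; apply: fl; move: t1 t2; lra.
Qed.

Let hs (x0 s : R) (t : R) : R := h (s^-1 * t + - (s^-1 * x0)).

Let hsE x0 s t : hs x0 s t = h ((t - x0) / s).
Proof. by rewrite /hs; congr h; ring. Qed.

Let hs_smooth_compact x0 s : 0 < s -> smooth_compact (hs x0 s).
Proof.
move=> s0; split; first by apply: smooth_affine; case: (plateau_smooth_compact (-1) (1 : R) 0).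
exists (`|x0| + s) => t tx; rewrite hsE h_out// normrM normfV (gtr0_norm s0).
rewrite ltr_pdivlMr// mul1r.
by have := ler_normD (t - x0) x0; rewrite subrK; move: tx; lra.
Qed.

Let hs_derive x0 s t : 0 < s -> (hs x0 s)^`()%classic t = s^-1 * h^`()%classic ((t - x0) / s).
Proof.
move=> s0; have sh : smooth h by case: (plateau_smooth_compact (-1) (1 : R) 0).
rewrite derive1E.
pose A x : R := s^-1 * x + - (s^-1 * x0).
have -> : hs x0 s = h \o A by [].
have dA : is_derive t (1 : R) A s^-1.
  rewrite -[X in is_derive _ _ _ X]addr0.
  apply: is_deriveD; rewrite -[X in is_derive _ _ _ X]mulr1.
  exact: (is_deriveZ s^-1 (is_derive_id t 1)).
have dh := smooth_is_derive (A t) sh.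
have [_ ->] : is_derive t (1 : R) (h \o A) (h^`()%classic (A t) * s^-1).
  exact: is_derive1_comp.
by rewrite mulrC; congr (_ * derive1 h _); rewrite /A; ring.
Qed.

(** Dilating one fixed bump multiplies its mass by s^2 but, in dimension two, leaves the Dirichlet
    integral unchanged. Hence both constants can be chosen independently of the centre and of the
    width. *)
Lemma hump_exists : exists kH : R * R, [/\ 0 < kH.1, 0 < kH.2 & forall x0 s : R, 1 <= s ->
  exists a b : R -> R, [/\ smooth_compact a, smooth_compact b,
    (forall z, 0 <= tensor a b z <= 1) /\
      (forall z, ~ cbox x0 s z -> tensor a b z = 0),
    kH.1 * s ^+ 2 <= \int[leb2]_z (tensor a b z ^+ 2) &
    \int[leb2]_z (tensor a^`()%classic b z ^+ 2) <= kH.2 /\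
    \int[leb2]_z (tensor a b^`()%classic z ^+ 2) <= kH.2]].
Proof.
have ch : smooth_compact h by exact: plateau_smooth_compact.
have ch' := smooth_compact_derive1 ch.
have [H H0 hH] := smooth_compact_bounded ch'.
have [_ [r0 hr0]] := ch'.
(* At least 1, so that both h and its derivative vanish beyond r and one square of half-side r s
   contains all the supports. *)
pose r := `|r0| + 1; have r1 : 1 <= r by rewrite lerDr.
have hr t : r < `|t| -> h^`()%classic t = 0.
  by move=> rt; apply: hr0; apply: le_lt_trans rt; rewrite /r; have := ler_norm r0; lra.
have r00 : 0 < r by apply: lt_le_trans r1.
(* On the square of half-side s / 2, of area s^2, each factor is at least exp(-4), so the squared
   product is at least exp(-16). The second constant is the area 4 (r s)^2 times the bound (H /
   s)^2. *)
exists (expR (- 16), 4 * H ^+ 2 * r ^+ 2); split => /=.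
- exact: expR_gt0.
- by rewrite !mulr_gt0// exprn_gt0.
move=> x0 s s1; have s0 : 0 < s by apply: lt_le_trans s1.
have ca := hs_smooth_compact x0 s0; have cb := hs_smooth_compact 0 s0.
exists (hs x0 s), (hs 0 s).
have rng z : 0 <= tensor (hs x0 s) (hs 0 s) z <= 1.
  by rewrite mulr_ge0 ?plateau_ge0//= mulr_ile1 ?plateau_ge0 ?h_le1.
have out z : ~ cbox x0 s z -> tensor (hs x0 s) (hs 0 s) z = 0.
  move=> /cboxP/not_andP[/negP|/negP]; rewrite -ltNge => lt; rewrite /tensor !hsE.
    by rewrite h_out ?mul0r// normrM normfV (gtr0_norm s0) ltr_pdivlMr// mul1r.
  by rewrite [h ((z.2 - 0) / s)]h_out ?mulr0// subr0 normrM normfV (gtr0_norm s0) ltr_pdivlMr// mul1r.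
have mten (c d : R -> R) : smooth_compact c -> smooth_compact d ->
    measurable_fun setT (fun z : P2 => tensor c d z ^+ 2).
  move=> [sc _] [sd _]; apply: measurable_funX.
  by apply: measurable_tensor; exact: smooth_measurable.
have dle (t x : R) : `|s^-1 * h^`()%classic x| <= s^-1 * H.
  by rewrite normrM ger0_norm ?invr_ge0 ?(ltW s0)// ler_wpM2l ?invr_ge0 ?(ltW s0).
have hn x : `|h x| <= 1 by rewrite ger0_norm ?plateau_ge0.
have rs0 : 0 <= r * s by rewrite mulr_ge0// ltW.
have K : 4 * (s^-1 * H) ^+ 2 * (r * s) ^+ 2 = 4 * H ^+ 2 * r ^+ 2.
  by field; rewrite gt_eqF.
have scal (t x1 : R) : r * s < `|t - x1| -> r < `|(t - x1) / s|.
  by rewrite normrM normfV (gtr0_norm s0) ltr_pdivlMr.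
have rh t : r < `|t| -> h t = 0 by move=> rt; apply: h_out; apply: le_lt_trans rt.
split => //.
- have mc := measurable_cbox x0 (s / 2).
  have s20 : 0 <= s / 2 by rewrite divr_ge0// ltW.
  have i1 : leb2.-integrable setT (fun z : P2 => (tensor (hs x0 s) (hs 0 s) z ^+ 2)%:E).
    apply: (proj1 (@integral_cbox_le R x0 s 1 _ (ltW s0) _ _ _)).
    - exact: mten.
    - move=> z; have /andP[z0 z1] := rng z.
      by rewrite ger0_norm ?sqr_ge0// expr_le1.
    - by move=> z /out ->; rewrite expr0n.
  pose ind (z : P2) : R := expR (-16) * \1_(cbox x0 (s / 2)) z.
  have [i2 _] : leb2.-integrable setT (EFin \o ind) /\ `|\int[leb2]_z ind z| <= 4 * expR (-16) * (s / 2) ^+ 2.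
    apply: (@integral_cbox_le R x0 _ _ _ s20).
    - by apply: measurable_funM => //; exact: measurable_indic.
    - move=> z; rewrite /ind ger0_norm ?mulr_ge0 ?expR_ge0// ler_piMr ?expR_ge0//.
    - by move=> z nz; rewrite /ind indicE memNset// mulr0.
  have Ei : \int[leb2]_z ind z = expR (-16) * s ^+ 2.
    rewrite /ind RintegralZl//; last first.
      have := integrableZl measurableT (expR 16) i2; congr (_.-integrable _ _).
      apply/funext => z /=; rewrite /ind -EFinM; congr EFin.
      by rewrite mulrA -expRD subrr expR0 mul1r.
    congr (_ * _); rewrite /Rintegral integral_indic// setIT.
    transitivity (fine (4 * (s / 2) ^+ 2)%:E); first by congr fine; exact: leb2_cbox.
    by rewrite /=; field.
  rewrite -Ei; apply: le_Rintegral => // z _; rewrite /ind indicE.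
  case: (boolP (z \in _)) => [|_]; last by rewrite mulr0 sqr_ge0.
  rewrite inE => /cboxP[z1 z2]; rewrite mulr1.
  rewrite (_ : - 16 = (- 4 + - 4) + (- 4 + - 4)); last by ring.
  have /andP[t0 _] := rng z.
  rewrite !expRD -expr2 ler_pXn2r ?nnegrE ?(mulr_ge0 (expR_ge0 _) (expR_ge0 _))//.
  apply: ler_pM; rewrite ?expR_ge0// hsE; apply: h_ge.
    by rewrite normrM normfV (gtr0_norm s0) ler_pdivrMr//; move: z1; lra.
  by rewrite subr0 normrM normfV (gtr0_norm s0) ler_pdivrMr//; move: z2; lra.
- split; rewrite -K; (apply: le_trans (ler_norm _) _);
    apply: (proj2 (@integral_cbox_le R x0 (r * s) _ _ rs0 _ _ _)).
  + exact: (mten _ _ (smooth_compact_derive1 ca) cb).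
  + move=> z; rewrite ger0_norm ?sqr_ge0// -[leLHS]real_normK ?num_real//.
    rewrite ler_pXn2r ?nnegrE ?mulr_ge0 ?invr_ge0 ?(ltW s0) ?(ltW H0)//.
    rewrite /tensor normrM hs_derive// hsE -[leRHS]mulr1; apply: ler_pM => //.
    exact: dle.
  + move=> z /cboxP/not_andP[/negP|/negP]; rewrite -ltNge => lt; rewrite /tensor hs_derive// hsE.
      by rewrite hr ?mulr0 ?mul0r ?expr0n//; exact: scal.
    by rewrite [h _]rh ?mulr0 ?expr0n//; apply: scal; rewrite subr0.
  + exact: (mten _ _ ca (smooth_compact_derive1 cb)).
  + move=> z; rewrite ger0_norm ?sqr_ge0// -[leLHS]real_normK ?num_real//.
    rewrite ler_pXn2r ?nnegrE ?mulr_ge0 ?invr_ge0 ?(ltW s0) ?(ltW H0)//.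
    rewrite /tensor normrM hs_derive// hsE -[leRHS]mul1r; apply: ler_pM => //.
    exact: dle.
  + move=> z /cboxP/not_andP[/negP|/negP]; rewrite -ltNge => lt; rewrite /tensor hs_derive// hsE.
      by rewrite [h _]rh ?mul0r ?expr0n//; exact: scal.
    by rewrite hr ?mulr0 ?expr0n//; apply: scal; rewrite subr0.
Qed.


End humps.

Section trial.
Context {R : realType}.
Local Notation P2 := (measurableTypeR R * measurableTypeR R)%type.

Lemma tensorZ (c : R) (a b : R -> R) : tensor (fun t => c * a t) b = fun z => c * tensor a b z.
Proof. by apply/funext => z; rewrite /tensor mulrA. Qed.

Lemma smooth_compactZ (c : R) (a : R -> R) : smooth_compact a ->
  smooth_compact (fun t => c * a t).
Proof.
move=> [sa [r hr]]; split; first by apply: smoothM => //; exact: smooth_cst.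
by exists r => x /hr ->; rewrite mulr0.
Qed.

Lemma derive1Z (c : R) (a : R -> R) : smooth a ->
  (fun t => c * a t)^`()%classic = fun t => c * a^`()%classic t.
Proof.
move=> sa; apply/funext => t; rewrite derive1E.
by have [_ ->] := is_deriveZ c (smooth_is_derive t sa).
Qed.

Lemma sum_tensor_Ck1 (a b c d : R -> R) : smooth a -> smooth b -> smooth c -> smooth d ->
  [/\ Ck 1 (fun z : R * R => tensor a b z + tensor c d z),
    forall z, 'D_(basis2 ord0) (fun z : R * R => tensor a b z + tensor c d z) z =
      tensor a^`()%classic b z + tensor c^`()%classic d z &
    forall z, 'D_(basis2 (lift ord0 ord0)) (fun z : R * R => tensor a b z + tensor c d z) z =
      tensor a b^`()%classic z + tensor c d^`()%classic z].
Proof.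
move=> sa sb sc sd; pose F : R * R -> R := fun z => tensor a b z + tensor c d z.
rewrite -/F; have d0 z := is_deriveD (is_derive_tensor0 b z sa) (is_derive_tensor0 d z sc).
have d1 z := is_deriveD (is_derive_tensor1 a z sb) (is_derive_tensor1 c z sd).
have E0 : 'D_(basis2 ord0) F =
    (fun z => tensor a^`()%classic b z + tensor c^`()%classic d z).
  by apply/funext => z; have [_ <-] := d0 z.
have E1 : 'D_(basis2 (lift ord0 ord0)) F =
    (fun z => tensor a b^`()%classic z + tensor c d^`()%classic z).
  by apply/funext => z; have [_ <-] := d1 z.
have ct (a' b' c' d' : R -> R) : smooth a' -> smooth b' -> smooth c' -> smooth d' ->
    continuous (fun z => tensor a' b' z + tensor c' d' z).
  move=> sa' sb' sc' sd' z; apply: (@cvgD _ _ _ _ _ (tensor a' b') (tensor c' d')).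
    by apply: tensor_continuous; exact: smooth_continuous.
  by apply: tensor_continuous; exact: smooth_continuous.
split => [|z|z]; [|by have := congr1 (@^~ z) E0|by have := congr1 (@^~ z) E1].
split; first exact: ct.
elim/ord2P; split.
- by move=> z; have [] := d0 z.
- by split => //; rewrite E0; apply: ct => //; exact: smooth_derive1.
- by move=> z; have [] := d1 z.
- by split => //; rewrite E1; apply: ct => //; exact: smooth_derive1.
Qed.

Lemma tensor_sqr_integrable (a b : R -> R) : smooth_compact a -> smooth_compact b ->
  leb2.-integrable setT (fun z : P2 => (tensor a b z ^+ 2)%:E).
Proof.
move=> ca cb; have [r hr] := tensor_support ca.2 cb.2.
have ct : continuous (tensor a b).
  by apply: tensor_continuous; apply: smooth_continuous; [case: ca|case: cb].
by have := Ck1_integrable_mul ct hr ct; under eq_fun do rewrite -expr2.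
Qed.

Lemma Rintegral_sqrD_le (f g : P2 -> R) (H : R) :
  leb2.-integrable setT (fun z => (f z ^+ 2)%:E) ->
  leb2.-integrable setT (fun z => (g z ^+ 2)%:E) ->
  measurable_fun setT f -> measurable_fun setT g ->
  \int[leb2]_z (f z ^+ 2) <= H -> \int[leb2]_z (g z ^+ 2) <= H ->
  \int[leb2]_z ((f z + g z) ^+ 2) <= 4 * H.
Proof.
move=> f2 g2 mf mg fH gH.
have [i1 e1] := Rintegral_axpy 1 f2 g2.
have i2 := integrableZl measurableT 2 i1.
have e2 : \int[leb2]_z (2 * (1 * f z ^+ 2 + g z ^+ 2)) <= 4 * H.
  by rewrite RintegralZl// e1; move: fH gH; lra.
apply: le_trans e2; have le z : (f z + g z) ^+ 2 <= 2 * (1 * f z ^+ 2 + g z ^+ 2).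
  by have := sqr_ge0 (f z - g z); nra.
apply: le_Rintegral => //.
apply: le_integrable i2 => //.
  by apply/measurable_EFinP; apply: measurable_funX; exact: measurable_funD.
by move=> z _; rewrite lee_fin /= ger0_norm ?sqr_ge0// (le_trans (le z))// ler_norm.
Qed.

(** The two bumps have disjoint supports because x0 >= 4 s, so the density is the sum of the two
    densities without a cross term. The constants depend on M only. The bound on [q1] is written
    with [1 ^+ 2] so that the profile lemmas apply with s = 1. *)
Lemma trial_exists (M : R) : 0 < M -> exists CH : R * R, forall m1 m2 x0 s : R,
  0 <= m1 -> 0 <= m2 -> m1 + m2 = M -> 1 <= s -> 4 * s <= x0 ->
  exists f q1 q2 : P2 -> R,
  [/\ Ck 1 f /\ (exists r, forall z, ~ box r z -> f z = 0),
    forall z, f z ^+ 2 = q1 z + q2 z,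
    density 0 1 (CH.1 / 1 ^+ 2) q1 /\ \int[leb2]_z q1 z = m1,
    density x0 s (CH.1 / s ^+ 2) q2 /\ \int[leb2]_z q2 z = m2 &
    forall i, \int[leb2]_z ('D_(basis2 i) f z ^+ 2) <= CH.2].
Proof.
move=> M0; have [[k H] /= [k0 H0 Hump]] := @hump_exists R.
exists (M / k, 4 * (M / k * H)) => m1 m2 x0 s m10 m20 mM s1 sx /=.
have s0 : 0 < s by apply: lt_le_trans s1.
have sep t : t <= 1 -> x0 - s <= t -> False by move: s1 sx; clear; lra.
have Mk0 : 0 < M / k by rewrite divr_gt0.
have step y t m : 1 <= t -> 0 <= m -> m <= M -> exists a b : R -> R,
  [/\ smooth_compact a, smooth_compact b,
    density y t (M / k / t ^+ 2) (fun z => tensor a b z ^+ 2) /\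
    \int[leb2]_z (tensor a b z ^+ 2) = m,
    \int[leb2]_z (tensor a^`()%classic b z ^+ 2) <= M / k * H &
    \int[leb2]_z (tensor a b^`()%classic z ^+ 2) <= M / k * H].
  move=> t1 m0 mM'; have t0 : 0 < t by apply: lt_le_trans t1.
  have t20 : 0 < t ^+ 2 by rewrite exprn_gt0.
  have t21 : 1 <= t ^+ 2 by rewrite expr_ge1// ltW.
  have [a [b [ca cb [rng out] Nk [Ha Hb]]]] := Hump y t t1.
  set N := \int[leb2]_z _ in Nk.
  have N0 : 0 < N by apply: lt_le_trans Nk; rewrite mulr_gt0.
  (* The amplitude that normalises the mass to m; the lower bound N >= k t^2 gives A^2 <= M / (k
     t^2), which is the required density bound. *)
  pose A := Num.sqrt (m / N).
  have A2 : A ^+ 2 = m / N by rewrite sqr_sqrtr// divr_ge0// ltW.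
  have A2le : A ^+ 2 <= M / k / t ^+ 2.
    rewrite A2 -mulrA -invfM; apply: ler_pM => //; first by rewrite invr_ge0 ltW.
    by rewrite lef_pV2 ?posrE// mulr_gt0.
  have A2le' : A ^+ 2 <= M / k.
    by apply: le_trans A2le _; rewrite ler_pdivrMr// ler_peMr// ltW.
  have sqZ (c d : R -> R) : (fun z : P2 => tensor (fun u => A * c u) d z ^+ 2) =
      (fun z => A ^+ 2 * tensor c d z ^+ 2).
    by apply/funext => z; rewrite tensorZ exprMn.
  have grad (c d : R -> R) : smooth_compact c -> smooth_compact d ->
      \int[leb2]_z (tensor c d z ^+ 2) <= H ->
      \int[leb2]_z (tensor (fun u => A * c u) d z ^+ 2) <= M / k * H.
    move=> cc cd cdH; rewrite sqZ RintegralZl//; last exact: tensor_sqr_integrable.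
    apply: ler_pM => //; first exact: sqr_ge0.
    by apply: Rintegral_ge0 => z _; exact: sqr_ge0.
  exists (fun u => A * a u), b; split => //.
  - exact: smooth_compactZ.
  - rewrite sqZ; split; last first.
      by rewrite RintegralZl//; [rewrite A2 -/N divfK// gt_eqF|exact: tensor_sqr_integrable].
    split.
    + by apply: measurable_funM => //; apply: measurable_funX; apply: measurable_tensor;
        apply: smooth_measurable; [case: ca|case: cb].
    + by move=> z; rewrite mulr_ge0 ?sqr_ge0.
    + move=> z; have /andP[z0 z1] := rng z; apply: le_trans A2le.
      by rewrite ler_piMr ?sqr_ge0// expr_le1.
    + by move=> z /out ->; rewrite expr0n mulr0.
  - by rewrite derive1Z; [apply: grad => //; exact: smooth_compact_derive1|case: ca].
  - by apply: grad => //; exact: smooth_compact_derive1.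
have m1M : m1 <= M by rewrite -mM lerDl.
have m2M : m2 <= M by rewrite -mM lerDr.
have [a [b [ca cb [dq1 Eq1] Ga Gb]]] := step 0 1 m1 (lexx 1) m10 m1M.
have [c [d [cc cd [dq2 Eq2] Gc Gd]]] := step x0 s m2 s1 m20 m2M.
have [Cf D0 D1] := sum_tensor_Ck1 ca.1 cb.1 cc.1 cd.1.
exists (fun z => tensor a b z + tensor c d z), (fun z => tensor a b z ^+ 2),
  (fun z => tensor c d z ^+ 2).
have mt (a' b' : R -> R) : smooth_compact a' -> smooth_compact b' ->
    measurable_fun [set: P2] (tensor a' b').
  by move=> [sa _] [sb _]; apply: measurable_tensor; exact: smooth_measurable.
have ca' := smooth_compact_derive1 ca; have cb' := smooth_compact_derive1 cb.
have cc' := smooth_compact_derive1 cc; have cd' := smooth_compact_derive1 cd.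
split => //.
- split => //; have [r hr] := tensor_support ca.2 cb.2; have [t ht] := tensor_support cc.2 cd.2.
  exists (Num.max r t) => z nz; rewrite hr ?ht ?addr0//.
    by move=> /boxE[z1 z2]; apply: nz; apply/boxE; rewrite !lt_max z1 z2 !orbT.
  by move=> /boxE[z1 z2]; apply: nz; apply/boxE; rewrite !lt_max z1 z2.
- move=> z; suff e : tensor a b z * tensor c d z = 0 by rewrite sqrrD e mul0rn addr0.
  have [_ _ _ z1] := dq1; have [_ _ _ z2] := dq2.
  have [/cboxP[b1 _]|/z1/eqP] := pselect (cbox 0 1 z); last first.
    by rewrite sqrf_eq0 => /eqP ->; rewrite mul0r.
  have /z2/eqP : ~ cbox x0 s z.
    move=> /cboxP[b2 _]; move: b1 b2; rewrite subr0 ler_norml ler_distl.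
    by move=> /andP[_ h2] /andP[h3 _]; exact: sep h2 h3.
  by rewrite sqrf_eq0 => /eqP ->; rewrite mulr0.
- elim/ord2P.
    suff H' : forall F : P2 -> R, (forall z, F z = tensor a^`()%classic b z + tensor c^`()%classic d z) ->
      \int[leb2]_z (F z ^+ 2) <= 4 * (M / k * H) by exact: H'.
    move=> F FE; under eq_Rintegral do rewrite FE.
    exact: (Rintegral_sqrD_le (tensor_sqr_integrable ca' cb) (tensor_sqr_integrable cc' cd) (mt _ _ ca' cb) (mt _ _ cc' cd) Ga Gc).
  suff H' : forall F : P2 -> R, (forall z, F z = tensor a b^`()%classic z + tensor c d^`()%classic z) ->
    \int[leb2]_z (F z ^+ 2) <= 4 * (M / k * H) by exact: H'.
  move=> F FE; under eq_Rintegral do rewrite FE.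
  exact: (Rintegral_sqrD_le (tensor_sqr_integrable ca cb') (tensor_sqr_integrable cc cd') (mt _ _ ca cb') (mt _ _ cc cd') Gb Gd).
Qed.

End trial.

Lemma two_humps_potential_combine (R : realFieldType) (m1 m2 M v a b p1 p2 L : R) :
  0 <= m1 -> 0 <= m2 -> m1 + m2 = M -> 0 <= v -> 0 <= a -> 0 <= b ->
  (4 * L - 4 * a) * m2 <= p2 <= (4 * L + 2 * b) * m2 ->
  0 * m1 <= p1 <= v * m1 ->
  `|p1 + p2 - 4 * L * m2| <= (v + 4 * a + 2 * b) * M.
Proof.
move=> m10 m20 <- v0 a0 b0 /andP[h1 h2] /andP[h3 h4].
have k1 := mulr_ge0 v0 m10; have k2 := mulr_ge0 v0 m20.
have k3 := mulr_ge0 a0 m10; have k4 := mulr_ge0 a0 m20.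
have k5 := mulr_ge0 b0 m10; have k6 := mulr_ge0 b0 m20.
by rewrite ler_norml; apply/andP; split; lra.
Qed.

(** Here L stands for ln x0 and l for ln s. The two cross terms carry L, the self-interaction of the
    wide bump carries l, and everything else is bounded in terms of M. *)
Lemma two_humps_interaction_combine (R : realFieldType)
    (m1 m2 M C a b l L p11 p12 p21 p22 : R) :
  0 <= m1 -> 0 <= m2 -> m1 + m2 = M -> 0 <= a -> 0 <= b ->
  (L - b) * (m2 * m1) <= p21 <= (L + b) * (m2 * m1) ->
  (L - b) * (m1 * m2) <= p12 <= (L + b) * (m1 * m2) ->
  l * (m2 * m2) - 256 * C * m2 <= p22 <= (l + a) * (m2 * m2) ->
  - (256 * C * m1) <= p11 <= a * (m1 * m1) ->
  `|1 * p11 + (1 * p12 + (1 * p21 + p22)) - (2 * L * (m1 * m2) + l * (m2 * m2))| <=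
    256 * `|C| * M + (a + 2 * b) * (M * M).
Proof.
move=> m10 m20 <- a0 b0 /andP[h1 h2] /andP[h3 h4] /andP[h5 h6] /andP[h7 h8].
have c1 : C * m1 <= `|C| * m1 by rewrite ler_wpM2r// ler_norm.
have c2 : C * m2 <= `|C| * m2 by rewrite ler_wpM2r// ler_norm.
have c3 := mulr_ge0 (normr_ge0 C) m10; have c4 := mulr_ge0 (normr_ge0 C) m20.
have k1 := mulr_ge0 a0 (mulr_ge0 m10 m10); have k2 := mulr_ge0 a0 (mulr_ge0 m20 m20).
have k3 := mulr_ge0 b0 (mulr_ge0 m10 m20); have k4 := mulr_ge0 a0 (mulr_ge0 m10 m20).
have k5 := mulr_ge0 b0 (mulr_ge0 m10 m10); have k6 := mulr_ge0 b0 (mulr_ge0 m20 m20).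
by rewrite ler_norml; apply/andP; split; lra.
Qed.

Lemma two_humps_entropy_combine (R : realFieldType) (p1 p2 t c : R) :
  `|p2 + t| <= 4 * c -> `|p1| <= 4 * c -> `|p1 + p2 + t| <= 8 * c.
Proof.
move=> h2 h1; rewrite -addrA; apply: le_trans (ler_normD _ _) _.
by move: h1 h2; lra.
Qed.

(** * Energy of the two-bump trial functions *)

Section trial_energy.
Context {R : realType}.
Local Notation P2 := (measurableTypeR R * measurableTypeR R)%type.
Local Notation nu := (leb2 \x leb2)%E.

Lemma H1_real_cst0 : H1_real (fun _ : R * R => 0 : R) /\
  energy_mass (fun _ : P2 => 0 : R) = 0%E.
Proof.
pose z0 := fun _ : R * R => 0 : R; rewrite -/z0.
have D0 v : 'D_v z0 = cst 0 by apply/funext => z; rewrite derive_cst.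
have C1 : Ck 1 z0.
  split; first by move=> z; exact: cvg_cst.
  move=> i; split; first by move=> z; exact: derivable_cst.
  by rewrite D0; split => // z; exact: cvg_cst.
have [H E] := @H1_real_classical R z0 1 C1 (fun _ _ => erefl).
split; first exact: H.
have Z i : (\int[leb2]_z (wpartial i z0 z ^+ 2)%:E = 0)%E.
  etransitivity; first exact: E.
  suff h (g : P2 -> R) : (forall z, g z = 0) -> (\int[leb2]_z (g z ^+ 2)%:E = 0)%E.
    by apply: h => z; exact: (congr1 (@^~ z) (D0 (basis2 i))).
  by move=> g0; apply: integral0_eq => z _; rewrite g0 expr0n.
transitivity (0 + 0 : \bar R)%E; last exact: adde0.
exact: (congr2 (fun a b : \bar R => a + b)%E (Z ord0) (Z (lift ord0 ord0))).
Qed.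

(** The imaginary part is identically zero, so the same trial function serves for real and for
    complex scalars. *)
Lemma real_function_sphere (sc : scalars) (f : P2 -> R) (M r H : R) : Ck 1 f ->
  (forall z, ~ box r z -> f z = 0) -> \int[leb2]_z (f z ^+ 2) = M ->
  (forall i, \int[leb2]_z ('D_(basis2 i) f z ^+ 2) <= H) ->
  let u := fun z => (f z +i* 0)%C in
  [/\ sphere sc M u, sqmod u = fun z => f z ^+ 2 & \int[leb2]_x sqgrad u x <= 2 * H].
Proof.
move=> Cf fr fM fH u.
have [Hf Ef] := H1_real_classical Cf fr; have [H0 E0] := H1_real_cst0.
have su : sqmod u = fun z => f z ^+ 2.
  by apply/funext => z; rewrite sqmodE /re /im /= [0 ^+ 2]expr0n addr0.
have us : sphere sc M u.
  split; last by rewrite su.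
  by split => //; case: sc.
split => //.
have iD i : leb2.-integrable setT (fun z : P2 => ('D_(basis2 i) f z ^+ 2)%:E).
  have [_ /(_ i)[_ [cD _]]] := Cf.
  have := Ck1_integrable_mul cD (fun z => @derive_support R f r (basis2 i) z fr) cD.
  by under eq_fun do rewrite -expr2.
have EI i : (\int[leb2]_z (wpartial i f z ^+ 2)%:E = (\int[leb2]_z ('D_(basis2 i) f z ^+ 2))%R%:E)%E.
  by etransitivity; [exact: Ef|rewrite /Rintegral fineK// integrable_fin_num].
have EM : energy_mass f = ((\int[leb2]_z ('D_(basis2 ord0) f z ^+ 2))%R%:E +
    (\int[leb2]_z ('D_(basis2 (lift ord0 ord0)) f z ^+ 2))%R%:E)%E.
  exact: (congr2 (fun a b : \bar R => a + b)%E (EI ord0) (EI (lift ord0 ord0))).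
have [_ _ _ _ EK] := sphere_facts us.
have {EK} : (energy_mass f + energy_mass (fun _ : P2 => 0%R) = (\int[leb2]_x sqgrad u x)%R%:E)%E.
  exact: EK.
rewrite E0 adde0 EM -EFinD => -[<-].
by rewrite mulr_natl mulr2n; exact: (lerD (fH ord0) (fH (lift ord0 ord0))).
Qed.

Lemma density_energy_dom (u : P2 -> R[i]) (x0 s C : R) : 0 <= s ->
  density x0 s C (sqmod u) -> energy_dom u.
Proof.
move=> s0 Hd; split.
- exact: density_potential_integrable Hd.
- by apply: aeW => x; exact: slice_integrable Hd x.
- exact: (interaction_integrable s0 s0 Hd Hd).
- exact: density_entropy_integrable Hd.
Qed.

Section geometry.
Variables (x0 s : R).
Hypotheses (s1 : 1 <= s) (sx : 4 * s <= x0).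

Let s0 : 0 < s. Proof. exact: lt_le_trans s1. Qed.
Let x00 : 0 < x0. Proof. by apply: lt_le_trans sx; rewrite mulr_gt0. Qed.
Let x04 : 4 <= x0. Proof. by move: s1 sx; lra. Qed.

Lemma enorm_cbox_between z : cbox x0 s z -> x0 / 2 <= enorm z <= 2 * x0.
Proof.
move=> /cboxP[a b]; apply/andP; split.
  apply: le_trans (normr_fst_le_enorm z).
  have := ler_normD (x0 - z.1) z.1; rewrite subrK distrC (gtr0_norm x00).
  by move: s1 sx a; lra.
apply: le_trans (enorm_le_add z) _.
have := ler_normD (z.1 - x0) x0; rewrite subrK (gtr0_norm x00).
by move: s1 sx a b; lra.
Qed.

Lemma enorm_cboxB_between z w : cbox 0 1 z -> cbox x0 s w -> x0 / 2 <= enorm (z - w) <= 2 * x0.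
Proof.
move=> /cboxP[a b] /cboxP[a' b']; rewrite subr0 in a; apply/andP; split.
  apply: le_trans (normr_fst_le_enorm _) => /=.
  have := ler_normD (x0 - w.1) (w.1 - z.1 + z.1).
  rewrite (_ : x0 - w.1 + (w.1 - z.1 + z.1) = x0); last by ring.
  rewrite (gtr0_norm x00).
  have := ler_normD (w.1 - z.1) z.1; rewrite [`|w.1 - z.1|]distrC [`|x0 - _|]distrC.
  by move: s1 sx a a'; lra.
apply: le_trans (enorm_le_add _) _ => /=.
have h1 := ler_normB z.1 w.1; have h2 := ler_normB z.2 w.2.
have := ler_normD (w.1 - x0) x0; rewrite subrK (gtr0_norm x00).
by move: s1 sx a b a' b' h1 h2; lra.
Qed.

Lemma ln_between t : x0 / 2 <= t <= 2 * x0 -> ln x0 - ln 2 <= ln t <= ln x0 + ln 2.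
Proof.
move=> /andP[t1 t2]; have t0 : 0 < t by apply: lt_le_trans t1; rewrite divr_gt0.
rewrite -ln_div ?posrE// -lnM ?posrE// !ler_ln ?posrE ?divr_gt0 ?mulr_gt0//.
by rewrite t1 mulrC t2.
Qed.

Lemma cbox_sub_origin z : cbox 0 1 z \/ cbox x0 s z -> cbox 0 (2 * x0) z.
Proof.
move=> h; apply/cboxP; rewrite subr0; case: h => /cboxP[a b]; split.
- by move: x04 a; rewrite subr0; lra.
- by move: x04 b; lra.
- have := ler_normD (z.1 - x0) x0; rewrite subrK (gtr0_norm x00).
  by move: s1 sx a; lra.
- by move: s1 sx b; lra.
Qed.

Lemma cbox_disjoint z : cbox 0 1 z -> ~ cbox x0 s z.
Proof.
move=> /cboxP[a _] /cboxP[b _]; move: a b; rewrite subr0 ler_norml ler_distl.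
by move=> /andP[h1 h2] /andP[h3 h4]; move: s1 sx h2 h3; lra.
Qed.

End geometry.

Section estimates.
Variables (C M m1 m2 x0 s : R) (q1 q2 : P2 -> R).
Hypotheses (m10 : 0 <= m1) (m20 : 0 <= m2) (mM : m1 + m2 = M).
Hypotheses (s1 : 1 <= s) (sx : 4 * s <= x0).
Hypotheses (d1 : density 0 1 (C / 1 ^+ 2) q1) (E1 : \int[leb2]_z q1 z = m1).
Hypotheses (d2 : density x0 s (C / s ^+ 2) q2) (E2 : \int[leb2]_z q2 z = m2).

Let s0 : 0 < s. Proof. exact: lt_le_trans s1. Qed.
Let x00 : 0 < x0. Proof. by apply: lt_le_trans sx; rewrite mulr_gt0. Qed.
Let x01 : 1 <= x0. Proof. by move: s1 sx; lra. Qed.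
Let ln_nat_ge0 n : 0 <= ln (n.+1%:R : R).
Proof. by rewrite ln_ge0// ler1n. Qed.

Lemma sum_density : exists D, density 0 (2 * x0) D (fun z => q1 z + q2 z).
Proof.
have [mq1 q10 q1C q1z] := d1; have [mq2 q20 q2C q2z] := d2.
exists (C / 1 ^+ 2 + C / s ^+ 2); split.
- exact: measurable_funD.
- by move=> z; rewrite addr_ge0.
- by move=> z; rewrite lerD.
by move=> z nz; rewrite q1z ?q2z ?addr0// => h; apply: nz; apply: (cbox_sub_origin s1 sx); [right|left].
Qed.

Let V_near z : cbox 0 1 z -> 0 <= V z <= V ((1, 1) : R * R).
Proof.
move=> /cboxP[a b]; rewrite subr0 in a; rewrite V_ge0 /= /V.
rewrite ler_wpM2l// ler_ln ?posrE; try by rewrite ltr_pwDl ?sqr_ge0.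
rewrite lerD2l !enorm_sqr /= lerD//.
  by rewrite -[leLHS]real_normK ?num_real// ler_pXn2r ?nnegrE.
by rewrite -[leLHS]real_normK ?num_real// ler_pXn2r ?nnegrE.
Qed.

Let V_far z : cbox x0 s z -> 4 * ln x0 - 4 * ln 2 <= V z <= 4 * ln x0 + 2 * ln 5.
Proof.
move=> /(enorm_cbox_between s1 sx)/andP[e1 e2].
have e0 : 0 < enorm z by apply: lt_le_trans e1; rewrite divr_gt0.
apply/andP; split.
  apply: le_trans (V_ge z).
  have -> : 4 * ln x0 - 4 * ln 2 = 4 * ln (x0 / 2) by rewrite ln_div ?posrE//; ring.
  by rewrite ler_wpM2l// ler_ln ?posrE ?divr_gt0.
rewrite /V.
have -> : 4 * ln x0 + 2 * ln 5 = 2 * ln (x0 ^+ 2 * 5).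
  by rewrite lnM ?posrE ?exprn_gt0// lnXn// mulr2n; ring.
rewrite ler_wpM2l// ler_ln ?posrE; [|by rewrite ltr_pwDl ?sqr_ge0|by rewrite mulr_gt0 ?exprn_gt0].
have h1 : enorm z ^+ 2 <= (2 * x0) ^+ 2 by rewrite ler_pXn2r ?nnegrE ?enorm_ge0 ?mulr_ge0 ?(ltW x00).
have h2 : 1 <= x0 ^+ 2 by rewrite expr_ge1 ?(ltW x00).
(* The 5 arises from 1 + |z|^2 <= x0^2 + (2 x0)^2, as x0 >= 1 and |z| <= 2 x0. *)
have -> : x0 ^+ 2 * 5 = x0 ^+ 2 + (2 * x0) ^+ 2 by ring.
exact: lerD.
Qed.

Lemma potential_estimate :
  `|\int[leb2]_z (V z * (q1 z + q2 z)) - 4 * ln x0 * m2| <=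
  (V ((1, 1) : R * R) + 4 * ln 2 + 2 * ln 5) * M.
Proof.
have iV1 := density_potential_integrable ler01 d1.
have iV2 := density_potential_integrable (ltW s0) d2.
have -> : (fun z : P2 => V z * (q1 z + q2 z)) = (fun z => V z * q1 z + V z * q2 z).
  by apply/funext => z; rewrite mulrDr.
rewrite RintegralD//.
have := density_integral_between ler01 d1 measurable_V V_near; rewrite E1.
have := density_integral_between (ltW s0) d2 measurable_V V_far; rewrite E2.
exact: (two_humps_potential_combine m10 m20 mM (V_ge0 _) (ln_nat_ge0 1) (ln_nat_ge0 4)).
Qed.

Lemma interaction_estimate :
  `|\int[nu]_z ((q1 z.1 + q2 z.1) * ln (enorm (z.1 - z.2)) * (q1 z.2 + q2 z.2))
    - (2 * ln x0 * (m1 * m2) + ln s * (m2 * m2))| <=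
  256 * `|C| * M + (ln 4 + 2 * ln 2) * (M * M).
Proof.
have i11 := interaction_integrable ler01 ler01 d1 d1.
have i12 := interaction_integrable ler01 (ltW s0) d1 d2.
have i21 := interaction_integrable (ltW s0) ler01 d2 d1.
have i22 := interaction_integrable (ltW s0) (ltW s0) d2 d2.
have [i3 e3] := Rintegral_axpy 1 i21 i22.
have [i4 e4] := Rintegral_axpy 1 i12 i3.
have [i5 e5] := Rintegral_axpy 1 i11 i4.
have -> : \int[nu]_z ((q1 z.1 + q2 z.1) * ln (enorm (z.1 - z.2)) * (q1 z.2 + q2 z.2)) =
  1 * \int[nu]_z (q1 z.1 * ln (enorm (z.1 - z.2)) * q1 z.2) +
  (1 * \int[nu]_z (q1 z.1 * ln (enorm (z.1 - z.2)) * q2 z.2) +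
  (1 * \int[nu]_z (q2 z.1 * ln (enorm (z.1 - z.2)) * q1 z.2) +
    \int[nu]_z (q2 z.1 * ln (enorm (z.1 - z.2)) * q2 z.2))).
  rewrite -e3 -e4 -e5; apply: eq_Rintegral => z _; ring.
have b12 z w : cbox 0 1 z -> cbox x0 s w ->
    ln x0 - ln 2 <= ln (enorm (z - w)) <= ln x0 + ln 2.
  by move=> zB wB; apply: (ln_between s1 sx); exact: (enorm_cboxB_between s1 sx).
have b21 z w : cbox x0 s z -> cbox 0 1 w ->
    ln x0 - ln 2 <= ln (enorm (z - w)) <= ln x0 + ln 2.
  move=> zB wB; have := b12 _ _ wB zB.
  by rewrite (_ : enorm (w - z) = enorm (z - w))// /enorm -opprB /= !sqrrN.
have := profile_self_interaction (lexx 1) d1; rewrite E1 ln1 mul0r !add0r.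
have := profile_self_interaction s1 d2; rewrite E2.
have := interaction_between ler01 (ltW s0) d1 d2 b12; rewrite E1 E2.
have := interaction_between (ltW s0) ler01 d2 d1 b21; rewrite E1 E2.
exact: (two_humps_interaction_combine m10 m20 mM (ln_nat_ge0 3) (ln_nat_ge0 1)).
Qed.

Lemma entropy_estimate :
  `|\int[leb2]_z ((q1 z + q2 z) * ln (q1 z + q2 z)) + 2 * ln s * m2| <= 8 * (1 + C ^+ 2).
Proof.
have ie1 := density_entropy_integrable ler01 d1.
have ie2 := density_entropy_integrable (ltW s0) d2.
have -> : (fun z : P2 => (q1 z + q2 z) * ln (q1 z + q2 z)) =
    (fun z => q1 z * ln (q1 z) + q2 z * ln (q2 z)).
  apply/funext => z; have [_ _ _ z1] := d1; have [_ _ _ z2] := d2.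
  have [b1|/z1 ->] := pselect (cbox 0 1 z); last by rewrite mul0r !add0r.
  by rewrite (z2 z (cbox_disjoint s1 sx b1)) mul0r !addr0.
rewrite RintegralD//.
have := profile_entropy (lexx 1) d1; rewrite E1 ln1 mulr0 mul0r addr0.
have := profile_entropy s1 d2; rewrite E2.
exact: two_humps_entropy_combine.
Qed.

End estimates.
End trial_energy.

Lemma energy_le_combine (R : realFieldType) (alpha beta gamma k v i e v0 i0 e0 K K1 K2 K3 : R) :
  k <= K -> `|v - v0| <= K1 -> `|i - i0| <= K2 -> `|e + e0| <= K3 ->
  k + alpha * v - beta * i + gamma * e <=
  K + `|alpha| * K1 + `|beta| * K2 + `|gamma| * K3 + (alpha * v0 - beta * i0 - gamma * e0).
Proof.
move=> kK h1 h2 h3.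
have bound (a x y : R) : `|x| <= y -> a * x <= `|a| * y.
  by move=> xy; apply: le_trans (ler_norm _) _; rewrite normrM ler_wpM2l.
have b1 := bound alpha _ _ h1; have b3 := bound gamma _ _ h3.
have b2 : - beta * (i - i0) <= `|beta| * K2 by rewrite -normrN; exact: bound.
move: kK b1 b2 b3; lra.
Qed.

Section unbounded.
Context {R : realType}.
Local Notation P2 := (measurableTypeR R * measurableTypeR R)%type.

(** [C0] is chosen before the masses, the distance and the width, so these remain free to drive the
    explicit logarithmic terms to minus infinity. *)
Lemma trial_energy_le (sc : scalars) (alpha beta gamma M : R) : 0 < M ->
  exists C0 : R, forall m1 m2 x0 s : R,
    0 <= m1 -> 0 <= m2 -> m1 + m2 = M -> 1 <= s -> 4 * s <= x0 ->
    exists2 u : P2 -> R[i], (sphere sc M `&` energy_dom) u &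
    energy alpha beta gamma u <= C0 + (alpha * (4 * ln x0 * m2)
      - beta * (2 * ln x0 * (m1 * m2) + ln s * (m2 * m2)) - gamma * (2 * ln s * m2)).
Proof.
move=> M0; have [[C H] /= HT] := trial_exists M0.
exists (2 * H + `|alpha| * ((V ((1, 1) : R * R) + 4 * ln 2 + 2 * ln 5) * M)
  + `|beta| * (256 * `|C| * M + (ln 4 + 2 * ln 2) * (M * M))
  + `|gamma| * (8 * (1 + C ^+ 2))) => m1 m2 x0 s m10 m20 mM s1 sx.
have [f [q1 [q2 [[Cf [r fr]] fq [d1 E1] [d2 E2] fH]]]] := HT _ _ _ _ m10 m20 mM s1 sx.
have x00 : 0 <= 2 * x0 by move: s1 sx; lra.
have s0 : 0 <= s by apply: le_trans s1.
have fqE : (fun z => f z ^+ 2) = (fun z : P2 => q1 z + q2 z) by exact/funext.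
have fM : \int[leb2]_z (f z ^+ 2) = M.
  rewrite fqE RintegralD ?E1 ?E2//.
    exact: (density_integrable ler01 d1).
  exact: (density_integrable s0 d2).
have [us uf uH] := real_function_sphere sc Cf fr fM fH.
set u := (fun z => _) in us uf uH.
have uq : sqmod u = (fun z : P2 => q1 z + q2 z) by rewrite uf.
have [D dD] := sum_density s1 sx d1 d2.
have ud : energy_dom u by apply: (density_energy_dom x00); rewrite uq; exact: dD.
exists u => //; rewrite (energyE _ _ _ us ud).
apply: energy_le_combine => //; rewrite uq.
- exact: (potential_estimate m10 m20 mM s1 sx d1 E1 d2 E2).
- exact: (interaction_estimate m10 m20 mM s1 sx d1 E1 d2 E2).
- exact: (entropy_estimate s1 sx d1 E1 d2 E2).
Qed.

Lemma energy_unbounded_of_alpha_lt0 (sc : scalars) (alpha beta gamma M : R) :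
  0 < M -> alpha < 0 -> ~ energy_bounded_below sc alpha beta gamma M.
Proof.
move=> M0 a0 [b lb]; have [C0 HC] := trial_energy_le sc alpha beta gamma M0.
pose Y := - (4 * alpha * M); have Y0 : 0 < Y by rewrite /Y; nra.
(* The bound C0 - Y t falls below b by at least 3 Y, and t >= 3 ensures expR t >= 4, the separation
   needed when s = 1. *)
pose t := 3 + `|C0 - b| / Y.
have t3 : 3 <= t by rewrite lerDl divr_ge0// ltW.
have x4 : 4 * 1 <= expR t by have := expR_ge1Dx t; lra.
have [u us] := HC 0 M (expR t) 1 (lexx 0) (ltW M0) (add0r M) (lexx 1) x4.
have := lb _ (ex_intro2 _ _ u us erefl).
rewrite expRK ln1 !(mul0r, mulr0, addr0, subr0).
have -> : alpha * (4 * t * M) = - (Y * 3) - `|C0 - b|.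
  have -> : alpha * (4 * t * M) = - (Y * t) by rewrite /Y; ring.
  have -> : Y * t = Y * 3 + `|C0 - b| by rewrite /t; field; rewrite gt_eqF.
  by ring.
have := ler_norm (C0 - b).
move: (energy _ _ _ _) => e; move: Y Y0 {t t3 x4} => Y Y0; lra.
Qed.

(** The expression is 4 alpha - 2 gamma - M beta at m = M and tends to 2 (2 alpha - gamma - M beta)
    as m goes to 0: the two entries of the minimum correspond to these two extremes. *)
Lemma mass_split (alpha beta gamma M : R) : 0 < M ->
  Num.min (2 * alpha - gamma) (4 * alpha - 2 * gamma) < M * beta ->
  exists2 m : R, 0 < m <= M & 4 * alpha - 2 * gamma - beta * (2 * M - m) < 0.
Proof.
move=> M0; rewrite gt_min => /orP[h|h]; last first.
  by exists M; [rewrite M0 lexx|move: h; lra].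
have [b0|b0] := lerP beta 0.
  (* For beta <= 0 the inequality 2 alpha - gamma < M beta makes the expression at m = M smaller
     than M beta, hence negative. *)
  by exists M; [rewrite M0 lexx|nra].
(* The slack M beta - (2 alpha - gamma) enters twice, so a perturbation beta m up to one copy of it
   keeps the sign. *)
pose m := Num.min M ((M * beta - (2 * alpha - gamma)) / beta).
have m0 : 0 < m by rewrite lt_min M0 divr_gt0// subr_gt0.
have mle : m * beta <= M * beta - (2 * alpha - gamma).
  by rewrite -ler_pdivlMr// /m ge_min lexx orbT.
exists m; first by rewrite m0 /m ge_min lexx.
move: h mle; lra.
Qed.

Lemma energy_unbounded_of_min_lt (sc : scalars) (alpha beta gamma M : R) :
  0 < M -> Num.min (2 * alpha - gamma) (4 * alpha - 2 * gamma) < M * beta ->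
  ~ energy_bounded_below sc alpha beta gamma M.
Proof.
move=> M0 /(mass_split M0)[m /andP[m0 mM] Xlt] [b lb].
have [C0 HC] := trial_energy_le sc alpha beta gamma M0.
pose Y := - (m * (4 * alpha - 2 * gamma - beta * (2 * M - m))).
have Y0 : 0 < Y by rewrite oppr_gt0 pmulr_rlt0.
(* The contribution of ln 4 coming from x0 = 4 s; what remains is linear in t = ln s with slope -
   Y. *)
pose C1 := alpha * (4 * ln 4 * m) - beta * (2 * ln 4 * ((M - m) * m)).
pose t := 1 + `|C0 + C1 - b| / Y.
have t0 : 0 <= t by rewrite addr_ge0// divr_ge0// ltW.
have s1 : 1 <= expR t by rewrite -expR0 ler_expR.
have m10 : 0 <= M - m by rewrite subr_ge0.
have [u us] := HC (M - m) m (4 * expR t) (expR t) m10 (ltW m0) (subrK m M) s1 (lexx _).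
have := lb _ (ex_intro2 _ _ u us erefl).
rewrite lnM ?posrE ?expR_gt0// expRK.
have -> : alpha * (4 * (ln 4 + t) * m) -
    beta * (2 * (ln 4 + t) * ((M - m) * m) + t * (m * m)) - gamma * (2 * t * m) =
    C1 - Y * t by rewrite /C1 /Y; ring.
have -> : Y * t = Y + `|C0 + C1 - b| by rewrite /t; field; rewrite gt_eqF.
have := ler_norm (C0 + C1 - b).
move: (energy _ _ _ _) C1 Y Y0 {t t0 s1 us} => e C1 Y Y0; lra.
Qed.

End unbounded.

Theorem theorem10 (R : realType) (K : scalars) (alpha beta gamma M : R)
  (hM : 0 < M) :
  ((alpha < 0 \/
    (0 <= alpha /\
     Num.min (2 * alpha - gamma) (4 * alpha - 2 * gamma) < M * beta)) ->
   ~ energy_bounded_below K alpha beta gamma M)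
  /\
  (((alpha = 0 /\ beta <= 0 /\ M * beta + 2 * gamma <= 0) \/
    (0 < alpha /\
     ((gamma <= 0 /\ M * beta <= 2 * alpha) \/
      (0 < gamma /\ M * beta <= 4 * alpha - 2 * gamma /\
       M * beta < 2 * alpha - gamma)))) ->
   energy_bounded_below K alpha beta gamma M).
Proof.
split=> [[a0|[_ hmin]]|h].
- exact: energy_unbounded_of_alpha_lt0.
- exact: energy_unbounded_of_min_lt.
- exact: energy_bounded_below_of.
Qed.
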